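(* Let $s\in(0,1)$, $N>2s$, $\alpha\in(0,N)$, $\varepsilon>0$ and $V\in C(\mathbb{R}^N,[0,+\infty))$. If $$p\in\Big(1,1+\frac{s+\frac{\alpha}{2}}{N-2s}\Big)\cup\Big[2,1+\frac{\alpha}{N-2s}\Big)\quad\text{and}\quad\limsup_{|x|\to\infty}(1+|x|^{2s})V(x)=0,$$ then the equation $$\varepsilon^{2s}(-\Delta)^su+Vu=\varepsilon^{-\alpha}(I_\alpha*|u|^p)|u|^{p-2}u\quad\text{in }\mathbb{R}^N$$ has no nonnegative nontrivial continuous weak solutions.
   Context: $I_\alpha(x)=\frac{1}{|x|^{N-\alpha}}$ and $(-\Delta)^su(x)=2\lim_{r\to0}\int_{\mathbb{R}^N\setminus B_r(x)}\frac{u(x)-u(y)}{|x-y|^{N+2s}}\,dy$ (multiplicative normalizing constants are dropped). $[u]_s^2=\iint_{\mathbb{R}^{2N}}\frac{|u(x)-u(y)|^2}{|x-y|^{N+2s}}\,dx\,dy$, $\dot H^s(\mathbb{R}^N)=\{u\in L^{2N/(N-2s)}(\mathbb{R}^N):[u]_s<\infty\}$, and $H^s_{V,\varepsilon}(\mathbb{R}^N)=\{u\in\dot H^s(\mathbb{R}^N):\int_{\mathbb{R}^N}V|u|^2<\infty\}$ with inner product $$\langle u,v\rangle_\varepsilon=\varepsilon^{2s}\iint_{\mathbb{R}^{2N}}\frac{(u(x)-u(y))(v(x)-v(y))}{|x-y|^{N+2s}}\,dx\,dy+\int_{\mathbb{R}^N}Vuv.$$ A weak solution is a $u\in H^s_{V,\varepsilon}(\mathbb{R}^N)$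 with $\langle u,\varphi\rangle_\varepsilon=\varepsilon^{-\alpha}\int_{\mathbb{R}^N}(I_\alpha*|u|^p)|u|^{p-2}u\varphi$ for all $\varphi\in H^s_{V,\varepsilon}(\mathbb{R}^N)$. The interval $[2,1+\frac{\alpha}{N-2s})$ is empty if its right endpoint is at most $2$. *)

(* Defs.v *)
From HB Require Import structures.
From mathcomp Require Import all_boot all_order all_algebra.
From mathcomp Require Import all_classical all_reals all_analysis.

Set Implicit Arguments.
Unset Strict Implicit.
Unset Printing Implicit Defensive.

Import Order.TTheory GRing.Theory Num.Theory.
Import numFieldNormedType.Exports.

Local Open Scope classical_set_scope.
Local Open Scope ring_scope.

(* R^N is 'rV[R]_N, with the product topology of the library.  The library    *)
(* norm `|x| on row vectors is the sup norm; [enorm] is the Euclidean one.    *)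
Definition enorm (R : realType) (N : nat) (x : 'rV[R]_N) : R :=
  Num.sqrt (\sum_(i < N) x 0 i ^+ 2).

(* The sigma-algebra on R^N is generated by the coordinates, i.e., it is the  *)
(* N-fold product of the Borel sigma-algebra of R (= the Borel sets of R^N).  *)
Definition rV_display : measure_display -> measure_display.
Proof. exact. Qed.

Section measurable_rV.
Context {R : realType} (N : nat).

Let coord_rV (i : 'I_N) (x : 'rV[R]_N) : R := x 0 i.

Let rV_set0 : g_sigma_preimage coord_rV set0.
Proof. exact: sigma_algebra0. Qed.

Let rV_setC A : g_sigma_preimage coord_rV A -> g_sigma_preimage coord_rV (~` A).
Proof. exact: sigma_algebraC. Qed.

Let rV_bigcup (F : (set 'rV[R]_N)^nat) :
  (forall i, g_sigma_preimage coord_rV (F i)) ->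
  g_sigma_preimage coord_rV (\bigcup_i (F i)).
Proof. exact: sigma_algebra_bigcup. Qed.

HB.instance Definition _ :=
  @isMeasurable.Build (rV_display default_measure_display) 'rV[R]_N
    (g_sigma_preimage coord_rV) rV_set0 rV_setC rV_bigcup.

Lemma measurable_coord_rV (i : 'I_N) :
  measurable_fun [set: 'rV[R]_N] (fun x : 'rV[R]_N => x 0 i).
Proof.
move=> _ Y mY; rewrite setTI; apply: sub_sigma_algebra => /=.
rewrite -bigcup_seq/=; exists i => /=; first by rewrite mem_index_enum.
by exists Y => //; rewrite setTI.
Qed.

Lemma measurable_fun_rVP d (T : measurableType d) (f : T -> 'rV[R]_N) :
  (forall i, measurable_fun [set: T] (fun t => f t 0 i)) ->
  measurable_fun [set: T] f.
Proof.
move=> mf _ A mA; rewrite setTI.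
suff : g_sigma_preimage coord_rV `<=` [set B | measurable (f @^-1` B)].
  exact.
apply: smallest_sub.
  split => /=.
  - by rewrite preimage_set0.
  - by move=> B mB; rewrite setTD preimage_setC; exact: measurableC.
  - by move=> F mF; rewrite preimage_bigcup; exact: bigcup_measurable.
rewrite -bigcup_seq/= => B [i _ [Y mY <-]] /=.
by rewrite setTI -[X in measurable X]setTI; exact: mf.
Qed.

End measurable_rV.

(* Lebesgue measure on R^N: the N-fold product of the Lebesgue measure of R.  *)
Section lebesgue_rV.
Context {R : realType}.

Definition cons_rV (n : nat) (z : measurableTypeR R * 'rV[R]_n) : 'rV[R]_n.+1 :=
  \row_i (if unlift ord0 i is Some j then z.2 0 j else z.1).

Definition uncons_rV (n : nat) (x : 'rV[R]_n.+1) :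
    measurableTypeR R * 'rV[R]_n :=
  (x 0 ord0, \row_i x 0 (lift ord0 i)).

Lemma cons_rV0 n (z : measurableTypeR R * 'rV[R]_n) : cons_rV z 0 ord0 = z.1.
Proof. by rewrite mxE unlift_none. Qed.

Lemma cons_rVS n (z : measurableTypeR R * 'rV[R]_n) (i : 'I_n) :
  cons_rV z 0 (lift ord0 i) = z.2 0 i.
Proof. by rewrite mxE liftK. Qed.

Lemma cons_rVK n : cancel (@cons_rV n) (@uncons_rV n).
Proof.
move=> z; rewrite /uncons_rV cons_rV0 [RHS]surjective_pairing; congr pair.
by apply/rowP => i; rewrite mxE cons_rVS.
Qed.

Lemma measurable_cons_rV n : measurable_fun setT (@cons_rV n).
Proof.
apply: measurable_fun_rVP => i.
have [j ->|->] := unliftP ord0 i.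
  rewrite (_ : (fun _ => _) = (fun x : 'rV[R]_n => x 0 j) \o snd).
    exact: measurableT_comp (measurable_coord_rV j) measurable_snd.
  by apply/funext => z; rewrite cons_rVS.
rewrite (_ : (fun _ => _) = fst); first exact: measurable_fst.
by apply/funext => z; rewrite cons_rV0.
Qed.

Lemma measurable_uncons_rV n : measurable_fun setT (@uncons_rV n).
Proof.
apply/measurable_fun_pairP; split; first exact: measurable_coord_rV.
apply: measurable_fun_rVP => i.
rewrite (_ : (fun _ => _) = (fun x : 'rV[R]_n.+1 => x 0 (lift ord0 i))).
  exact: measurable_coord_rV.
by apply/funext => x /=; rewrite mxE.
Qed.

Section succ.
Variables (n : nat) (m : {sigma_finite_measure set 'rV[R]_n -> \bar R}).

Definition lebesgue_rV_succ : set 'rV[R]_n.+1 -> \bar R :=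
  pushforward (lebesgue_measure \x m)%E (@cons_rV n).

Let succ0 : lebesgue_rV_succ set0 = 0%E.
Proof. by rewrite /lebesgue_rV_succ /pushforward preimage_set0 measure0. Qed.

Let succ_ge0 A : (0 <= lebesgue_rV_succ A)%E.
Proof. by rewrite /lebesgue_rV_succ /pushforward; exact: measure_ge0. Qed.

Let succ_sigma_additive : semi_sigma_additive lebesgue_rV_succ.
Proof.
move=> F mF tF mUF; rewrite /lebesgue_rV_succ /pushforward preimage_bigcup.
apply: measure_semi_sigma_additive.
- by move=> k; rewrite -[X in measurable X]setTI; exact: measurable_cons_rV.
- apply/trivIsetP => /= i j _ _ ij; rewrite -preimage_setI.
  by move/trivIsetP : tF => /(_ _ _ _ _ ij) ->//; rewrite preimage_set0.
- rewrite -preimage_bigcup -[X in measurable X]setTI.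
  exact: measurable_cons_rV.
Qed.

HB.instance Definition _ := isMeasure.Build _ _ _ lebesgue_rV_succ
  succ0 succ_ge0 succ_sigma_additive.

Let succ_sigma_finite : sigma_finite setT lebesgue_rV_succ.
Proof.
have /sigma_finiteP[F [TF ndF Foo]] :=
  sigma_finiteT (@lebesgue_measure R : {sigma_finite_measure set _ -> \bar R}).
have /sigma_finiteP[G [TG ndG Goo]] := sigma_finiteT m.
exists (fun k => @uncons_rV n @^-1` (F k `*` G k)).
  rewrite -preimage_bigcup [X in _ @^-1` X](_ : _ = setT) ?preimage_setT//.
  rewrite -subTset => -[x y] _.
  have [k _ Fkx] : (\bigcup_k F k) x by rewrite -TF.
  have [l _ Gly] : (\bigcup_k G k) y by rewrite -TG.
  exists (maxn k l) => //; split => /=.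
    by move: x Fkx; exact/subsetPset/ndF/leq_maxl.
  by move: y Gly; exact/subsetPset/ndG/leq_maxr.
move=> k; have [mFk Fkoo] := Foo k; have [mGk Gkoo] := Goo k; split.
  rewrite -[X in measurable X]setTI.
  by apply: measurable_uncons_rV => //; exact: measurableX.
rewrite /lebesgue_rV_succ /pushforward -comp_preimage.
rewrite (_ : _ \o _ = id); last by apply/funext => z /=; rewrite cons_rVK.
by rewrite preimage_id product_measure1E// lte_mul_pinfty// ge0_fin_numE.
Qed.

HB.instance Definition _ := @Measure_isSigmaFinite.Build _ _ _ lebesgue_rV_succ
  succ_sigma_finite.

End succ.

Fixpoint lebesgue_rV (N : nat) : {sigma_finite_measure set 'rV[R]_N -> \bar R} :=
  match N with
  | 0 => \d_(0 : 'rV[R]_0)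
  | n.+1 => lebesgue_rV_succ (lebesgue_rV n)
  end.

Lemma lebesgue_rV_box (N : nat) (A : 'I_N -> set (measurableTypeR R)) :
  (forall i, measurable (A i)) ->
  lebesgue_rV N [set x | forall i, A i (x 0 i)] =
  (\prod_(i < N) lebesgue_measure (A i))%E.
Proof.
elim: N A => [|n IH] A mA /=.
  by rewrite big_ord0 diracE mem_set// => -[].
have mB : measurable [set x : 'rV[R]_n | forall i, A (lift ord0 i) (x 0 i)].
  rewrite (_ : [set _ | _] = \bigcap_(i in [set: 'I_n])
      ((fun x : 'rV[R]_n => x 0 i) @^-1` A (lift ord0 i))).
    apply: fin_bigcap_measurable => // i _.
    rewrite -[X in measurable X]setTI.
    by apply: measurable_coord_rV => //; exact: mA.
  apply/seteqP; split => x /=; first by move=> xA i _; exact: xA.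
  by move=> xA i; apply: (xA i).
rewrite big_ord_recl -IH; last by move=> i; exact: mA.
rewrite -product_measure1E//.
congr (product_measure1 _ _ _); apply/seteqP; split => z /=.
  move=> zA; split; first by rewrite -cons_rV0; exact: zA.
  by move=> i; rewrite -cons_rVS; exact: zA.
move=> -[z1 z2] i; have [j ->|->] := unliftP ord0 i.
  by rewrite cons_rVS.
by rewrite cons_rV0.
Qed.

End lebesgue_rV.

(* The filter "|x| -> oo" on R^N.                                             *)
Definition enorm_pinfty (R : realType) (N : nat) : set_system 'rV[R]_N :=
  filter_from [set: R] (fun M => [set x | M < enorm x]).

Section choquard.
Context {R : realType} (N : nat).
Local Notation RN := 'rV[R]_N.
Local Notation mu := (@lebesgue_rV R N).

(* At x = 0 the kernel 1 / |x|^(N - alpha) takes the (junk) value 0.          *)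
Definition riesz_kernel (alpha : R) (x : RN) : R :=
  (enorm x `^ (N%:R - alpha))^-1.

(* (I_alpha * f)(x) for f >= 0, with values in [0, +oo].                      *)
Definition riesz_potential (alpha : R) (f : RN -> R) (x : RN) : \bar R :=
  (\int[mu]_y (riesz_kernel alpha (x - y) * f y)%:E)%E.

Definition gagliardo_sq (s : R) (u : RN -> R) : \bar R :=
  (\int[(mu \x mu)%E]_z
    (`|u z.1 - u z.2| ^+ 2 / enorm (z.1 - z.2) `^ (N%:R + 2 * s))%:E)%E.

Definition Hdot (s : R) : set (RN -> R) :=
  [set u | u \in Lfun mu (2 * N%:R / (N%:R - 2 * s))%:E /\
           (gagliardo_sq s u < +oo)%E].

(* The set does not depend on eps, only the inner product does.               *)
Definition HV (s : R) (V : RN -> R) : set (RN -> R) :=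
  [set u | Hdot s u /\ (\int[mu]_x (V x * `|u x| ^+ 2)%:E < +oo)%E].

Definition HV_inner (s eps : R) (V : RN -> R) (u v : RN -> R) : R :=
  eps `^ (2 * s) *
    \int[(mu \x mu)%E]_z ((u z.1 - u z.2) * (v z.1 - v z.2) /
                       enorm (z.1 - z.2) `^ (N%:R + 2 * s)) +
  \int[mu]_x (V x * u x * v x).

(* Since oo - oo = -oo in \bar R, equality with a real number forces the      *)
(* right-hand integral to converge absolutely.                                *)
Definition weak_solution (s alpha eps p : R) (V : RN -> R) (u : RN -> R) :=
  HV s V u /\
  forall phi, HV s V phi ->
    ((HV_inner s eps V u phi)%:E =
     (eps `^ (- alpha))%:E *
     \int[mu]_x (riesz_potential alpha (fun y => `|u y| `^ p)%R x *
                 (`|u x| `^ (p - 2) * u x * phi x)%:E))%E.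

End choquard.

(* Main.v *)
Require Import Defs.
From mathcomp Require Import all_boot all_order all_algebra.
From mathcomp Require Import all_classical all_reals all_analysis.
From mathcomp Require Import measurable_realfun lra ring.
Set Implicit Arguments.
Unset Strict Implicit.
Unset Printing Implicit Defensive.
Import Order.TTheory GRing.Theory Num.Theory.
Import numFieldNormedType.Exports.
Local Open Scope classical_set_scope.
Local Open Scope ring_scope.

(** A nonnegative solution [u <> 0] would have to decay at infinity at two
incompatible rates. Both are obtained by testing the equation with decreasing
functions of [u], cut off on a large scale, so that [test_inequality] carries the
whole argument; all integrals are estimated with Tonelli's theorem and the volume
of cubes.

Write [w = u + t] with a small [t > 0], and let [eta] be a cutoff function at
scale [r]. Testing with [eta^2 (w^(-b) - M)_+] makes the Gagliardo form negative,
up to an error due to the variation of [eta]. The inequality [caccioppoli], which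
generalizes Picone's, also quantifies this negativity as a gain over all pairs
of points.

Fast decay. Take [b = 1] and [M = 0], and [eta] supported in a ball of radius
[2 r] whose center has norm [4 r]. Then the gain and the integral of
[(I_alpha * u^p) u^(p - 1) eta^2 / w] are [O(r^(N - 2s))], because [V] is
[O(|x|^(-2s))]. Since the kernel is nonlocal, the gain also bounds the product of
the integral of [1 / w] over the ball with the weighted mass of [u] elsewhere
([cross_estimate]). So if the mean of [u] at scale [r] were larger than [r^(-g)],
then [w] would be at least of order [r^(-g)] on most of the ball, and the Riesz
potential term would be too large provided that [g (p - 1) < s + alpha / 2], or
that [p >= 2] and [g (p - 2) < alpha - (N - 2s)]. The two ranges of [p] are those
for which some [g > N - 2s] satisfies one of these conditions ([exists_rate]).
Hence [u] decays faster than the fundamental solution [|x|^(-(N - 2s))]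
([mass_decay]).

Slow decay. For a supersolution of a linear equation whose potential is
[o(|x|^(-2s))] this is impossible. Take [b] in (0, 1) so small that
[g (1 - b) > N - 2s], [M = m^(-b)], and [eta = 1] on the ball of radius [r] about
the origin. The potential term lives where [w < m]. Far from the origin it is
absorbed by the gain through a fractional Hardy inequality ([hardy]); on a fixed
ball it is absorbed by the jumps to a ball where [u] is bounded below, if [m] is
small ([gain_le_err]). What remains is the bound of the gain by the cutoff error,
which is [O(r^(N - 2s - g (1 - b)))] by the fast decay ([err_decay]) and tends to
0, whereas the gain is bounded below independently of [r] ([gain_ge_mass]). *)


(** * Measurability and cubes in Euclidean space *)

Section measurability.
Context d (T : measurableType d) (R : realType).
Implicit Types f g : T -> R.

Lemma measurable_inv_fun f :
  measurable_fun setT f -> measurable_fun setT (fun x => (f x)^-1).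
Proof.
move=> mf.
rewrite (_ : (fun x => _) = fun x => if 0 <= f x then f x `^ (-1)
   else - ((- f x) `^ (-1))).
  apply: measurable_fun_ifT.
  - exact: measurable_fun_ler.
  - by apply: (measurableT_comp (measurable_powR (-1))).
  - apply: measurable_funN.
    by apply: (measurableT_comp (measurable_powR (-1))); exact: measurable_funN.
apply/funext => x; case: ifPn => fx; first by rewrite powR_inv1.
rewrite powR_inv1 ?invrN ?opprK// oppr_ge0.
by move: fx; rewrite -ltNge => /ltW.
Qed.

(** These closure properties are restated for lambda-abstractions, the form in
which the syntax-directed tactic [measurable_step] meets them. *)
Lemma measurable_add_fun f g : measurable_fun setT f -> measurable_fun setT g ->
  measurable_fun setT (fun x => f x + g x).
Proof. exact: measurable_funD. Qed.

Lemma measurable_opp_fun f : measurable_fun setT f -> measurable_fun setT (fun x => - f x).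
Proof. exact: measurable_funN. Qed.

Lemma measurable_mul_fun f g : measurable_fun setT f -> measurable_fun setT g ->
  measurable_fun setT (fun x => f x * g x).
Proof. exact: measurable_funM. Qed.

Lemma measurable_exprn_fun n f : measurable_fun setT f -> measurable_fun setT (fun x => f x ^+ n).
Proof. exact: measurable_funX. Qed.

Lemma measurable_powR_fun p f : measurable_fun setT f -> measurable_fun setT (fun x => f x `^ p).
Proof. by move=> mf; apply: (measurableT_comp (measurable_powR p)). Qed.

Lemma measurable_max_fun f g : measurable_fun setT f -> measurable_fun setT g ->
  measurable_fun setT (fun x => Num.max (f x) (g x)).
Proof. exact: measurable_maxr. Qed.

Lemma measurable_min_fun f g : measurable_fun setT f -> measurable_fun setT g ->
  measurable_fun setT (fun x => Num.min (f x) (g x)).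
Proof. exact: measurable_minr. Qed.

Lemma measurable_norm_fun f : measurable_fun setT f -> measurable_fun setT (fun x => `|f x|).
Proof. by move=> mf; apply: (measurableT_comp (@normr_measurable R setT)). Qed.

Lemma measurable_if_fun (b : T -> bool) f g : measurable_fun setT b ->
  measurable_fun setT f -> measurable_fun setT g ->
  measurable_fun setT (fun x => if b x then f x else g x).
Proof. exact: measurable_fun_ifT. Qed.

Lemma measurable_le_fun f g : measurable_fun setT f -> measurable_fun setT g ->
  measurable_fun setT (fun x => f x <= g x).
Proof. exact: measurable_fun_ler. Qed.

Lemma measurable_lt_fun f g : measurable_fun setT f -> measurable_fun setT g ->
  measurable_fun setT (fun x => f x < g x).
Proof. exact: measurable_fun_ltr. Qed.

Lemma measurable_EFin_fun f : measurable_fun setT f -> measurable_fun setT (fun x => (f x)%:E).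
Proof. by move=> mf; apply/measurable_EFinP. Qed.

End measurability.

Ltac measurable_step :=
  lazymatch goal with
  | |- measurable_fun _ (fun x => EFin _) => apply: measurable_EFin_fun
  | |- measurable_fun _ (fun x => if _ then _ else _) => apply: measurable_if_fun
  | |- measurable_fun _ (fun x => Num.max _ _) => apply: measurable_max_fun
  | |- measurable_fun _ (fun x => Num.min _ _) => apply: measurable_min_fun
  | |- measurable_fun _ (fun x => (_ <= _)%R) => apply: measurable_le_fun
  | |- measurable_fun _ (fun x => (_ < _)%R) => apply: measurable_lt_fun
  | |- measurable_fun _ (fun x => _ && _) => apply: measurable_and
  | |- measurable_fun _ (fun x => ~~ _) => apply: measurable_neg
  | |- measurable_fun _ (fun x => (_ + _)%R) => apply: measurable_add_fun
  | |- measurable_fun _ (fun x => (- _)%R) => apply: measurable_opp_fun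
  | |- measurable_fun _ (fun x => (_ * _)%R) => apply: measurable_mul_fun
  | |- measurable_fun _ (fun x => (_ ^-1)%R) => apply: measurable_inv_fun
  | |- measurable_fun _ (fun x => (_ ^+ _)%R) => apply: measurable_exprn_fun
  | |- measurable_fun _ (fun x => (_ `^ _)%R) => apply: measurable_powR_fun
  | |- measurable_fun _ (fun x => Num.norm _) => apply: measurable_norm_fun
  end.

Section rV_space.
Context (R : realType) (N : nat).
Local Notation RN := 'rV[R]_N.
Local Notation mu := (@lebesgue_rV R N).
Implicit Types (x y c : RN) (r : R).

Lemma rV_norm_le x r : 0 <= r -> (`|x| <= r) <-> (forall i, `|x 0 i| <= r).
Proof.
move=> r0; rewrite -[`|x|]/(mx_norm x) mx_normrE; split.
  move=> xr i; apply: le_trans xr.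
  exact: (@le_bigmax _ _ _ 0 (fun ij : 'I_1 * 'I_N => `|x ij.1 ij.2|) (0, i)).
by move=> xr; apply: bigmax_le => // -[i j] _ /=; rewrite ord1.
Qed.

Lemma rV_coord_le x i : `|x 0 i| <= `|x|.
Proof. by have [/(_ (lexx _))] := @rV_norm_le x `|x| (normr_ge0 _); exact. Qed.

Lemma norm_rV_forall x r : 0 <= r ->
  (`|x| <= r) = [forall i, `|x 0 i| <= r].
Proof. by move=> r0; apply/idP/forallP => /(rV_norm_le _ r0). Qed.

Lemma measurable_forall_fun d (T : measurableType d) n (b : 'I_n -> T -> bool) :
  (forall i, measurable_fun setT (b i)) ->
  measurable_fun setT (fun t => [forall i, b i t]).
Proof.
move=> mb; apply: (@measurable_fun_bool _ _ _ _ true).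
rewrite setTI (_ : _ @^-1` _ = \bigcap_(i in [set: 'I_n]) (b i @^-1` [set true])).
  apply: fin_bigcap_measurable => // i _.
  by rewrite -[X in measurable X]setTI; exact: mb.
apply/seteqP; split => x /=; first by move=> /forallP h i _ /=; rewrite h.
by move=> h; apply/forallP => i; rewrite h.
Qed.

Lemma measurable_norm_rV d (T : measurableType d) (f : T -> RN) :
  measurable_fun setT f -> measurable_fun setT (fun t => `|f t|).
Proof.
move=> mf; apply: (@measurability _ _ _ _ _ _ (@RGenOInfty.G R)).
  exact: RGenOInfty.measurableE.
move=> _ [_ [r ->] <-]; rewrite setTI.
have [r0|r0] := leP 0 r; last first.
  rewrite (_ : _ @^-1` _ = setT) //; apply/seteqP; split => // t _ /=.
  by rewrite in_itv/= andbT (lt_le_trans r0).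
rewrite (_ : _ @^-1` _ = ~` ((fun t => [forall i, `|f t 0 i| <= r]) @^-1` [set true])).
  apply: measurableC; rewrite -[X in measurable X]setTI.
  apply: measurable_forall_fun => // i.
  apply: measurable_le_fun => //; apply: measurable_norm_fun.
  exact: (measurableT_comp (measurable_coord_rV i) mf).
apply/seteqP; split => t /=; rewrite in_itv/= andbT.
  by move=> h; rewrite -norm_rV_forall// => h'; move: h; rewrite ltNge h'.
by rewrite -norm_rV_forall// ltNge => /negP.
Qed.

Lemma measurable_subr_rV d (T : measurableType d) (f g : T -> RN) :
  measurable_fun setT f -> measurable_fun setT g ->
  measurable_fun setT (fun t => f t - g t).
Proof.
move=> mf mg; apply: measurable_fun_rVP => i.
under eq_fun do rewrite !mxE.
by apply: measurable_add_fun; [|apply: measurable_opp_fun]; exact: (measurableT_comp (measurable_coord_rV i)).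
Qed.

Lemma measurable_enorm_rV d (T : measurableType d) (f : T -> RN) :
  measurable_fun setT f -> measurable_fun setT (fun t => enorm (f t)).
Proof.
move=> mf; rewrite /enorm.
under eq_fun => t do rewrite -powR12_sqrt ?(sumr_ge0 _ (fun i _ => sqr_ge0 _))//.
apply: measurable_powR_fun; apply: measurable_sum => i.
by apply: measurable_exprn_fun; exact: (measurableT_comp (measurable_coord_rV i)).
Qed.

Lemma enorm_ge0 x : 0 <= enorm x.
Proof. exact: sqrtr_ge0. Qed.

Lemma norm_le_enorm x : `|x| <= enorm x.
Proof.
apply/rV_norm_le => [|i]; first exact: enorm_ge0.
rewrite -sqrtr_sqr ler_wsqrtr// (bigD1 i)//= lerDl.
by apply: sumr_ge0 => j _; exact: sqr_ge0.
Qed.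

Lemma enorm_le_norm x : enorm x <= Num.sqrt N%:R * `|x|.
Proof.
rewrite -[X in _ * X](@ger0_norm _ `|x|)// -sqrtr_sqr -sqrtrM ?ler0n//.
apply: ler_wsqrtr; rewrite mulr_natl.
rewrite -[X in _ *+ X](card_ord N) -sumr_const; apply: ler_sum => i _.
by rewrite -real_normK ?num_real// lerXn2r ?nnegrE// rV_coord_le.
Qed.

Lemma lebesgue_rV_cube (a : 'I_N -> R) r : 0 <= r ->
  mu [set y | forall i, y 0 i \in `[a i, a i + r]] = (r ^+ N)%:E.
Proof.
move=> r0.
rewrite (lebesgue_rV_box (A := fun i => [set` `[a i, a i + r]])) //=.
rewrite (eq_bigr (fun=> r%:E)); last first.
  move=> i _; rewrite lebesgue_measure_itv/= lte_fin ltrDl.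
  case: ltP => [_|]; first by rewrite -EFinB addrC addKr.
  by rewrite le_eqVlt ltNge r0 orbF => /eqP ->.
by rewrite prodEFin big_const_ord iter_mulr_1.
Qed.

Lemma lebesgue_rV_ball c r : 0 <= r ->
  mu [set y | `|y - c| <= r] = ((2 * r) ^+ N)%:E.
Proof.
move=> r0.
rewrite -(@lebesgue_rV_cube (fun i => c 0 i - r) (2 * r)) ?mulr_ge0//; congr (mu _).
apply/seteqP; split => y /=.
  move=> /(rV_norm_le _ r0) h i; move: (h i); rewrite !mxE ler_norml in_itv/=.
  lra.
move=> h; apply/(rV_norm_le _ r0) => i; move: (h i).
rewrite !mxE ler_norml in_itv/=; lra.
Qed.

(** An open set is the union of the countably many cubes with rational center
and inverse-integer size that it contains, and cubes are measurable for the
sigma-algebra generated by the coordinates. *)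
Lemma continuous_measurable_rV (f : RN -> R) :
  continuous f -> measurable_fun setT f.
Proof.
move=> cf; apply: (@measurability _ _ _ _ _ _ (@RGenOInfty.G R)).
  exact: RGenOInfty.measurableE.
move=> _ [_ [a ->] <-]; rewrite setTI.
set U := _ @^-1` _.
have Unbhs x : U x -> nbhs x U.
  rewrite /U /= in_itv/= andbT => ax; apply: (cf x).
  apply: open_nbhs_nbhs; split; last by rewrite /= in_itv/= andbT.
  by rewrite set_itvE; exact: open_gt.
pose q2r (q : 'rV[rat]_N) : RN := map_mx ratr q.
pose B (qk : 'rV[rat]_N * nat) : set RN :=
  [set y | `|y - q2r qk.1| <= qk.2.+1%:R^-1].
have mB qk : measurable (B qk).
  rewrite (_ : B qk = (fun y => `|y - q2r qk.1| <= qk.2.+1%:R^-1) @^-1` [set true])//.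
  rewrite -[X in measurable X]setTI; apply: measurable_le_fun => //.
  by apply: measurable_norm_rV; apply: measurable_subr_rV.
rewrite (_ : U = \bigcup_qk (if `[< B qk `<=` U >] then B qk else set0)); last first.
  apply/seteqP; split => [x Ux|x [qk _]]; last by case: asboolP => // + ?; exact.
  have /nbhs_ballP[e /= e0 xeU] := Unbhs x Ux.
  have [k ke] : exists k : nat, k.+1%:R^-1 < e / 2.
    exists (Num.truncn (e / 2)^-1); rewrite invf_plt ?posrE ?divr_gt0//.
    exact: truncnS_gt.
  have /fin_all_exists[q qP] : forall i : 'I_N, exists q : rat,
      `|x 0 i - ratr q| < k.+1%:R^-1.
    move=> i; have k0 : 0 < k.+1%:R^-1 :> R by rewrite invr_gt0.
    have [|q] := @rat_in_itvoo R (x 0 i - k.+1%:R^-1) (x 0 i + k.+1%:R^-1).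
      by rewrite ltrBlDr -addrA ltrDl addr_gt0.
    rewrite in_itv/= => /andP[h1 h2]; exists q.
    by rewrite ltr_distlC h1 h2.
  pose qv : 'rV[rat]_N := \row_i q i.
  have xq : `|x - q2r qv| <= k.+1%:R^-1.
    by apply/rV_norm_le => // i; rewrite !mxE ltW.
  exists (qv, k) => //; case: asboolP => // -[].
  move=> y /= yq; apply: xeU; rewrite -ball_normE /ball_/=.
  rewrite (_ : x - y = (x - q2r qv) - (y - q2r qv)); last first.
    by rewrite opprB addrA subrK.
  apply: (le_lt_trans (ler_normB _ _)).
  rewrite [ltRHS](splitr e); apply: ltr_leD; last by rewrite (le_trans yq)// ltW.
  exact: le_lt_trans xq ke.
apply: countable_bigcupT_measurable => // qk.
by case: asboolP.
Qed.
End rV_space.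


(** * Dyadic estimates of singular integrals *)

Section real_integrands.
Context d (T : measurableType d) (R : realType).
Variable mu : {measure set T -> \bar R}.
Implicit Types f g : T -> R.

Lemma int_ge0 f : (forall x, 0 <= f x) -> (0 <= \int[mu]_x (f x)%:E)%E.
Proof. by move=> f0; apply: integral_ge0 => x _; rewrite lee_fin. Qed.

Lemma le_int f g : measurable_fun setT f -> measurable_fun setT g ->
  (forall x, 0 <= f x) -> (forall x, f x <= g x) ->
  (\int[mu]_x (f x)%:E <= \int[mu]_x (g x)%:E)%E.
Proof.
move=> mf mg f0 fg; apply: ge0_le_integral => //.
- by move=> x _; rewrite lee_fin.
- exact: measurable_EFin_fun.
- exact: measurable_EFin_fun.
- by move=> x _; rewrite lee_fin.
Qed.

Lemma intD f g : measurable_fun setT f -> measurable_fun setT g ->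
  (forall x, 0 <= f x) -> (forall x, 0 <= g x) ->
  (\int[mu]_x (f x + g x)%:E = \int[mu]_x (f x)%:E + \int[mu]_x (g x)%:E)%E.
Proof.
move=> mf mg f0 g0; under eq_integral do rewrite EFinD.
rewrite ge0_integralD//; try (by move=> x _; rewrite lee_fin); exact: measurable_EFin_fun.
Qed.

Lemma intZ k f : measurable_fun setT f -> 0 <= k -> (forall x, 0 <= f x) ->
  (\int[mu]_x (k * f x)%:E = k%:E * \int[mu]_x (f x)%:E)%E.
Proof.
move=> mf k0 f0; under eq_integral do rewrite EFinM.
rewrite ge0_integralZl_EFin//; first by move=> x _; rewrite lee_fin.
exact: measurable_EFin_fun.
Qed.
End real_integrands.

Section series_bound.
Context d (T : measurableType d) (R : realType).
Variable mu : {measure set T -> \bar R}.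

Lemma int_if_cst (b : T -> bool) (h : R) : measurable_fun setT b -> 0 <= h ->
  (\int[mu]_x (if b x then h else 0)%:E = h%:E * mu [set x | b x])%E.
Proof.
move=> mb h0.
have mB : measurable [set x | b x].
  rewrite (_ : [set x | b x] = b @^-1` [set true])//.
  by rewrite -[X in measurable X]setTI; exact: mb.
rewrite (_ : (fun x => _) = fun x => (h * \1_[set y | b y] x)%:E); last first.
  apply/funext => x; rewrite indicE; case: ifPn => bx.
    by rewrite mem_set// mulr1.
  by rewrite memNset ?mulr0//; exact/negP.
by rewrite intZ// ?integral_indic ?setIT.
Qed.

(** Integrals of functions with an algebraic singularity or an algebraic decay
are estimated by covering the domain with countably many sets on which the
function is essentially constant. *)
Lemma int_le_geometric (f : T -> R) (b : nat -> T -> bool) (h : nat -> R)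
    (A q : R) :
  measurable_fun setT f -> (forall x, 0 <= f x) ->
  (forall j, measurable_fun setT (b j)) -> (forall j, 0 <= h j) ->
  (forall x, f x != 0 -> exists j, b j x /\ f x <= h j) ->
  0 <= A -> 0 < q < 1 ->
  (forall j, (h j)%:E * mu [set x | b j x] <= (A * q ^+ j)%:E)%E ->
  (\int[mu]_x (f x)%:E <= (A / (1 - q))%:E)%E.
Proof.
move=> mf f0 mb h0 fb A0 /andP[q0 q1] hA.
pose g j x : \bar R := (if b j x then h j else 0)%:E.
have g0 j x : (0 <= g j x)%E by rewrite /g lee_fin; case: ifP.
have mg j : measurable_fun setT (g j).
  by apply: measurable_EFin_fun; apply: measurable_if_fun.
apply: (@le_trans _ _ (\int[mu]_x (\sum_(0 <= j <oo) g j x))%E).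
  apply: ge0_le_integral => //.
  - by move=> x _; rewrite lee_fin.
  - exact: measurable_EFin_fun.
  - by apply: ge0_emeasurable_sum => // k x _ _; exact: g0.
  - move=> x _; have [->|/fb[j [bj fj]]] := eqVneq (f x) 0.
      by apply: nneseries_ge0 => k _ _; exact: g0.
    apply: (@le_trans _ _ (g j x)); first by rewrite /g bj lee_fin.
    apply: le_trans (nneseries_lim_ge j.+1 _); last by move=> *; exact: g0.
    rewrite big_nat_recr//= leeDr//.
    by apply: sume_ge0 => k _; exact: g0.
rewrite integral_nneseries//.
apply: lime_le.
  apply: is_cvg_nneseries => k _ _; apply: integral_ge0 => x _; exact: g0.
near=> n; rewrite /g.
apply: (@le_trans _ _ (\sum_(0 <= k < n) (A * q ^+ k)%:E)%E).
  by apply: lee_sum => k _; rewrite int_if_cst.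
rewrite sumEFin lee_fin.
have := @geometric_le_lim R n A q A0 q0.
by rewrite ger0_norm ?(ltW q0)// => /(_ q1).
Unshelve. all: by end_near.
Qed.
End series_bound.

Section powR_extra.
Context (R : realType).
Implicit Types (x y a b z : R).

Lemma ler_of_eq (x y : R) : x = y -> x <= y.
Proof. by move=> ->. Qed.

Lemma expr_powR z a n : 0 <= z -> (z ^+ n) `^ a = (z `^ a) ^+ n.
Proof.
move=> z0; rewrite -(powR_mulrn n z0) -(powR_mulrn n (powR_ge0 z a)).
exact: powRAC.
Qed.

Lemma powR_lt1 x a : 1 < x -> a < 0 -> x `^ a < 1.
Proof.
move=> x1 a0; have x0 : 0 < x by apply: lt_trans x1.
by rewrite /powR gt_eqF// -expR0 ltr_expR nmulr_rlt0// ln_gt0.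
Qed.

Lemma powRNle a x y : 0 <= a -> 0 < x -> x <= y -> y `^ (- a) <= x `^ (- a).
Proof.
move=> a0 x0 xy; rewrite !powRN lef_pV2 ?posrE ?powR_gt0//.
  by apply: ge0_ler_powR => //; rewrite nnegrE ?ltW// (lt_le_trans x0).
exact: lt_le_trans xy.
Qed.

Lemma dyadic_bracket (t : R) : 1 <= t -> exists j : nat, 2 ^+ j <= t < 2 ^+ j.+1.
Proof.
move=> t1.
have ex : exists n : nat, t < 2 ^+ n :> R.
  exists (Num.truncn t).+1; apply: (lt_le_trans (truncnS_gt t)).
  by rewrite -natrX ler_nat ltnW// ltn_expl.
case: (ex_minnP ex) => -[|j] tj jmin; first by move: tj; rewrite expr0 ltNge t1.
exists j; rewrite tj andbT leNgt; apply/negP => /jmin.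
by rewrite ltnn.
Qed.
End powR_extra.

Section kernel.
Context (R : realType) (N : nat).
Local Notation RN := 'rV[R]_N.
Local Notation mu := (@lebesgue_rV R N).
Implicit Types (x y c : RN) (r a : R).

Lemma measurable_ball_norm c r : measurable_fun setT (fun y : RN => `|y - c| <= r).
Proof. by apply: measurable_le_fun => //; apply: measurable_norm_rV; apply: measurable_subr_rV. Qed.

(** On the dyadic shell of index [j] the integrand is at most [(2^j r)^(-a)],
and the shell lies in a cube of volume [4^N (2^j r)^N]. *)
Lemma int_far_power a : N%:R < a -> exists C : R, [/\ 0 < C & forall x r, 0 < r ->
  (\int[mu]_y (if (r <= `|y - x|)%R then `|y - x| `^ (- a) else 0)%:E
     <= (C * r `^ (N%:R - a))%:E)%E].
Proof.
move=> Na.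
pose q : R := 2 `^ (- a) * 2 ^+ N.
have a0 : 0 < a by apply: le_lt_trans Na.
have q0 : 0 < q by rewrite mulr_gt0// ?powR_gt0// exprn_gt0.
have q1 : q < 1.
  rewrite /q -powR_mulrn// -powRD ?pnatr_eq0 ?implybT//.
  by rewrite powR_lt1// ?ltr1n// addrC subr_lt0.
exists (4 ^+ N / (1 - q)); split.
  by rewrite divr_gt0// ?exprn_gt0// subr_gt0.
move=> x r r0.
have mn : measurable_fun setT (fun y : RN => `|y - x|).
  by apply: measurable_norm_rV; apply: measurable_subr_rV.
rewrite mulrAC; apply: (@int_le_geometric _ _ _ _ _
  (fun j y => `|y - x| <= 2 ^+ j.+1 * r) (fun j => (2 ^+ j * r) `^ (- a))).
- by repeat (measurable_step || exact: mn || exact: measurable_cst).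
- by move=> y; case: ifP => // _; exact: powR_ge0.
- by move=> j; exact: measurable_ball_norm.
- by move=> j; exact: powR_ge0.
- move=> y; case: ifPn; last by rewrite eqxx.
  move=> ry _; have [|j /andP[j1 j2]] := @dyadic_bracket R (`|y - x| / r).
    by rewrite ler_pdivlMr// mul1r.
  move: j1 j2; rewrite ler_pdivlMr// ltr_pdivrMr// => j1 j2.
  exists j; split; first exact: ltW.
  by apply: powRNle => //; [exact: ltW|rewrite mulr_gt0// exprn_gt0].
- by rewrite mulr_ge0// ?powR_ge0// exprn_ge0.
- by rewrite q0.
- move=> j; rewrite [X in (_ * X <= _)%E](_ : _ = ((2 * (2 ^+ j.+1 * r)) ^+ N)%:E); last first.
    by apply: lebesgue_rV_ball; rewrite mulr_ge0 ?exprn_ge0 ?ltW.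
  rewrite -EFinM lee_fin powRM ?exprn_ge0 ?(ltW r0)// expr_powR//.
  rewrite exprS !exprMn -!exprM.
  rewrite powRD ?(gt_eqF r0) ?implybT// powR_mulrn ?(ltW r0)//.
  rewrite (_ : 4 ^+ N = 2 ^+ N * 2 ^+ N :> R); last first.
    by rewrite -exprMn -natrM.
  by rewrite [(j * N)%N]mulnC; apply: ler_of_eq; ring.
Qed.

Lemma int_near_power a : 0 <= a -> a < N%:R + 2 -> exists C : R, [/\ 0 < C & forall x r, 0 < r ->
  (\int[mu]_y (if (`|y - x| < r)%R then `|y - x| ^+ 2 * `|y - x| `^ (- a) else 0)%:E
     <= (C * (r ^+ 2 * r `^ (N%:R - a)))%:E)%E].
Proof.
move=> a0 aN.
pose q : R := 2^-1 ^+ 2 * (2^-1 `^ (- a)) * 2^-1 ^+ N.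
have q0 : 0 < q by rewrite /q !mulr_gt0// ?powR_gt0// ?exprn_gt0// invr_gt0.
have h0 : 0 < 2^-1 :> R by rewrite invr_gt0.
have q1 : q < 1.
  rewrite /q -!powR_mulrn ?ltW// -!powRD ?(gt_eqF h0) ?implybT//.
  rewrite -[X in X `^ _]powR_inv1// -powRrM powR_lt1// ?ltr1n//.
  by rewrite mulN1r oppr_lt0; lra.
exists (2 ^+ N * 2^-1 `^ (- a) / (1 - q)); split.
  by rewrite divr_gt0// ?mulr_gt0// ?powR_gt0// ?exprn_gt0// subr_gt0.
move=> x r r0.
have mn : measurable_fun setT (fun y : RN => `|y - x|).
  by apply: measurable_norm_rV; apply: measurable_subr_rV.
rewrite mulrAC; apply: (@int_le_geometric _ _ _ _ _
  (fun j y => `|y - x| <= 2^-1 ^+ j * r)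
  (fun j => (2^-1 ^+ j * r) ^+ 2 * (2^-1 ^+ j.+1 * r) `^ (- a))).
- by repeat (measurable_step || exact: mn || exact: measurable_cst).
- by move=> y; case: ifP => // _; rewrite mulr_ge0// ?powR_ge0// exprn_ge0.
- by move=> j; exact: measurable_ball_norm.
- by move=> j; rewrite mulr_ge0// ?powR_ge0// sqr_ge0.
- move=> y; case: ifPn; last by rewrite eqxx.
  move=> yr; have [->|y0] := eqVneq `|y - x| 0.
    by rewrite expr0n mul0r eqxx.
  have {}y0 : 0 < `|y - x| by rewrite lt_def y0 normr_ge0.
  move=> _; have [|j /andP[j1 j2]] := @dyadic_bracket R (r / `|y - x|).
    by rewrite ler_pdivlMr// mul1r ltW.
  move: j1 j2; rewrite ler_pdivlMr// ltr_pdivrMr// => j1 j2.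
  have j1' : `|y - x| <= 2^-1 ^+ j * r.
    by rewrite exprVn mulrC ler_pdivlMr ?exprn_gt0// mulrC.
  exists j; split => //.
  apply: ler_pM; rewrite ?sqr_ge0 ?powR_ge0//.
    by rewrite lerXn2r// nnegrE// mulr_ge0 ?exprn_ge0// ltW.
  apply: powRNle => //; first by rewrite mulr_gt0// exprn_gt0.
  by rewrite exprVn mulrC ler_pdivrMr ?exprn_gt0// mulrC ltW.
- by rewrite !mulr_ge0// ?powR_ge0// ?exprn_ge0// ltW.
- by rewrite q0.
- move=> j; rewrite [X in (_ * X <= _)%E](_ : _ = ((2 * (2^-1 ^+ j * r)) ^+ N)%:E); last first.
    by apply: lebesgue_rV_ball; rewrite mulr_ge0 ?exprn_ge0 ?ltW.
  rewrite -EFinM lee_fin exprSr !powRM ?mulr_ge0 ?exprn_ge0 ?(ltW r0) ?(ltW h0)// expr_powR ?(ltW h0)//.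
  rewrite !exprMn -!exprM.
  rewrite powRD ?(gt_eqF r0) ?implybT// powR_mulrn ?(ltW r0)//.
  rewrite [(j * N)%N]mulnC muln1; apply: ler_of_eq.
  by rewrite [_ `^ (- a) ^+ j.+1]exprS; move: (2^-1 `^ (- a)) (2^-1 : R) => A B; ring.
Qed.
End kernel.


(** * The fractional kernel and cutoff functions *)

Section fractional_kernel.
Context (R : realType) (N : nat) (s : R).
Hypotheses (s0 : 0 < s) (s1 : s < 1).
Local Notation RN := 'rV[R]_N.
Local Notation mu := (@lebesgue_rV R N).
Local Notation a := (N%:R + 2 * s).
Implicit Types (x y c : RN) (r : R).

Definition frac_kernel x y : R := (enorm (x - y) `^ a)^-1.

Definition cutoff c r x : R := Num.min 1 (Num.max 0 (2 - `|x - c| / r)).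

Lemma exponent_gt0 : 0 < a. Proof. by rewrite ltr_wpDl// mulr_gt0. Qed.
Lemma dim_lt_exponent : N%:R < a. Proof. by rewrite ltrDl mulr_gt0. Qed.

Lemma enormN x : enorm (- x) = enorm x.
Proof. by congr Num.sqrt; apply: eq_bigr => i _; rewrite mxE sqrrN. Qed.

Lemma frac_kernel_sym x y : frac_kernel x y = frac_kernel y x.
Proof. by rewrite /frac_kernel -enormN opprB. Qed.

Lemma frac_kernel_ge0 x y : 0 <= frac_kernel x y.
Proof. by rewrite invr_ge0 powR_ge0. Qed.

Lemma measurable_frac_kernel d (T : measurableType d) (f g : T -> RN) :
  measurable_fun setT f -> measurable_fun setT g ->
  measurable_fun setT (fun t => frac_kernel (f t) (g t)).
Proof.
move=> mf mg; apply: measurable_inv_fun; apply: measurable_powR_fun.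
by apply: measurable_enorm_rV; apply: measurable_subr_rV.
Qed.

Lemma frac_kernel_le x y : frac_kernel x y <= `|y - x| `^ (- a).
Proof.
rewrite /frac_kernel powRN distrC; have [->|xy] := eqVneq x y.
  have -> : enorm (y - y) = 0.
    by rewrite subrr /enorm big1 ?sqrtr0// => i _; rewrite mxE expr0n.
  by rewrite subrr normr0.
have xy0 : 0 < `|x - y| by rewrite normr_gt0 subr_eq0.
have xye := norm_le_enorm (x - y).
rewrite lef_pV2 ?posrE ?powR_gt0//; last exact: lt_le_trans xye.
by apply: ge0_ler_powR => //; rewrite ?nnegrE ?enorm_ge0// ltW// exponent_gt0.
Qed.

Lemma frac_kernel_ge x y r : x != y -> `|x - y| <= r ->
  (Num.sqrt N%:R * r) `^ (- a) <= frac_kernel x y.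
Proof.
move=> xy xyr.
have xy0 : 0 < `|x - y| by rewrite normr_gt0 subr_eq0.
rewrite /frac_kernel -powRN; apply: powRNle.
- exact/ltW/exponent_gt0.
- exact: lt_le_trans (norm_le_enorm _).
- by apply: le_trans (enorm_le_norm _) _; rewrite ler_wpM2l.
Qed.

Lemma cutoff_ge0 c r x : 0 <= cutoff c r x.
Proof. by rewrite /cutoff le_min ler01 le_max lexx. Qed.

Lemma cutoff_le1 c r x : cutoff c r x <= 1.
Proof. by rewrite /cutoff ge_min lexx. Qed.

Lemma cutoff_in c r x : 0 < r -> `|x - c| <= r -> cutoff c r x = 1.
Proof.
move=> r0 xr; apply/min_idPl; rewrite le_max; apply/orP; right.
by rewrite lerBrDr addrC -lerBrDr ler_pdivrMr// (_ : 2 - 1 = 1) ?mul1r//; ring.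
Qed.

Lemma cutoff_out c r x : 0 < r -> 2 * r <= `|x - c| -> cutoff c r x = 0.
Proof.
move=> r0 xr; rewrite /cutoff max_l ?min_r//.
by rewrite subr_le0 ler_pdivlMr.
Qed.

Lemma dist_trunc (u v : R) :
  `|Num.min 1 (Num.max 0 u) - Num.min 1 (Num.max 0 v)| <= `|u - v|.
Proof.
wlog uv : u v / u <= v => [h|].
  have [/h //|/ltW/h] := leP u v.
  by rewrite distrC [X in _ <= X]distrC.
have m : Num.min 1 (Num.max 0 u) <= Num.min 1 (Num.max 0 v).
  by apply: le_min2 => //; apply: le_max2.
rewrite ler0_norm ?subr_le0// ler0_norm ?subr_le0// !opprB.
by rewrite /Num.min /Num.max; do ! case: ifPn => //; rewrite -?leNgt; lra.
Qed.

Lemma cutoff_lip c r x y : 0 < r -> `|cutoff c r x - cutoff c r y| <= `|x - y| / r.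
Proof.
move=> r0; apply: (le_trans (dist_trunc _ _)).
rewrite (_ : _ - _ = (`|y - c| - `|x - c|) / r); last by ring.
rewrite normrM [X in _ * X]ger0_norm ?invr_ge0 ?(ltW r0)//.
rewrite ler_pM2r ?invr_gt0//; apply: (le_trans (ler_dist_dist _ _)).
by rewrite opprB addrA subrK distrC.
Qed.

Lemma cutoff_dist1 c r x y : `|cutoff c r x - cutoff c r y| <= 1.
Proof.
rewrite ler_norml; move: (cutoff_ge0 c r x) (cutoff_le1 c r x).
by move: (cutoff_ge0 c r y) (cutoff_le1 c r y); lra.
Qed.

Lemma measurable_cutoff c r d (T : measurableType d) (f : T -> RN) :
  measurable_fun setT f -> measurable_fun setT (fun t => cutoff c r (f t)).
Proof.
move=> mf; have mn : measurable_fun setT (fun t => `|f t - c|).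
  by apply: measurable_norm_rV; apply: measurable_subr_rV.
by rewrite /cutoff; repeat (exact: mn || exact: measurable_cst || measurable_step).
Qed.

(** For [x] within [12 r] of the origin, the short jumps (by the Lipschitz bound)
and the long ones (by the decay of the kernel) both contribute a multiple of
[r^(-2s)]; for other [x] only the jumps into the support of the cutoff count. *)
Lemma cutoff_energy : exists C : R, [/\ 0 < C & forall c r, 0 < r -> `|c| <= 4 * r ->
  forall x, (\int[mu]_y ((cutoff c r x - cutoff c r y) ^+ 2 * frac_kernel x y)%:E
    <= (C * (r ^+ N * (r + `|x|) `^ (- a)))%:E)%E].
Proof.
have [Cf [Cf0 far]] := int_far_power dim_lt_exponent.
have [|Cn [Cn0 near]] := @int_near_power R N a (ltW exponent_gt0).
  by rewrite ltrD2l gtr_pMr.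
exists ((Cn + Cf) * 13 `^ a + 4 ^+ N * 4 `^ a); split.
  by rewrite addr_gt0// mulr_gt0// ?powR_gt0// ?exprn_gt0// addr_gt0.
move=> c r r0 c4 x.
have rx0 : 0 < r + `|x| by rewrite ltr_pwDl.
have mb : measurable_fun setT (fun y => cutoff c r x - cutoff c r y).
  by apply: measurable_add_fun => //; apply: measurable_opp_fun; exact: measurable_cutoff.
have mk : measurable_fun setT (fun y => frac_kernel x y) by exact: measurable_frac_kernel.
have mn : measurable_fun setT (fun y : RN => `|y - x|).
  by apply: measurable_norm_rV; apply: measurable_subr_rV.
have [x12|x12] := leP `|x| (12 * r).
  apply: (@le_trans _ _ (((Cn + Cf) * r `^ (N%:R - a))%:E)%E).
    apply: (@le_trans _ _ (\int[mu]_y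
     (r ^- 2 * (if (`|y - x| < r)%R then `|y - x| ^+ 2 * `|y - x| `^ (- a) else 0)
       + (if (r <= `|y - x|)%R then `|y - x| `^ (- a) else 0))%:E)%E).
      apply: le_int.
      - by repeat (exact: mb || exact: mk || measurable_step).
      - by repeat (exact: mn || exact: measurable_cst || measurable_step).
      - by move=> y; rewrite mulr_ge0 ?sqr_ge0 ?frac_kernel_ge0.
      - move=> y; case: ltP => yx.
          rewrite addr0 mulrA; apply: ler_pM; rewrite ?sqr_ge0 ?frac_kernel_ge0//.
            rewrite -real_normK ?num_real// mulrC -expr_div_n.
            by rewrite lerXn2r ?nnegrE ?divr_ge0 ?(ltW r0)// [X in _ <= X / _]distrC cutoff_lip.
          exact: frac_kernel_le.
        rewrite mulr0 add0r -[X in _ <= X]mul1r.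
        apply: ler_pM; rewrite ?sqr_ge0 ?frac_kernel_ge0//; last exact: frac_kernel_le.
        by rewrite -real_normK ?num_real// exprn_ile1// cutoff_dist1.
    rewrite intD//; last first.
    - by move=> y; case: ifP => // _; exact: powR_ge0.
    - move=> y; case: ifP; rewrite ?mulr0// => _.
      by rewrite !mulr_ge0// ?powR_ge0// invr_ge0 sqr_ge0.
    - by repeat (exact: mn || exact: measurable_cst || measurable_step).
    - by repeat (exact: mn || exact: measurable_cst || measurable_step).
    rewrite intZ//; last first.
    - by move=> y; case: ifP.
    - by rewrite invr_ge0 sqr_ge0.
    - by repeat (exact: mn || exact: measurable_cst || measurable_step).
    rewrite [(Cn + Cf) * _]mulrDl [X in (_ <= X)%E]EFinD; apply: leeD; last exact: far.
    apply: (@le_trans _ _ ((r ^- 2)%:E * (Cn * (r ^+ 2 * r `^ (N%:R - a)))%:E)%E).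
      by apply: lee_wpmul2l (near _ _ r0); rewrite lee_fin invr_ge0 sqr_ge0.
    rewrite -EFinM lee_fin; apply: ler_of_eq.
    move: (r `^ _) => P; field; exact: lt0r_neq0.
  rewrite lee_fin [leRHS]mulrDl -[leLHS]addr0; apply: lerD; last first.
    by rewrite !mulr_ge0// ?powR_ge0// ?exprn_ge0// ltW.
  rewrite powRD ?(gt_eqF r0) ?implybT// powR_mulrn ?(ltW r0)//.
  rewrite -!mulrA ler_pM2l ?addr_gt0// [leRHS]mulrCA ler_pM2l ?exprn_gt0//.
  have -> : 13 `^ a = 13^-1 `^ (- a).
    by rewrite -[13^-1]powR_inv1// -powRrM mulN1r opprK.
  rewrite -powRM ?invr_ge0 ?(ltW rx0)//; apply: powRNle; first exact/ltW/exponent_gt0.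
    by rewrite mulr_gt0// invr_gt0.
  by rewrite mulrC ler_pdivrMr//; lra.
(* The support lies in the ball of radius [6 r] about the origin, hence at
distance at least [|x| / 2] from [x]. *)
have x0 : 0 < `|x| by apply: le_lt_trans x12; rewrite mulr_ge0// ltW.
apply: (@le_trans _ _ (\int[mu]_y
    (if (`|y - c| <= 2 * r)%R then (`|x| / 2) `^ (- a) else 0)%:E)%E).
  apply: le_int.
  - by repeat (exact: mb || exact: mk || measurable_step).
  - by apply: measurable_if_fun => //; exact: measurable_ball_norm.
  - by move=> y; rewrite mulr_ge0 ?sqr_ge0 ?frac_kernel_ge0.
  have cx : cutoff c r x = 0.
    apply: cutoff_out => //; have := ler_normD (x - c) c; rewrite subrK.
    by move: x12 c4; lra.
  move=> y; case: ifPn => yc; last first.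
    rewrite cx (cutoff_out r0); last by move: yc; rewrite -ltNge => /ltW.
    by rewrite subrr expr0n mul0r.
  rewrite -[leRHS]mul1r; apply: ler_pM; rewrite ?sqr_ge0 ?frac_kernel_ge0//.
    by rewrite -real_normK ?num_real// exprn_ile1// cutoff_dist1.
  apply: (le_trans (frac_kernel_le _ _)); apply: powRNle; first exact/ltW/exponent_gt0.
    by rewrite divr_gt0.
  have h1 := ler_normD (x - y) y; rewrite subrK in h1.
  have h2 := ler_normD (y - c) c; rewrite subrK in h2.
  by rewrite distrC; move: x12 c4 yc h1 h2; lra.
rewrite int_if_cst ?powR_ge0//; last exact: measurable_ball_norm.
rewrite [X in (_ * X <= _)%E](_ : _ = ((2 * (2 * r)) ^+ N)%:E); last first.
  by apply: lebesgue_rV_ball; rewrite mulr_ge0// ltW.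
rewrite -EFinM lee_fin [leRHS]mulrDl -[leLHS]add0r; apply: lerD.
  rewrite !mulr_ge0// ?powR_ge0// ?exprn_ge0// ?(ltW r0)//.
  by rewrite addr_ge0 ?ltW.
rewrite mulrA -natrM exprMn mulrC -!mulrA ler_pM2l ?exprn_gt0//.
rewrite [leRHS]mulrCA ler_pM2l ?exprn_gt0//.
have -> : 4 `^ a = 4^-1 `^ (- a).
  by rewrite -[4^-1]powR_inv1// -powRrM mulN1r opprK.
rewrite -powRM ?invr_ge0 ?(ltW rx0)//; apply: powRNle; first exact/ltW/exponent_gt0.
  by rewrite mulr_gt0// invr_gt0.
by rewrite mulrC ler_pdivrMr//; move: x12 r0; lra.
Qed.

Lemma int_weight : exists C : R, [/\ 0 < C & forall r, 0 < r ->
  (\int[mu]_x ((r + `|x|) `^ (- a))%:E <= (C * r `^ (- (2 * s)))%:E)%E].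
Proof.
have [Cf [Cf0 far]] := int_far_power dim_lt_exponent.
exists (2 ^+ N + Cf); split; first by rewrite addr_gt0// exprn_gt0.
move=> r r0.
have mn : measurable_fun setT (fun y : RN => `|y|) by apply: measurable_norm_rV.
have mn0 : measurable_fun setT (fun y : RN => `|y - 0|).
  by under eq_fun do rewrite subr0.
apply: (@le_trans _ _ (\int[mu]_y ((if (`|y - 0| <= r)%R then r `^ (- a) else 0) +
    (if (r <= `|y - 0|)%R then `|y - 0| `^ (- a) else 0))%:E)%E).
  apply: le_int.
  - by repeat (exact: mn || exact: measurable_cst || measurable_step).
  - by repeat (exact: mn0 || exact: measurable_cst || measurable_step).
  - by move=> y; exact: powR_ge0.
  move=> y; rewrite subr0; case: (leP `|y| r) => yr.
    apply: ler_wpDr; first by case: ifP => // _; exact: powR_ge0.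
    by apply: powRNle => //; [exact/ltW/exponent_gt0|rewrite lerDl].
  rewrite (ltW yr) add0r; apply: powRNle; first exact/ltW/exponent_gt0.
    exact: lt_trans yr.
  by rewrite lerDr ltW.
rewrite intD; last first.
- by move=> y; case: ifP => // _; exact: powR_ge0.
- by move=> y; case: ifP => // _; exact: powR_ge0.
- by repeat (exact: mn0 || exact: measurable_cst || measurable_step).
- by repeat (exact: mn0 || exact: measurable_cst || measurable_step).
rewrite [(2 ^+ N + Cf) * _]mulrDl [X in (_ <= X)%E]EFinD; apply: leeD; last first.
  apply: (le_trans (far 0 r r0)); rewrite lee_fin; apply: ler_of_eq.
  by congr (_ * _ `^ _); ring.
rewrite int_if_cst ?powR_ge0//; last exact: measurable_ball_norm.
rewrite [X in (_ * X <= _)%E](_ : _ = ((2 * r) ^+ N)%:E); last first.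
  by apply: lebesgue_rV_ball; exact: ltW.
rewrite -EFinM lee_fin; apply: ler_of_eq.
rewrite exprMn -(powR_mulrn _ (ltW r0)) mulrCA -powRD ?(gt_eqF r0) ?implybT//.
by congr (_ * _ `^ _); ring.
Qed.

(** By Tonelli and the symmetry of the kernel, the cutoff errors of all the test
functions below reduce to one integral against [(r + |x|)^(-(N + 2s))]. *)
Lemma cutoff_error : exists C : R, [/\ 0 < C & forall c r (h : RN -> R),
  0 < r -> `|c| <= 4 * r -> measurable_fun setT h -> (forall x, 0 <= h x) ->
  (\int[(mu \x mu)%E]_z
     ((cutoff c r z.1 - cutoff c r z.2) ^+ 2 * (h z.1 + h z.2) * frac_kernel z.1 z.2)%:E
  <= (C * r ^+ N)%:E * \int[mu]_x (h x * (r + `|x|) `^ (- a))%:E)%E].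
Proof.
have [C [C0 CP]] := cutoff_energy.
exists (2 * C); split; first by rewrite mulr_gt0.
move=> c r h r0 c4 mh h0.
have mn : measurable_fun setT (fun y : RN => `|y|) by apply: measurable_norm_rV.
have mhz (f : RN * RN -> RN) : measurable_fun setT f -> measurable_fun setT (h \o f).
  by move=> mf; apply: measurableT_comp.
have mb1 : measurable_fun setT (fun z : RN * RN => cutoff c r z.1).
  exact: measurable_cutoff.
have mb2 : measurable_fun setT (fun z : RN * RN => cutoff c r z.2).
  exact: measurable_cutoff.
have mk : measurable_fun setT (fun z : RN * RN => frac_kernel z.1 z.2).
  exact: measurable_frac_kernel.
have mh1 : measurable_fun setT (fun z : RN * RN => h z.1) by exact: mhz.
have mh2 : measurable_fun setT (fun z : RN * RN => h z.2) by exact: mhz.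
under eq_integral do rewrite mulrDr mulrDl.
have half (f : RN * RN -> R) (g : RN -> RN -> RN * RN) :
  (\int[(mu \x mu)%E]_z (f z)%:E = \int[mu]_x \int[mu]_y (f (g x y))%:E)%E ->
  (forall x y, f (g x y) = h x * ((cutoff c r x - cutoff c r y) ^+ 2 * frac_kernel x y)) ->
  (\int[(mu \x mu)%E]_z (f z)%:E <= (C * r ^+ N)%:E * \int[mu]_x (h x * (r + `|x|) `^ (- a))%:E)%E.
  move=> -> fg.
  have mbx x : measurable_fun setT (fun y => (cutoff c r x - cutoff c r y) ^+ 2 * frac_kernel x y).
    apply: measurable_mul_fun; last exact: measurable_frac_kernel.
    by apply: measurable_exprn_fun; apply: measurable_add_fun => //; apply: measurable_opp_fun; exact: measurable_cutoff.
  rewrite -intZ; last first.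
  - by move=> x; rewrite mulr_ge0// powR_ge0.
  - by rewrite mulr_ge0 ?exprn_ge0// ltW.
  - by repeat (exact: mn || exact: measurable_cst || exact: mh || measurable_step).
  have E x : (\int[mu]_y (f (g x y))%:E =
      (h x)%:E * \int[mu]_y ((cutoff c r x - cutoff c r y) ^+ 2 * frac_kernel x y)%:E)%E.
    under eq_integral do rewrite fg.
    by rewrite intZ// => y; rewrite mulr_ge0 ?sqr_ge0 ?frac_kernel_ge0.
  apply: ge0_le_integral => //.
  - move=> x _; apply: int_ge0 => y; rewrite fg.
    by apply: mulr_ge0; [exact: h0|apply: mulr_ge0; [exact: sqr_ge0|exact: frac_kernel_ge0]].
  - under eq_fun do rewrite E.
    apply: emeasurable_funM; first exact: measurable_EFin_fun.
    have := @measurable_fun_fubini_tonelli_F _ _ RN RN R mu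
       (fun z => ((cutoff c r z.1 - cutoff c r z.2) ^+ 2 * frac_kernel z.1 z.2)%:E).
    apply; last by move=> z; rewrite lee_fin mulr_ge0 ?sqr_ge0 ?frac_kernel_ge0.
    by repeat (assumption || measurable_step).
  - by repeat (exact: mn || exact: measurable_cst || exact: mh || measurable_step).
  - move=> x _; rewrite E.
    apply: (@le_trans _ _ ((h x)%:E * (C * (r ^+ N * (r + `|x|) `^ (- a)))%:E)%E).
      by apply: lee_wpmul2l; [rewrite lee_fin|exact: CP].
    rewrite -EFinM lee_fin; apply: ler_of_eq; ring.
rewrite intD; last first.
- by move=> z; exact: mulr_ge0 (mulr_ge0 (sqr_ge0 _) (h0 _)) (frac_kernel_ge0 _ _).
- by move=> z; exact: mulr_ge0 (mulr_ge0 (sqr_ge0 _) (h0 _)) (frac_kernel_ge0 _ _).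
- by repeat (assumption || measurable_step).
- by repeat (assumption || measurable_step).
have -> : (2 * C * r ^+ N)%:E = ((C * r ^+ N)%:E + (C * r ^+ N)%:E)%E.
  by rewrite -EFinD; congr EFin; ring.
rewrite ge0_muleDl; last first.
- by rewrite lee_fin mulr_ge0 ?exprn_ge0 ?ltW.
- by rewrite lee_fin mulr_ge0 ?exprn_ge0 ?ltW.
apply: leeD.
  apply: (half _ (fun x y => (x, y))); last by move=> x y /=; ring.
  rewrite fubini_tonelli1//; first by repeat (assumption || measurable_step).
  by move=> z; rewrite lee_fin; exact: mulr_ge0 (mulr_ge0 (sqr_ge0 _) (h0 _)) (frac_kernel_ge0 _ _).
apply: (half _ (fun x y => (y, x))).
  rewrite fubini_tonelli2//; first by repeat (assumption || measurable_step).
  by move=> z; rewrite lee_fin; exact: mulr_ge0 (mulr_ge0 (sqr_ge0 _) (h0 _)) (frac_kernel_ge0 _ _).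
by move=> x y /=; rewrite [frac_kernel y x]frac_kernel_sym; ring.
Qed.
End fractional_kernel.


(** * Pointwise inequalities *)

Section pointwise.
Context (R : realType).
Implicit Types (v w P Q b M m : R).

Definition trunc_powN b M v : R := Num.max 0 (v `^ (- b) - M).

(** The energy released by a jump from the value [v] up to the value [w], when
the test function is [eta^2 * trunc_powN b M] and [Q] is the value of [eta] at
the lower end; downward jumps count for nothing. *)
Definition gain b M Q v w : R := Q ^+ 2 * Num.max 0 (w - v) * (trunc_powN b M v - trunc_powN b M w).

Lemma powR1B v b : 0 < v -> v `^ (1 - b) = v * v `^ (- b).
Proof. by move=> v0; rewrite powRD ?(gt_eqF v0) ?implybT// powRr1// ltW. Qed.

Lemma trunc_powN_ge0 b M v : 0 <= trunc_powN b M v.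
Proof. by rewrite le_max lexx. Qed.

Lemma trunc_powN_le b M v : 0 <= M -> trunc_powN b M v <= v `^ (- b).
Proof. by move=> M0; rewrite ge_max powR_ge0 gerBl. Qed.

Lemma trunc_powN_anti b M v w : 0 <= b -> 0 < v -> v <= w -> trunc_powN b M w <= trunc_powN b M v.
Proof.
move=> b0 v0 vw; apply: le_max2 => //; rewrite lerD2r.
exact: powRNle.
Qed.

Lemma gain_ge0 b M Q v w : 0 <= b -> 0 < v -> 0 <= gain b M Q v w.
Proof.
move=> b0 v0; rewrite /gain; have [vw|wv] := leP v w.
  apply: mulr_ge0; first by rewrite mulr_ge0 ?sqr_ge0// le_max lexx.
  by rewrite subr_ge0 trunc_powN_anti.
by rewrite max_l ?mulr0 ?mul0r// subr_le0 ltW.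
Qed.

Lemma gain_le0 b M Q v w : w <= v -> gain b M Q v w = 0.
Proof. by move=> wv; rewrite /gain max_l ?mulr0 ?mul0r// subr_le0. Qed.

Lemma gainE b M Q v w : v <= w ->
  gain b M Q v w = Q ^+ 2 * (w - v) * (trunc_powN b M v - trunc_powN b M w).
Proof. by move=> wv; rewrite /gain max_r// subr_ge0. Qed.

(** The tangent inequality for the convex function [t^(-b)]. *)
Lemma powRN_convex v w b : 0 < b -> 0 < w -> w <= v ->
  b * (v `^ (- b) * ((v - w) / v)) <= w `^ (- b) - v `^ (- b).
Proof.
move=> b0 w0 wv; have v0 : 0 < v by apply: lt_le_trans wv.
have wv0 : 0 < w / v by rewrite divr_gt0.
have -> : w `^ (- b) = v `^ (- b) * (w / v) `^ (- b).
  rewrite -powRM ?(ltW v0) ?(ltW wv0)//; congr (_ `^ _).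
  by field; exact: lt0r_neq0.
have h : 1 + b * (1 - w / v) <= (w / v) `^ (- b).
  rewrite /powR gt_eqF//; apply: le_trans (expR_ge1Dx _).
  rewrite lerD2l mulNr -mulrN ler_pM2l// lerNr opprB.
  rewrite -[X in ln X](_ : 1 + (w / v - 1) = _); last by ring.
  by apply: le_ln1Dx; rewrite ltrBrDl subrr.
have -> : (v - w) / v = 1 - w / v by field; exact: lt0r_neq0.
rewrite -[X in _ <= _ - X]mulr1 -mulrBr mulrCA ler_pM2l ?powR_gt0//.
by rewrite lerBrDl.
Qed.

(** The core of [caccioppoli] for [w <= v], with [F] and [G] in place of the
values of the decreasing function at [v] and [w]: after expanding
[Q = P + (Q - P)], the cross term [F P (Q - P)] is split by Young's inequality,
the tangent inequality making its square absorbable by the gain. *)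
Lemma truncation_young v w F G A P Q b : 0 < b -> 0 < w -> w <= v ->
  0 <= F -> F <= A -> F <= G -> 0 <= P -> 0 <= Q ->
  (F != 0 -> b * (A * ((v - w) / v)) <= G - F) ->
  (v - w) * (Q ^+ 2 * F - P ^+ 2 * G) + 2^-1 * (P ^+ 2 * (v - w) * (G - F))
    <= (1 + 2 / b) * (Q - P) ^+ 2 * (v * A).
Proof.
move=> b0 w0 wv F0 FA FG P0 Q0 hFG.
have v0 : 0 < v by apply: lt_le_trans wv.
have A0 : 0 <= A by apply: le_trans FA.
have d0 : 0 <= v - w by rewrite subr_ge0.
have vA : 0 <= v * A by rewrite mulr_ge0// ltW.
have c0 : 0 <= (1 + 2 / b) * (Q - P) ^+ 2 * (v * A).
  apply: mulr_ge0 => //; apply: mulr_ge0; last exact: sqr_ge0.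
  by rewrite addr_ge0// divr_ge0// ltW.
have [FE|/hFG {}hFG] := eqVneq F 0.
  apply: le_trans c0; rewrite FE mulr0 sub0r subr0.
  have : 0 <= P ^+ 2 * (v - w) * G by rewrite !mulr_ge0 ?sqr_ge0// (le_trans F0).
  lra.
have dv : v - w <= v by rewrite gerBl ltW.
have dF : (v - w) * F <= v * A by apply: ler_pM.
set d := v - w in d0 dv dF hFG *; set e := Q - P.
have h1 : d * F * e ^+ 2 <= v * A * e ^+ 2 by rewrite ler_wpM2r// sqr_ge0.
have h2 : 2 * d * F * P * e <= 2 * d * A * P * `|e|.
  apply: (@le_trans _ _ (2 * d * F * P * `|e|)).
    by rewrite ler_wpM2l ?ler_norm// !mulr_ge0.
  apply: ler_wpM2r => //; apply: ler_wpM2r => //; apply: ler_wpM2l => //.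
  by rewrite mulr_ge0.
have h3 : P ^+ 2 * d * (b * (A * (d / v))) <= P ^+ 2 * d * (G - F).
  by rewrite ler_wpM2l// mulr_ge0 ?sqr_ge0.
have h4 : 2 * d * A * P * `|e| <= 2^-1 * (P ^+ 2 * d * (b * (A * (d / v))))
   + 2 / b * `|e| ^+ 2 * (v * A).
  rewrite -subr_ge0 (_ : _ - _ = A / (2 * b * v) * (b * P * d - 2 * `|e| * v) ^+ 2).
    by rewrite mulr_ge0 ?sqr_ge0// divr_ge0// !mulr_ge0// ltW.
  by field; rewrite !lt0r_neq0.
rewrite real_normK ?num_real// in h4.
have -> : Q = P + e by rewrite /e addrC subrK.
have -> : d * ((P + e) ^+ 2 * F - P ^+ 2 * G) = d * F * e ^+ 2 + 2 * d * F * P * e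
   - P ^+ 2 * d * (G - F) by ring.
have -> : (1 + 2 / b) * e ^+ 2 * (v * A) = v * A * e ^+ 2 + 2 / b * e ^+ 2 * (v * A).
  by ring.
move: h1 h2 h3 h4; set X1 := _ * e ^+ 2; set X2 := _ * `|e|.
set X3 := P ^+ 2 * d * (G - F); set X4 := _ * (v * A); set X5 := P ^+ 2 * d * _.
set X6 := _ * e; set X7 := v * A * _.
lra.
Qed.

Lemma caccioppoli_le v w P Q b M : 0 < b -> 0 <= M -> 0 < w -> w <= v ->
  0 <= P -> 0 <= Q ->
  (v - w) * (Q ^+ 2 * trunc_powN b M v - P ^+ 2 * trunc_powN b M w) + 2^-1 * gain b M P w v
    <= (1 + 2 / b) * (Q - P) ^+ 2 * v `^ (1 - b).
Proof.
move=> b0 M0 w0 wv P0 Q0; have v0 : 0 < v by apply: lt_le_trans wv.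
rewrite gainE// powR1B//; apply: truncation_young => //.
- exact: trunc_powN_ge0.
- exact: trunc_powN_le.
- by apply: trunc_powN_anti => //; exact: ltW.
- rewrite /trunc_powN; have [|h _] := leP (v `^ (- b) - M) 0; first by rewrite eqxx.
  apply: (le_trans (powRN_convex b0 w0 wv)).
  rewrite [leRHS](_ : _ = Num.max 0 (w `^ (- b) - M) - (v `^ (- b) - M))//.
  have : w `^ (- b) - M <= Num.max 0 (w `^ (- b) - M) by rewrite le_max lexx orbT.
  by lra.
Qed.

(** Testing with a decreasing function of [u] makes the quadratic form negative,
up to an error carried by the variation of the cutoff. For [b = 1] and [M = 0]
this is Picone's inequality with a remainder term. *)
Lemma caccioppoli v w P Q b M : 0 < b -> 0 <= M -> 0 < v -> 0 < w ->
  0 <= P -> 0 <= Q ->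
  (v - w) * (Q ^+ 2 * trunc_powN b M v - P ^+ 2 * trunc_powN b M w)
     + 2^-1 * (gain b M Q v w + gain b M P w v)
    <= (1 + 2 / b) * ((Q - P) ^+ 2 * (v `^ (1 - b) + w `^ (1 - b))).
Proof.
move=> b0 M0 v0 w0 P0 Q0.
have c0 : 0 <= (1 + 2 / b) * (Q - P) ^+ 2.
  by rewrite mulr_ge0 ?sqr_ge0// addr_ge0// divr_ge0// ltW.
rewrite [leRHS]mulrA [leRHS]mulrDr; have [wv|/ltW vw] := leP w v.
  rewrite (gain_le0 _ _ _ wv) add0r -[leLHS]addr0.
  by apply: lerD; [exact: caccioppoli_le|rewrite mulr_ge0// powR_ge0].
rewrite (gain_le0 _ _ _ vw) addr0 -[leLHS]add0r.
apply: lerD; first by rewrite mulr_ge0// powR_ge0.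
rewrite (_ : (Q - P) ^+ 2 = (P - Q) ^+ 2); last by ring.
apply: le_trans (caccioppoli_le b0 M0 v0 vw Q0 P0).
by apply: ler_of_eq; ring.
Qed.

(** If the truncated value at the first point is at most twice that at the second
one, the comparison is direct; otherwise the jump between them releases a gain
of the order of [min(v, m)^(1 - b)]. *)
Lemma hardy_pointwise v w P Q b m : 0 < b < 1 -> 0 < m -> 0 < v -> 0 < w ->
  0 <= P -> 0 <= Q ->
  Q ^+ 2 * Num.min v m `^ (1 - b) <= 4 * (P ^+ 2 * Num.min w m `^ (1 - b))
    + (2 + 4 / (2 `^ b - 1)) *
       (gain b (m `^ (- b)) Q v w + gain b (m `^ (- b)) P w v
        + (Q - P) ^+ 2 * (v `^ (1 - b) + w `^ (1 - b))).
Proof.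
move=> /andP[b0 b1] m0 v0 w0 P0 Q0.
have b10 : 0 <= 1 - b by rewrite subr_ge0 ltW.
have k0 : 0 < 2 `^ b - 1.
  rewrite subr_gt0 -[X in X < _](powRr0 2) /powR !gt_eqF// ltr_expR.
  by rewrite mul0r mulr_gt0// ln_gt0// ltr1n.
set k := 4 / _; have kk0 : 0 < k by rewrite divr_gt0.
set M := m `^ (- b).
have g1 : 0 <= gain b M Q v w by apply: gain_ge0 => //; exact: ltW.
have g2 : 0 <= gain b M P w v by apply: gain_ge0 => //; exact: ltW.
set E := (Q - P) ^+ 2 * _.
set v' := Num.min v m; set w' := Num.min w m.
have v'0 : 0 < v' by rewrite lt_min v0 m0.
have w'0 : 0 < w' by rewrite lt_min w0 m0.
have v'v : v' `^ (1 - b) <= v `^ (1 - b).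
  by apply: ge0_ler_powR => //; rewrite ?nnegrE ?(ltW v'0) ?(ltW v0)// ge_min lexx.
have QP : Q ^+ 2 * v' `^ (1 - b) <= 2 * (P ^+ 2 * v' `^ (1 - b)) + 2 * E.
  have -> : Q ^+ 2 = (P + (Q - P)) ^+ 2 by congr (_ ^+ 2); ring.
  apply: (@le_trans _ _ ((2 * P ^+ 2 + 2 * (Q - P) ^+ 2) * v' `^ (1 - b))).
    rewrite ler_wpM2r ?powR_ge0//.
    by have := sqr_ge0 (P - (Q - P)); move: (Q - P) => e; rewrite !expr2; lra.
  rewrite /E mulrDl -[2 * P ^+ 2 * _]mulrA -[2 * (Q - P) ^+ 2 * _]mulrA.
  rewrite lerD2l ler_pM2l// ler_wpM2l ?sqr_ge0//.
  by rewrite (le_trans v'v)// lerDl powR_ge0.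
apply: (le_trans QP).
have E0 : 0 <= E by rewrite mulr_ge0 ?sqr_ge0// addr_ge0 ?powR_ge0.
suff h : 2 * (P ^+ 2 * v' `^ (1 - b)) <=
    4 * (P ^+ 2 * w' `^ (1 - b)) + k * gain b M P w v.
  have x1 : 0 <= k * gain b M Q v w by rewrite mulr_ge0// ltW.
  have x2 : 0 <= k * E by rewrite mulr_ge0// ltW.
  move: h x1 x2 g1 g2 E0; rewrite mulrDl !mulrDr; lra.
have [vw|vw] := leP v' (2 * w').
  rewrite -[leLHS]addr0; apply: lerD; last by rewrite mulr_ge0// ltW.
  rewrite mulrCA [leRHS]mulrCA ler_wpM2l ?sqr_ge0//.
  have -> : 4 = 2 * 2 :> R by ring.
  rewrite -mulrA ler_pM2l//.
  apply: (@le_trans _ _ ((2 * w') `^ (1 - b))).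
    by apply: ge0_ler_powR => //; rewrite nnegrE ltW// mulr_gt0.
  rewrite powRM ?(ltW w'0)// ler_wpM2r ?powR_ge0//.
  by apply: ler1_powR; rewrite ?ler1n// gerBl ltW.
rewrite -[leLHS]add0r; apply: lerD; first by rewrite !mulr_ge0 ?sqr_ge0 ?powR_ge0.
have w'm : w < m.
  rewrite ltNge; apply/negP => mw; move: vw; rewrite /v' /w' (min_r mw).
  by apply/negP; rewrite -leNgt ge_min; apply/orP; right; lra.
have w'E : w' = w by apply: min_l; exact: ltW.
rewrite w'E in vw w'0 *.
have v'v1 : v' <= v by rewrite ge_min lexx.
have v'm : v' <= m by rewrite ge_min lexx orbT.
have wv : w <= v by move: vw v'v1 w0; lra.
rewrite gainE// powR1B//.
have h1 : v' / 2 <= v - w by move: vw v'v1; lra.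
have h2 : (2 `^ b - 1) * v' `^ (- b) <= trunc_powN b M w - trunc_powN b M v.
  have tw : w `^ (- b) - M <= trunc_powN b M w by rewrite le_max lexx orbT.
  have tv : trunc_powN b M v <= v' `^ (- b) - M.
    rewrite ge_max subr_ge0 lerD2r; apply/andP; split; apply: powRNle => //; exact: ltW.
  have hw : 2 `^ b * v' `^ (- b) <= w `^ (- b).
    have -> : 2 `^ b = 2^-1 `^ (- b).
      by rewrite -[2^-1]powR_inv1// -powRrM mulN1r opprK.
    rewrite -powRM ?invr_ge0 ?(ltW v'0)//; apply: powRNle => //; first exact: ltW.
    by rewrite mulrC ler_pdivlMr// mulrC ltW.
  by rewrite mulrBl mul1r; move: tw tv hw; lra.
have h3 : v' / 2 * ((2 `^ b - 1) * v' `^ (- b)) <= (v - w) * (trunc_powN b M w - trunc_powN b M v).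
  apply: ler_pM => //; first by rewrite divr_ge0// ltW.
  by rewrite mulr_ge0 ?powR_ge0// ltW.
rewrite -[P ^+ 2 * _ * _]mulrA [leRHS]mulrCA [leLHS]mulrCA ler_wpM2l ?sqr_ge0//.
apply: (@le_trans _ _ (k * (v' / 2 * ((2 `^ b - 1) * v' `^ (- b))))); last first.
  by rewrite ler_pM2l.
apply: ler_of_eq; rewrite /k; field; exact: lt0r_neq0.
Qed.
End pointwise.


(** * Integration lemmas and Lipschitz bounds *)

Lemma continuous_bounded_rV (R : realType) N (f : 'rV[R]_N -> R) r :
  continuous f -> exists B, 0 < B /\ forall x, `|x| <= r -> `|f x| <= B.
Proof.
move=> cf; have [r0|r0] := ltP r 0.
  by exists 1; split => // x xr; have := le_lt_trans xr r0; rewrite normr_lt0.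
pose A := [set x : 'rV[R]_N | forall i, [set` `[- r, r]] (x ord0 i)].
have cA : compact A.
  apply: (@rV_compact R N (fun=> [set` `[- r, r]])) => _.
  exact: (@segment_compact R (- r) r).
have /compact_bounded : compact (f @` A).
  by apply: continuous_compact => //; apply: continuous_subspaceT.
move=> [B [_ /(_ (Num.max 1 (B + 1)))]] /=.
have BB : B < Num.max 1 (B + 1) by rewrite lt_max ltrDl ltr01 orbT.
move=> /(_ BB) fB.
exists (Num.max 1 (B + 1)); split; first by rewrite lt_max ltr01.
move=> x xr; apply: fB; exists x => //= i.
have : `|x ord0 i| <= r by exact: le_trans (rV_coord_le _ _) xr.
by rewrite ler_norml /= in_itv.
Qed.

Section integral_extra.
Context d (T : measurableType d) (R : realType).
Variable mu : {measure set T -> \bar R}.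

Lemma int_lt_integrable (f : T -> R) : measurable_fun setT f ->
  (forall x, 0 <= f x) -> (\int[mu]_x (f x)%:E < +oo)%E ->
  mu.-integrable setT (EFin \o f).
Proof.
move=> mf f0 foo; apply/integrableP; split; first exact: measurable_EFin_fun.
rewrite (eq_integral (fun x => (f x)%:E))// => x _ /=.
by rewrite ger0_norm.
Qed.

Lemma int_dominated (f g : T -> R) : measurable_fun setT f ->
  mu.-integrable setT (EFin \o g) -> (forall x, `|f x| <= g x) ->
  mu.-integrable setT (EFin \o f).
Proof.
move=> mf ig fg; apply: le_integrable ig => //; first exact: measurable_EFin_fun.
by move=> x _ /=; rewrite lee_fin (le_trans (fg x))// ler_norm.
Qed.

(** The integrability of [G] comes out of the bound itself, once the integral of
[E] is finite. *)
Lemma int_le_split (X G E : T -> R) :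
  mu.-integrable setT (EFin \o X) ->
  measurable_fun setT G -> measurable_fun setT E ->
  (forall x, 0 <= G x) -> (forall x, 0 <= E x) -> (forall x, X x + G x <= E x) ->
  (\int[mu]_x (X x)%:E + \int[mu]_x (G x)%:E <= \int[mu]_x (E x)%:E)%E.
Proof.
move=> iX mG mEE G0 E0 XGE.
have [Eoo|] := ltP (\int[mu]_x (E x)%:E)%E +oo%E; last first.
  by rewrite leye_eq => /eqP ->; rewrite leey.
have iE : mu.-integrable setT (EFin \o E) by exact: int_lt_integrable.
have iG : mu.-integrable setT (EFin \o G).
  have iEX : mu.-integrable setT (EFin \o (fun x => E x - X x)).
    rewrite (_ : _ \o _ = (EFin \o E) \- (EFin \o X))%E//.
    exact: integrableB.
  apply: int_dominated iEX _ => // x.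
  by rewrite ger0_norm// lerBrDl.
rewrite -integralD//; apply: le_integral => //.
  exact: integrableD.
by move=> x _ /=; rewrite -EFinD lee_fin.
Qed.
End integral_extra.

Section trunc_powN_lipschitz.
Context (R : realType).
Implicit Types (v w b M t : R).

Lemma dist_max0 (x y : R) : `|Num.max 0 x - Num.max 0 y| <= `|x - y|.
Proof.
wlog xy : x y / x <= y => [h|].
  have [/h //|/ltW/h] := leP x y.
  by rewrite distrC [X in _ <= X]distrC.
have m : Num.max 0 x <= Num.max 0 y by apply: le_max2.
rewrite ler0_norm ?subr_le0// ler0_norm ?subr_le0// !opprB.
by rewrite /Num.max; do ! case: ifPn => //; rewrite -?leNgt; lra.
Qed.

Lemma trunc_powN_lip b M t v w : 0 < b -> 0 < t -> t <= v -> t <= w ->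
  `|trunc_powN b M v - trunc_powN b M w| <= t `^ (- b) * (b / t) * `|v - w|.
Proof.
move=> b0 t0 tv tw; apply: (le_trans (dist_max0 _ _)).
wlog wv : v w tv tw / w <= v => [h|].
  have [/h|/ltW/h] := leP w v; first exact.
  by rewrite distrC [`|v - w|]distrC; exact.
have w0 : 0 < w by apply: lt_le_trans tw.
have v0 : 0 < v by apply: lt_le_trans tv.
have wv0 : 0 < v / w by rewrite divr_gt0.
rewrite opprB addrA subrK distrC ger0_norm ?subr_ge0; last first.
  by apply: powRNle => //; exact: ltW.
rewrite ger0_norm ?subr_ge0//.
have -> : v `^ (- b) = w `^ (- b) * (v / w) `^ (- b).
  rewrite -powRM ?(ltW w0) ?(ltW wv0)//; congr (_ `^ _).
  by field; exact: lt0r_neq0.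
have h : 1 - b * (v / w - 1) <= (v / w) `^ (- b).
  rewrite /powR gt_eqF//; apply: le_trans (expR_ge1Dx _).
  rewrite lerD2l mulNr lerN2 ler_pM2l//.
  rewrite -[X in ln X](_ : 1 + (v / w - 1) = _); last by ring.
  by apply: le_ln1Dx; rewrite ltrBrDl subrr.
rewrite -[X in X - _]mulr1 -mulrBr -mulrA.
apply: ler_pM.
- exact: powR_ge0.
- rewrite subr_ge0 -[leRHS](powRr0 (v / w)); apply: ler_powR.
    by rewrite ler_pdivlMr// mul1r.
  by rewrite oppr_le0 ltW.
- by apply: powRNle => //; exact: ltW.
apply: (@le_trans _ _ (b * (v / w - 1))); first by move: h; lra.
rewrite -mulrA ler_pM2l//.
have -> : v / w - 1 = w^-1 * (v - w) by field; exact: lt0r_neq0.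
by rewrite ler_wpM2r ?subr_ge0// lef_pV2.
Qed.
End trunc_powN_lipschitz.


(** * The test function inequality *)

Section test_function.
Context (R : realType) (N : nat) (s alpha eps p : R) (V u : 'rV[R]_N -> R).
Local Notation RN := 'rV[R]_N.
Local Notation mu := (@lebesgue_rV R N).
Local Notation a := (N%:R + 2 * s).
Local Notation K := (frac_kernel s).
Hypotheses (s0 : 0 < s) (s1 : s < 1) (hN : 2 * s < N%:R) (eps0 : 0 < eps).
Hypotheses (cV : continuous V) (V0 : forall x, 0 <= V x).
Hypotheses (cu : continuous u) (u0 : forall x, 0 <= u x).
Hypothesis hu : weak_solution s alpha eps p V u.

Let mes_u : measurable_fun setT u. Proof. exact: continuous_measurable_rV. Qed.
Let mV : measurable_fun setT V. Proof. exact: continuous_measurable_rV. Qed.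

Variables (c : RN) (r b M t : R).
Hypotheses (r0 : 0 < r) (cr : `|c| <= 4 * r) (b0 : 0 < b) (M0 : 0 <= M) (t0 : 0 < t).

Local Notation eta := (cutoff c r).
Local Notation w x := (u x + t).

(** The shift [t > 0] makes the test function Lipschitz in [u], even where [u]
vanishes. *)
Definition test_fun x := eta x ^+ 2 * trunc_powN b M (w x).

Let w0 x : 0 < w x. Proof. by rewrite ltr_wpDl. Qed.
Let tw x : t <= w x. Proof. by rewrite lerDr. Qed.

Let B := t `^ (- b).
Let L := B * (b / t).

Lemma test_fun_ge0 x : 0 <= test_fun x.
Proof. by rewrite mulr_ge0 ?sqr_ge0 ?trunc_powN_ge0. Qed.

Lemma trunc_powN_w_le x : trunc_powN b M (w x) <= B.
Proof.
apply: (le_trans (trunc_powN_le _ _ M0)); apply: powRNle => //; exact: ltW.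
Qed.

Lemma test_fun_le x : test_fun x <= if `|x - c| <= 2 * r then B else 0.
Proof.
rewrite /test_fun; case: ifPn => [_|].
  rewrite -[leRHS]mul1r; apply: ler_pM; rewrite ?sqr_ge0 ?trunc_powN_ge0 ?trunc_powN_w_le//.
  by apply: exprn_ile1; [exact: cutoff_ge0|exact: cutoff_le1].
by rewrite -ltNge => /ltW h; rewrite (cutoff_out r0 h) expr0n mul0r.
Qed.

Lemma measurable_trunc_powN d (T : measurableType d) (f : T -> R) :
  measurable_fun setT f -> measurable_fun setT (fun x => trunc_powN b M (f x)).
Proof. by move=> mf; rewrite /trunc_powN; repeat (exact: mf || exact: measurable_cst || measurable_step). Qed.

Lemma measurable_u d (T : measurableType d) (f : T -> RN) :
  measurable_fun setT f -> measurable_fun setT (fun x => u (f x)).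
Proof. by move=> mf; exact: (measurableT_comp mes_u mf). Qed.

Lemma measurable_test_fun d (T : measurableType d) (f : T -> RN) :
  measurable_fun setT f -> measurable_fun setT (fun x => test_fun (f x)).
Proof.
move=> mf; apply: measurable_mul_fun; first by apply: measurable_exprn_fun; exact: measurable_cutoff.
by apply: measurable_trunc_powN; apply: measurable_add_fun => //; exact: measurable_u.
Qed.

Lemma test_fun_dist x y : `|test_fun x - test_fun y| ^+ 2 <=
  2 * L ^+ 2 * `|u x - u y| ^+ 2 + 8 * B ^+ 2 * (eta x - eta y) ^+ 2.
Proof.
have -> : test_fun x - test_fun y = eta x ^+ 2 * (trunc_powN b M (w x) - trunc_powN b M (w y))
   + (eta x ^+ 2 - eta y ^+ 2) * trunc_powN b M (w y).
  by rewrite /test_fun; ring.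
have h1 : `|eta x ^+ 2 * (trunc_powN b M (w x) - trunc_powN b M (w y))| <= L * `|u x - u y|.
  rewrite normrM -[leRHS]mul1r; apply: ler_pM => //.
    rewrite ger0_norm ?sqr_ge0//.
    by apply: exprn_ile1; [exact: cutoff_ge0|exact: cutoff_le1].
  have := trunc_powN_lip M b0 t0 (tw x) (tw y).
  by rewrite (_ : w x - w y = u x - u y); last by ring.
have h2 : `|(eta x ^+ 2 - eta y ^+ 2) * trunc_powN b M (w y)| <= 2 * B * `|eta x - eta y|.
  rewrite normrM [`|trunc_powN _ _ _|]ger0_norm ?trunc_powN_ge0//.
  rewrite -mulrA [B * _]mulrC mulrA; apply: ler_pM => //; rewrite ?trunc_powN_ge0 ?trunc_powN_w_le//.
  rewrite subr_sqr normrM mulrC ler_wpM2r// ger0_norm; last first.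
    by rewrite addr_ge0 ?cutoff_ge0.
  by rewrite (_ : 2 = 1 + 1)// lerD// cutoff_le1.
have sq (x1 x2 y1 y2 : R) : `|x1| <= y1 -> `|x2| <= y2 ->
    `|x1 + x2| ^+ 2 <= 2 * y1 ^+ 2 + 2 * y2 ^+ 2.
  move=> xy1 xy2.
  have y10 : 0 <= y1 by apply: le_trans xy1.
  have y20 : 0 <= y2 by apply: le_trans xy2.
  apply: (@le_trans _ _ ((y1 + y2) ^+ 2)).
    rewrite lerXn2r ?nnegrE ?addr_ge0//.
    by apply: (le_trans (ler_normD _ _)); exact: lerD.
  by rewrite -subr_ge0 (_ : _ - _ = (y1 - y2) ^+ 2) ?sqr_ge0//; ring.
apply: (le_trans (sq _ _ _ _ h1 h2)).
by rewrite -[(eta x - eta y) ^+ 2]real_normK ?num_real//; apply: ler_of_eq; ring.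
Qed.

Let mK : measurable_fun setT (fun z : RN * RN => K z.1 z.2).
Proof. exact: measurable_frac_kernel. Qed.
Let me1 : measurable_fun setT (fun z : RN * RN => eta z.1).
Proof. exact: measurable_cutoff. Qed.
Let me2 : measurable_fun setT (fun z : RN * RN => eta z.2).
Proof. exact: measurable_cutoff. Qed.
Let mu1 : measurable_fun setT (fun z : RN * RN => u z.1).
Proof. exact: measurable_u. Qed.
Let mu2 : measurable_fun setT (fun z : RN * RN => u z.2).
Proof. exact: measurable_u. Qed.
Let mt1 : measurable_fun setT (fun z : RN * RN => test_fun z.1).
Proof. exact: measurable_test_fun. Qed.
Let mt2 : measurable_fun setT (fun z : RN * RN => test_fun z.2).
Proof. exact: measurable_test_fun. Qed.
Let mt : measurable_fun setT test_fun.
Proof. exact: measurable_test_fun. Qed.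

Ltac meas := repeat (measurable_step || exact: measurable_cst || exact: mK ||
  exact: me1 || exact: me2 || exact: mu1 || exact: mu2 || exact: mt1 ||
  exact: mt2 || exact: mt || exact: mes_u || exact: mV).

Lemma int_du_lty : (\int[(mu \x mu)%E]_z
  (`|u z.1 - u z.2| ^+ 2 * K z.1 z.2)%:E < +oo)%E.
Proof. by case: hu => -[[_ ug] _] _; exact: ug. Qed.

Lemma int_deta_lty : (\int[(mu \x mu)%E]_z
  ((eta z.1 - eta z.2) ^+ 2 * K z.1 z.2)%:E < +oo)%E.
Proof.
have [C [C0 CP]] := @cutoff_error R N s s0 s1.
have [C' [C'0 CP']] := @int_weight R N s s0.
have := @CP c r (fun=> 1) r0 cr (measurable_cst _) (fun=> ler01).
under [X in (_ <= _ * X)%E -> _]eq_integral do rewrite mul1r.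
move=> h; apply: (@le_lt_trans _ _ ((C * r ^+ N)%:E * (C' * r `^ (- (2 * s)))%:E)%E); last first.
  by rewrite -EFinM ltry.
apply: le_trans (_ : (_ <= (C * r ^+ N)%:E * _)%E).
  apply: le_trans h; apply: le_int.
  - by meas.
  - by meas.
  - by move=> z; rewrite mulr_ge0 ?sqr_ge0 ?frac_kernel_ge0.
  - move=> z; rewrite ler_wpM2r ?frac_kernel_ge0// ler_peMr ?sqr_ge0//; lra.
apply: lee_wpmul2l; last exact: CP'.
by rewrite lee_fin mulr_ge0 ?exprn_ge0 ?ltW.
Qed.

Lemma int_dtest_fun_lty : (\int[(mu \x mu)%E]_z
  (`|test_fun z.1 - test_fun z.2| ^+ 2 * K z.1 z.2)%:E < +oo)%E.
Proof.
apply: (@le_lt_trans _ _ (\int[(mu \x mu)%E]_z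
  ((2 * L ^+ 2) * (`|u z.1 - u z.2| ^+ 2 * K z.1 z.2)
  + (8 * B ^+ 2) * ((eta z.1 - eta z.2) ^+ 2 * K z.1 z.2))%:E)%E).
  apply: le_int.
  - by meas.
  - by meas.
  - by move=> z; rewrite mulr_ge0 ?sqr_ge0 ?frac_kernel_ge0.
  - move=> z; rewrite [leRHS](_ : _ = (2 * L ^+ 2 * `|u z.1 - u z.2| ^+ 2
       + 8 * B ^+ 2 * (eta z.1 - eta z.2) ^+ 2) * K z.1 z.2); last by ring.
    by apply: ler_wpM2r; [exact: frac_kernel_ge0|exact: test_fun_dist].
have L0 : 0 <= 2 * L ^+ 2 by rewrite mulr_ge0// sqr_ge0.
have B0 : 0 <= 8 * B ^+ 2 by rewrite mulr_ge0// sqr_ge0.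
have q1 (z : RN * RN) : 0 <= `|u z.1 - u z.2| ^+ 2 * K z.1 z.2.
  by rewrite mulr_ge0 ?sqr_ge0 ?frac_kernel_ge0.
have q2 (z : RN * RN) : 0 <= (eta z.1 - eta z.2) ^+ 2 * K z.1 z.2.
  by rewrite mulr_ge0 ?sqr_ge0 ?frac_kernel_ge0.
rewrite intD; last first.
- by move=> z; rewrite mulr_ge0.
- by move=> z; rewrite mulr_ge0.
- by meas.
- by meas.
rewrite intZ//; last by meas.
rewrite intZ//; last by meas.
by apply: lte_add_pinfty; apply: lte_mul_pinfty;
  rewrite ?lee_fin ?int_du_lty ?int_deta_lty.
Qed.

Lemma V_bound : exists2 Vm, 0 < Vm & forall x, `|x - c| <= 2 * r -> V x <= Vm.
Proof.
have [Vm [Vm0 VP]] := continuous_bounded_rV (6 * r) cV.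
exists Vm => // x xc; apply: (le_trans (ler_norm _)); apply: VP.
have := ler_normD (x - c) c; rewrite subrK; move: xc cr; lra.
Qed.

Lemma supp_int_lty (h : R) : 0 <= h ->
  (\int[mu]_x (if (`|x - c| <= 2 * r)%R then h else 0)%:E < +oo)%E.
Proof.
move=> h0; rewrite int_if_cst//; last exact: measurable_ball_norm.
rewrite [X in (_ * X < _)%E](_ : _ = ((2 * (2 * r)) ^+ N)%:E); last first.
  by apply: lebesgue_rV_ball; rewrite mulr_ge0// ltW.
by rewrite -EFinM ltry.
Qed.

Let mball (h : R) : measurable_fun setT
  (fun x : RN => if (`|x - c| <= 2 * r)%R then h else 0).
Proof. by apply: measurable_if_fun => //; exact: measurable_ball_norm. Qed.

Let B_ge0 : 0 <= B. Proof. exact: powR_ge0. Qed.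

(** Being compactly supported and Lipschitz in [u] and in the cutoff, the test
function inherits their finite energy. *)
Lemma test_fun_HV : HV s V test_fun.
Proof.
have q0 : 0 < 2 * N%:R / (N%:R - 2 * s).
  have N0 : 0 < N%:R :> R by apply: lt_trans hN; rewrite mulr_gt0.
  by rewrite divr_gt0 ?mulr_gt0// subr_gt0.
split; first split.
- rewrite inE /=; apply/andP; split; first by rewrite inE.
  rewrite inE /= /finite_norm unlock; apply: poweR_lty.
  set q := (2 * N%:R / _) in q0 *.
  apply: le_lt_trans (supp_int_lty (powR_ge0 B q)).
  rewrite (eq_integral (fun x => (`|test_fun x| `^ q)%:E))//.
  apply: le_int.
  + by meas.
  + exact: mball.
  + by move=> x; exact: powR_ge0.
  + move=> x; have := test_fun_le x; rewrite ger0_norm ?test_fun_ge0//.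
    case: ifPn => _ h.
      by apply: ge0_ler_powR => //; rewrite ?nnegrE ?test_fun_ge0// ltW.
    have -> : test_fun x = 0 by apply: le_anti; rewrite h test_fun_ge0.
    by rewrite powR0 ?gt_eqF.
- exact: int_dtest_fun_lty.
- have [Vm Vm0 VP] := V_bound.
  apply: le_lt_trans (@supp_int_lty (Vm * B ^+ 2) _); last first.
    by rewrite mulr_ge0 ?sqr_ge0// ltW.
  apply: le_int.
  + by meas.
  + exact: mball.
  + by move=> x; rewrite mulr_ge0 ?sqr_ge0.
  + move=> x; have := test_fun_le x; have := VP x; rewrite ger0_norm ?test_fun_ge0//.
    case: ifPn => _ Vx h.
      apply: ler_pM; rewrite ?sqr_ge0 ?Vx//.
      by rewrite lerXn2r// nnegrE test_fun_ge0.
    have -> : test_fun x = 0 by apply: le_anti; rewrite h test_fun_ge0.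
    by rewrite expr0n mulr0.
Qed.

Lemma energy_density_integrable : (mu \x mu)%E.-integrable setT (EFin \o
  (fun z => (u z.1 - u z.2) * (test_fun z.1 - test_fun z.2) * K z.1 z.2)).
Proof.
have i1 := int_lt_integrable (_ : measurable_fun setT _) (_ : forall x, 0 <= _) int_du_lty.
have i2 := int_lt_integrable (_ : measurable_fun setT _) (_ : forall x, 0 <= _) int_dtest_fun_lty.
have {}i1 := i1 ltac:(meas) (fun z => mulr_ge0 (sqr_ge0 _) (frac_kernel_ge0 _ _ _)).
have {}i2 := i2 ltac:(meas) (fun z => mulr_ge0 (sqr_ge0 _) (frac_kernel_ge0 _ _ _)).
have i3 := integrableD measurableT i1 i2.
apply: (@int_dominated _ _ _ _ _ (fun z => `|u z.1 - u z.2| ^+ 2 * K z.1 z.2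
   + `|test_fun z.1 - test_fun z.2| ^+ 2 * K z.1 z.2) _ i3).
  by meas.
move=> z; rewrite -mulrDl normrM [`|K _ _|]ger0_norm ?frac_kernel_ge0//.
rewrite ler_wpM2r ?frac_kernel_ge0// normrM.
move: (`|_|) (`|_|) (normr_ge0 (u z.1 - u z.2)) (normr_ge0 (test_fun z.1 - test_fun z.2)) => A D A0 D0.
have := sqr_ge0 (A - D); have := sqr_ge0 A; have := sqr_ge0 D; rewrite !expr2; lra.
Qed.

Lemma int_V_test_fun_lty : (\int[mu]_x (V x * u x * test_fun x)%:E < +oo)%E.
Proof.
have [Vm Vm0 VP] := V_bound.
have [um [um0 uP]] := continuous_bounded_rV (6 * r) cu.
apply: le_lt_trans (@supp_int_lty (Vm * um * B) _); last first.
  by rewrite !mulr_ge0// ltW.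
apply: le_int.
+ by meas.
+ exact: mball.
+ by move=> x; rewrite mulr_ge0 ?test_fun_ge0// mulr_ge0.
+ move=> x /=; have := test_fun_le x; have := VP x.
  case: ifPn => xc Vx h.
    apply: ler_pM (mulr_ge0 (V0 x) (u0 x)) (test_fun_ge0 x) _ h.
    apply: ler_pM (V0 x) (u0 x) (Vx isT) _.
    apply: (le_trans (ler_norm _)); apply: uP.
    have := ler_normD (x - c) c; rewrite subrK; move: xc cr; lra.
  have -> : test_fun x = 0 by apply: le_anti; rewrite h test_fun_ge0.
  by rewrite mulr0.
Qed.

Definition gain_density z := (gain b M (eta z.1) (w z.1) (w z.2)
  + gain b M (eta z.2) (w z.2) (w z.1)) * K z.1 z.2.

Definition err_density z := (eta z.1 - eta z.2) ^+ 2 * (w z.1 `^ (1 - b) + w z.2 `^ (1 - b))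
   * K z.1 z.2.

Definition nonlin (phi : RN -> R) : \bar R :=
  (\int[mu]_x (riesz_potential alpha (fun y => `|u y| `^ p)%R x *
     (`|u x| `^ (p - 2) * u x * phi x)%:E))%E.

Lemma gain_density_ge0 z : 0 <= gain_density z.
Proof.
by rewrite /gain_density mulr_ge0 ?frac_kernel_ge0// addr_ge0// gain_ge0// ltW.
Qed.

Lemma err_density_ge0 z : 0 <= err_density z.
Proof.
by rewrite /err_density mulr_ge0 ?frac_kernel_ge0// mulr_ge0 ?sqr_ge0// addr_ge0// powR_ge0.
Qed.

Lemma measurable_gain_density : measurable_fun setT gain_density.
Proof.
have mw1 : measurable_fun setT (fun z : RN * RN => trunc_powN b M (w z.1)).
  by apply: measurable_trunc_powN; meas.
have mw2 : measurable_fun setT (fun z : RN * RN => trunc_powN b M (w z.2)).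
  by apply: measurable_trunc_powN; meas.
rewrite /gain_density /gain; repeat (measurable_step ||
  exact: measurable_cst || exact: mw1 || exact: mw2 || exact: mK || exact: me1 ||
  exact: me2 || exact: mu1 || exact: mu2).
Qed.

Lemma measurable_err_density : measurable_fun setT err_density.
Proof. by rewrite /err_density; meas. Qed.

(** The weak formulation with [phi = test_fun]: by [caccioppoli], the gain moves
to the side of the nonlinearity. *)
Lemma test_inequality :
  ((eps `^ (- alpha))%:E * nonlin test_fun +
   (eps `^ (2 * s) * 2^-1)%:E * \int[(mu \x mu)%E]_z (gain_density z)%:E <=
   (eps `^ (2 * s) * (1 + 2 / b))%:E * \int[(mu \x mu)%E]_z (err_density z)%:E
   + \int[mu]_x (V x * u x * test_fun x)%:E)%E.
Proof.
have [_ /(_ _ test_fun_HV) weq] := hu.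
rewrite -[((eps `^ _)%:E * nonlin _)%E]weq /HV_inner.
set e2 := eps `^ (2 * s); have e20 : 0 < e2 by exact: powR_gt0.
have iX := energy_density_integrable.
have iV : mu.-integrable setT (EFin \o (fun x => V x * u x * test_fun x)).
  apply: int_lt_integrable int_V_test_fun_lty; first by meas.
  by move=> x; rewrite mulr_ge0 ?test_fun_ge0// mulr_ge0.
have mG : measurable_fun setT (fun z => 2^-1 * gain_density z).
  by apply: measurable_mul_fun => //; exact: measurable_gain_density.
have b20 : 0 <= 1 + 2 / b by rewrite addr_ge0// divr_ge0// ltW.
have mEE : measurable_fun setT (fun z => (1 + 2 / b) * err_density z).
  by apply: measurable_mul_fun => //; exact: measurable_err_density.
have key := @int_le_split _ _ _ _ _ (fun z => 2^-1 * gain_density z)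
  (fun z => (1 + 2 / b) * err_density z) iX mG mEE.
have {}key : (\int[(mu \x mu)%E]_x ((u x.1 - u x.2) * (test_fun x.1 - test_fun x.2) * K x.1 x.2)%:E
  + \int[(mu \x mu)%E]_x (2^-1 * gain_density x)%:E <= \int[(mu \x mu)%E]_x ((1 + 2 / b) * err_density x)%:E)%E.
  apply: key.
  - by move=> z; rewrite mulr_ge0// gain_density_ge0.
  - by move=> z; rewrite mulr_ge0// err_density_ge0.
  move=> z; rewrite /gain_density /err_density [2^-1 * _]mulrA -mulrDl [leRHS]mulrA.
  rewrite ler_wpM2r ?frac_kernel_ge0//.
  have -> : u z.1 - u z.2 = w z.1 - w z.2 by ring.
  by apply: caccioppoli => //; exact: cutoff_ge0.
rewrite intZ// in key; [|exact: measurable_gain_density|exact: gain_density_ge0].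
rewrite intZ// in key; [|exact: measurable_err_density|exact: err_density_ge0].
have iXf := integrable_fin_num measurableT iX.
have iVf := integrable_fin_num measurableT iV.
rewrite EFinD EFinM /Rintegral !fineK//.
have g0 : (0 <= \int[(mu \x mu)%E]_z (gain_density z)%:E)%E by apply: int_ge0; exact: gain_density_ge0.
rewrite addeAC; apply: leeD => //.
rewrite EFinM -muleA -muleDr//; last first.
  by rewrite fin_num_adde_defr.
rewrite EFinM -muleA; apply: lee_wpmul2l => //.
by rewrite lee_fin ltW.
Qed.
End test_function.


(** * Riesz potentials and the decay of the potential *)

Lemma lee_ldiv (R : realType) (k z : R) (x : \bar R) : 0 < k ->
  (k%:E * x <= z%:E)%E -> (x <= (z / k)%:E)%E.
Proof.
move=> k0 h; have -> : x = ((k^-1)%:E * (k%:E * x))%E.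
  by rewrite muleA -EFinM mulVf ?gt_eqF// mul1e.
rewrite mulrC EFinM; apply: lee_wpmul2l => //.
by rewrite lee_fin invr_ge0 ltW.
Qed.

Lemma int_prod d1 d2 (T1 : measurableType d1) (T2 : measurableType d2) (R : realType)
  (m1 : {sigma_finite_measure set T1 -> \bar R})
  (m2 : {sigma_finite_measure set T2 -> \bar R}) (f : T1 -> R) (g : T2 -> R) :
  measurable_fun setT f -> measurable_fun setT g ->
  (forall x, 0 <= f x) -> (forall x, 0 <= g x) ->
  (\int[(m1 \x m2)%E]_z (f z.1 * g z.2)%:E =
    \int[m1]_x (f x)%:E * \int[m2]_y (g y)%:E)%E.
Proof.
move=> mf mg f0 g0.
rewrite fubini_tonelli1; last 2 first.
- by apply: measurable_EFin_fun; apply: measurable_mul_fun; [exact: (measurableT_comp mf measurable_fst)|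
    exact: (measurableT_comp mg measurable_snd)].
- by move=> z; rewrite lee_fin mulr_ge0.
rewrite -ge0_integralZr//; last 3 first.
- exact: measurable_EFin_fun.
- by move=> x _; rewrite lee_fin.
- by apply: int_ge0.
apply: eq_integral => x _; rewrite /fubini_F /=.
by rewrite intZ.
Qed.

Lemma potential_decay (R : realType) N (s : R) (V : 'rV[R]_N -> R) :
  0 < s -> (forall x, 0 <= V x) ->
  limf_esup (fun x : 'rV[R]_N => ((1 + enorm x `^ (2 * s)) * V x)%:E)
          (@enorm_pinfty R N) = 0%E ->
  forall d, 0 < d -> exists2 rho, 0 < rho &
    forall x, rho <= `|x| -> V x <= d * `|x| `^ (- (2 * s)).
Proof.
move=> s0 V0 hV d d0; move: hV; rewrite limf_esupE => hV.
have /ereal_inf_lt[_ [A [M _ MA] <-] supA] : (ereal_inf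
  [set ereal_sup [set ((1 + enorm x `^ (2 * s)) * V x)%:E | x in A] |
     A in @enorm_pinfty R N] < d%:E)%E by rewrite hV lte_fin.
exists (Num.max 1 (M + 1)); first by rewrite lt_max ltr01.
move=> x; rewrite ge_max => /andP[x1 xM].
have x0 : 0 < `|x| by apply: lt_le_trans x1.
have xe := norm_le_enorm x.
have Ax : A x.
  by apply: MA => /=; apply: lt_le_trans xe; apply: lt_le_trans xM; rewrite ltrDl.
have : (((1 + enorm x `^ (2 * s)) * V x)%:E <= d%:E)%E.
  by apply: le_trans (ltW supA); apply: ereal_sup_ubound; exists x.
rewrite lee_fin powRN ler_pdivlMr ?powR_gt0//; apply: le_trans.
rewrite mulrC ler_wpM2r//.
apply: (@le_trans _ _ (enorm x `^ (2 * s))); last by rewrite lerDr.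
apply: ge0_ler_powR => //; rewrite ?nnegrE ?enorm_ge0//.
by rewrite mulr_ge0// ltW.
Qed.

Section singleton.
Context (R : realType) (N : nat).
Local Notation RN := 'rV[R]_N.
Local Notation mu := (@lebesgue_rV R N).

Lemma measurable_eq_rV (x : RN) : measurable_fun setT (fun y : RN => x == y).
Proof.
rewrite (_ : (fun y => _) = fun y => `|y - x| <= 0).
  exact: measurable_ball_norm.
by apply/funext => y; rewrite normr_le0 subr_eq0 eq_sym.
Qed.

(** The kernels take the value 0 on the diagonal, so that lower bounds for them
hold off a point only. *)
Lemma int_diff_point (x : RN) (f : RN -> R) : (0 < N)%N ->
  measurable_fun setT f -> (forall y, 0 <= f y) ->
  (\int[mu]_y (f y)%:E = \int[mu]_y (if x != y then f y else 0)%:E)%E.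
Proof.
move=> N0 mf f0.
have mb := measurable_eq_rV x.
have mnb : measurable_fun setT (fun y : RN => x != y) by apply: measurable_neg.
have -> : (fun y => (f y)%:E) =
   fun y => ((if x != y then f y else 0) + (if x == y then f x else 0))%:E.
  by apply/funext => y; case: eqVneq => [->|_]; rewrite ?add0r ?addr0.
rewrite intD; last first.
- by move=> y; case: ifP.
- by move=> y; case: ifP.
- exact: measurable_if_fun.
- exact: measurable_if_fun.
rewrite [X in (_ + X)%E](_ : _ = 0)%E ?adde0//.
rewrite int_if_cst//.
rewrite [X in (_ * X)%E](_ : _ = ((2 * 0) ^+ N)%:E); last first.
  rewrite -(@lebesgue_rV_ball R N x 0)//; congr (_ _); apply/seteqP; split => y /=.
    by move=> /eqP ->; rewrite subrr normr0.
  by rewrite normr_le0 subr_eq0 eq_sym.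
by rewrite mulr0 expr0n gtn_eqF// mule0.
Qed.
End singleton.

Section riesz.
Context (R : realType) (N : nat) (alpha : R).
Local Notation RN := 'rV[R]_N.
Local Notation mu := (@lebesgue_rV R N).
Hypotheses (N0 : (0 < N)%N) (alphaN : alpha < N%:R).

Lemma riesz_kernel_ge0 (x : RN) : 0 <= riesz_kernel alpha x.
Proof. by rewrite invr_ge0 powR_ge0. Qed.

Lemma measurable_riesz_kernel d (T : measurableType d) (f : T -> RN) :
  measurable_fun setT f -> measurable_fun setT (fun t => riesz_kernel alpha (f t)).
Proof.
by move=> mf; apply: measurable_inv_fun; apply: measurable_powR_fun; exact: measurable_enorm_rV.
Qed.

Lemma riesz_potential_ge (f : RN -> R) (b : RN -> bool) x (D : R) :
  measurable_fun setT f -> (forall y, 0 <= f y) -> measurable_fun setT b ->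
  (forall y, b y -> `|x - y| <= D) ->
  (((Num.sqrt N%:R * D) `^ (alpha - N%:R))%:E *
     \int[mu]_y (if b y then f y else 0)%:E <= riesz_potential alpha f x)%E.
Proof.
move=> mf f0 mb bD.
have mif0 : measurable_fun setT (fun y => if b y then f y else 0).
  by apply: measurable_if_fun.
rewrite (@int_diff_point _ _ x)//; last by move=> y; case: ifP.
have mnb : measurable_fun setT (fun y : RN => x != y).
  by apply: measurable_neg; exact: measurable_eq_rV.
rewrite -intZ ?powR_ge0//; last 2 first.
- by apply: measurable_if_fun.
- by move=> y; case: ifP => // _; case: ifP.
apply: le_int.
- by apply: measurable_mul_fun => //; apply: measurable_if_fun.
- by apply: measurable_mul_fun => //; apply: measurable_riesz_kernel; apply: measurable_subr_rV.
- by move=> y; rewrite mulr_ge0 ?powR_ge0//; case: ifP => // _; case: ifP.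
move=> y; case: ifPn => [xy|_]; last by rewrite mulr0 mulr_ge0 ?riesz_kernel_ge0.
case: ifPn => [/bD xyD|_]; last by rewrite mulr0 mulr_ge0 ?riesz_kernel_ge0.
rewrite ler_wpM2r// /riesz_kernel -powRN opprB.
have xy0 : 0 < `|x - y| by rewrite normr_gt0 subr_eq0.
rewrite -[alpha - _]opprB; apply: powRNle.
- by rewrite subr_ge0 ltW.
- exact: lt_le_trans (norm_le_enorm _).
- by apply: le_trans (enorm_le_norm _) _; rewrite ler_wpM2l.
Qed.

Lemma measurable_riesz_potential (f : RN -> R) :
  measurable_fun setT f -> (forall y, 0 <= f y) ->
  measurable_fun setT (riesz_potential alpha f).
Proof.
move=> mf f0.
have := @measurable_fun_fubini_tonelli_F _ _ RN RN R mu
   (fun z => (riesz_kernel alpha (z.1 - z.2) * f z.2)%:E).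
apply; last by move=> z; rewrite lee_fin mulr_ge0 ?riesz_kernel_ge0.
apply: measurable_EFin_fun; apply: measurable_mul_fun.
  by apply: measurable_riesz_kernel; apply: measurable_subr_rV.
exact: (measurableT_comp mf measurable_snd).
Qed.

Lemma riesz_potential_ge0 (f : RN -> R) x :
  (forall y, 0 <= f y) -> (0 <= riesz_potential alpha f x)%E.
Proof. by move=> f0; apply: int_ge0 => y; rewrite mulr_ge0 ?riesz_kernel_ge0. Qed.
End riesz.


(** * Testing on balls far from the origin *)

Section annulus.
Context (R : realType) (N : nat) (s alpha eps p : R) (V u : 'rV[R]_N -> R).
Local Notation RN := 'rV[R]_N.
Local Notation mu := (@lebesgue_rV R N).
Local Notation a := (N%:R + 2 * s).
Local Notation K := (frac_kernel s).
Hypotheses (s0 : 0 < s) (s1 : s < 1) (hN : 2 * s < N%:R) (eps0 : 0 < eps).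
Hypotheses (alphaN : alpha < N%:R) (p1 : 1 < p).
Hypotheses (cV : continuous V) (V0 : forall x, 0 <= V x).
Hypotheses (cu : continuous u) (u0 : forall x, 0 <= u x).
Hypothesis hu : weak_solution s alpha eps p V u.
Hypothesis Vdecay : forall d, 0 < d -> exists2 rho, 0 < rho &
    forall x, rho <= `|x| -> V x <= d * `|x| `^ (- (2 * s)).

Let mes_u : measurable_fun setT u. Proof. exact: continuous_measurable_rV. Qed.
Let mV : measurable_fun setT V. Proof. exact: continuous_measurable_rV. Qed.
Let N0 : (0 < N)%N.
Proof. by rewrite -(ltr_nat R); apply: lt_trans hN; rewrite mulr_gt0. Qed.

Lemma trunc_powN1 (v : R) : 0 < v -> trunc_powN 1 0 v = v^-1.
Proof.
by move=> v0; rewrite /trunc_powN subr0 powR_inv1 ?ltW// max_r// invr_ge0 ltW.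
Qed.

Lemma exprM_powRN2s (r : R) : 0 < r -> r ^+ N * r `^ (- (2 * s)) = r `^ (N%:R - 2 * s).
Proof.
by move=> r0; rewrite powRD ?(gt_eqF r0) ?implybT// powR_mulrn// ltW.
Qed.

(** For [b = 1] and [M = 0] the test function is [eta^2 / (u + t)], so that the
potential term is at most the integral of [V eta^2]; on balls of radius [2 r] at
distance [2 r] from the origin it is [O(r^(N - 2s))], like the cutoff error. *)
Lemma annulus_test : exists C r1 : R, [/\ 0 < C, 0 < r1 &
  forall c r t, r1 <= r -> `|c| = 4 * r -> 0 < t ->
  [/\ (nonlin alpha p u (test_fun u c r 1 0 t) <= (C * r `^ (N%:R - 2 * s))%:E)%E,
      (\int[(mu \x mu)%E]_z (err_density s u c r 1 t z)%:E <= (C * r `^ (N%:R - 2 * s))%:E)%E &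
      (\int[(mu \x mu)%E]_z (gain_density s u c r 1 0 t z)%:E <= (C * r `^ (N%:R - 2 * s))%:E)%E]].
Proof.
have [Ce [Ce0 CeP]] := @cutoff_error R N s s0 s1.
have [Cw [Cw0 CwP]] := @int_weight R N s s0.
have [r1 r10 Vr1] := Vdecay ltr01.
pose e2 := eps `^ (2 * s); have e20 : 0 < e2 by exact: powR_gt0.
pose ea := eps `^ (- alpha); have ea0 : 0 < ea by exact: powR_gt0.
pose C1 := e2 * (1 + 2 / 1) * (Ce * Cw) + 4 ^+ N.
have C10 : 0 < C1.
  by rewrite addr_gt0// ?exprn_gt0// !mulr_gt0// addr_gt0// divr_gt0.
exists (Ce * Cw + C1 / ea + C1 / (e2 / 2)), r1; split => //.
  by rewrite !addr_gt0// ?mulr_gt0// ?invr_gt0// divr_gt0.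
move=> c r t r1r c4 t0.
have r0 : 0 < r by apply: lt_le_trans r1r.
have c4' : `|c| <= 4 * r by rewrite c4.
pose P := r `^ (N%:R - 2 * s); have P0 : 0 < P by exact: powR_gt0.
have err : (\int[(mu \x mu)%E]_z (err_density s u c r 1 t z)%:E <= (Ce * Cw * P)%:E)%E.
  have := CeP c r (fun=> 1) r0 c4' (measurable_cst _) (fun=> ler01).
  under [X in (_ <= _ * X)%E -> _]eq_integral do rewrite mul1r.
  rewrite /err_density => h.
  under eq_integral do rewrite subrr !powRr0.
  apply: (le_trans h).
  apply: (@le_trans _ _ ((Ce * r ^+ N)%:E * (Cw * r `^ (- (2 * s)))%:E)%E).
    apply: lee_wpmul2l; last exact: CwP.
    by rewrite lee_fin mulr_ge0 ?exprn_ge0 ?(ltW r0) ?(ltW Ce0).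
  by rewrite -EFinM lee_fin /P -exprM_powRN2s//; apply: ler_of_eq; ring.
have w0 x : 0 < u x + t by rewrite ltr_wpDl.
have Vint : (\int[mu]_x (V x * u x * test_fun u c r 1 0 t x)%:E <= (4 ^+ N * P)%:E)%E.
  apply: (@le_trans _ _ (\int[mu]_x (if (`|x - c| <= 2 * r)%R then r `^ (- (2 * s)) else 0)%:E)%E).
    apply: le_int.
    - apply: measurable_mul_fun; first exact: measurable_mul_fun.
      exact: measurable_test_fun.
    - by apply: measurable_if_fun => //; exact: measurable_ball_norm.
    - by move=> x; rewrite mulr_ge0 ?test_fun_ge0// mulr_ge0.
    move=> x; rewrite /test_fun; case: ifPn => [xc|]; last first.
      by rewrite -ltNge => /ltW h; rewrite (cutoff_out r0 h) expr0n mul0r mulr0.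
    rewrite trunc_powN1//.
    have x2r : 2 * r <= `|x|.
      have := ler_normD (c - x) x; rewrite subrK c4 distrC; move: xc; lra.
    have Vx : V x <= r `^ (- (2 * s)).
      apply: (le_trans (Vr1 x _)); first by move: r1r r0 x2r; lra.
      rewrite mul1r; apply: powRNle => //; first by rewrite mulr_ge0// ltW.
      by move: r0 x2r; lra.
    have -> : V x * u x * (cutoff c r x ^+ 2 * (u x + t)^-1) =
       V x * (u x / (u x + t) * cutoff c r x ^+ 2) by ring.
    rewrite -[leRHS]mulr1; apply: ler_pM => //.
      by rewrite mulr_ge0 ?sqr_ge0// divr_ge0// ltW.
    rewrite -[leRHS]mulr1; apply: ler_pM => //.
    - by rewrite divr_ge0// ltW.
    - by rewrite sqr_ge0.
    - by rewrite ler_pdivrMr// mul1r lerDl ltW.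
    - by apply: exprn_ile1; [exact: cutoff_ge0|exact: cutoff_le1].
  rewrite int_if_cst ?powR_ge0//; last exact: measurable_ball_norm.
  rewrite [X in (_ * X <= _)%E](_ : _ = ((2 * (2 * r)) ^+ N)%:E); last first.
    by apply: lebesgue_rV_ball; rewrite mulr_ge0// ltW.
  rewrite -EFinM lee_fin /P -exprM_powRN2s// mulrA -natrM exprMn.
  by apply: ler_of_eq; ring.
have b0 : 0 < 1 :> R by [].
have := test_inequality s0 s1 hN eps0 cV V0 cu u0 hu r0 c4' b0 (lexx 0) t0.
rewrite -/e2 -/ea; set T := nonlin _ _ _ _; set G := (\int[_]_z (gain_density _ _ _ _ _ _ _ z)%:E)%E.
set E := (\int[_]_z (err_density _ _ _ _ _ _ z)%:E)%E in err *; set W := (\int[_]_x _)%E in Vint *.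
move=> test.
have tot : (ea%:E * T + (e2 / 2)%:E * G <= (C1 * P)%:E)%E.
  apply: (le_trans test).
  have -> : C1 * P = e2 * (1 + 2 / 1) * (Ce * Cw * P) + 4 ^+ N * P.
    by rewrite /C1; ring.
  rewrite [leRHS]EFinD; apply: leeD => //.
  rewrite [leRHS]EFinM; apply: lee_wpmul2l => //.
  by rewrite lee_fin mulr_ge0 ?(ltW e20)// addr_ge0.
have T0 : (0 <= T)%E.
  apply: integral_ge0 => x _; apply: mule_ge0.
    by apply: riesz_potential_ge0 => y; exact: powR_ge0.
  by rewrite lee_fin mulr_ge0 ?test_fun_ge0// mulr_ge0// powR_ge0.
have G0 : (0 <= G)%E by apply: int_ge0 => z; exact: gain_density_ge0.
have Cc0 : 0 < Ce * Cw by rewrite mulr_gt0.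
have q1 : 0 < C1 / ea by rewrite divr_gt0.
have q2 : 0 < C1 / (e2 / 2) by rewrite !divr_gt0.
split.
- apply: (@le_trans _ _ (C1 * P / ea)%:E).
    apply: lee_ldiv => //; apply: le_trans tot.
    by rewrite leeDl// mule_ge0// lee_fin ltW// divr_gt0.
  rewrite lee_fin mulrAC ler_pM2r//; lra.
- by apply: (le_trans err); rewrite lee_fin ler_pM2r//; lra.
- apply: (@le_trans _ _ (C1 * P / (e2 / 2))%:E).
    apply: lee_ldiv; first by rewrite divr_gt0.
    apply: le_trans tot.
    by rewrite leeDr// mule_ge0// lee_fin ltW.
  rewrite lee_fin mulrAC ler_pM2r//; lra.
Qed.

Definition inv_mass c r t : \bar R :=
  (\int[mu]_x (if (`|x - c| <= r)%R then (u x + t)^-1 else 0)%:E)%E.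

Definition far_mass c r : \bar R :=
  (\int[mu]_y (if (2 * r <= `|y - c|)%R then u y * (r + `|y|) `^ (- a) else 0)%:E)%E.

Let measurable_far_fun (c : RN) (r : R) : measurable_fun setT (fun y : RN =>
  if 2 * r <= `|y - c| then u y * (r + `|y|) `^ (- a) else 0).
Proof.
have mn : measurable_fun setT (fun y : RN => `|y|) by apply: measurable_norm_rV.
have mnc : measurable_fun setT (fun y : RN => `|y - c|).
  by apply: measurable_norm_rV; apply: measurable_subr_rV.
by repeat (exact: mn || exact: mnc || exact: mes_u || exact: measurable_cst || measurable_step).
Qed.

Let measurable_ball_if (c : RN) (r : R) (f : RN -> R) : measurable_fun setT f ->
  measurable_fun setT (fun y : RN => if `|y - c| <= r then f y else 0).
Proof. by move=> mf; apply: measurable_if_fun => //; exact: measurable_ball_norm. Qed.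

Let measurable_inv_w (t : R) : measurable_fun setT (fun x : RN => (u x + t)^-1).
Proof. by apply: measurable_inv_fun; apply: measurable_add_fun. Qed.

(** For [x] in the ball and [y] off the support of the cutoff, [gain_density]
and [err_density] together exceed [u y / (u x + t)] times the kernel, and the
double integral of that quotient factors. A large mass of [u] elsewhere thus
forces the mean of [1 / (u + t)] on the ball to be small. *)
Lemma cross_estimate : exists C r1 : R, [/\ 0 < C, 0 < r1 &
  forall c r t, r1 <= r -> `|c| = 4 * r -> 0 < t ->
  (inv_mass c r t * far_mass c r <= (C * r `^ (N%:R - 2 * s))%:E)%E].
Proof.
have [C [r1 [C0 r10 CP]]] := annulus_test.
pose k := (Num.sqrt N%:R * 5) `^ (- a).
have sN : 0 < Num.sqrt N%:R :> R by rewrite sqrtr_gt0 ltr0n.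
have k0 : 0 < k by rewrite powR_gt0// mulr_gt0.
exists ((C + C) / k), r1; split => //; first by rewrite divr_gt0// addr_gt0.
move=> c r t r1r c4 t0; have [_ err gn] := CP c r t r1r c4 t0.
have r0 : 0 < r by apply: lt_le_trans r1r.
have w0 x : 0 < u x + t by rewrite ltr_wpDl.
rewrite mulrAC; apply: lee_ldiv => //.
rewrite /inv_mass /far_mass -int_prod; last 4 first.
- by apply: measurable_ball_if.
- exact: measurable_far_fun.
- by move=> x; case: ifP => // _; rewrite invr_ge0 ltW.
- by move=> y; case: ifP => // _; rewrite mulr_ge0// powR_ge0.
rewrite -intZ; last 3 first.
- apply: measurable_mul_fun.
  + exact: (measurableT_comp (measurable_ball_if c r (measurable_inv_w t)) measurable_fst).
  + exact: (measurableT_comp (measurable_far_fun c r) measurable_snd).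
- exact: ltW.
- move=> z; apply: mulr_ge0; case: ifP => // _; first by rewrite invr_ge0 ltW.
  by rewrite mulr_ge0// powR_ge0.
rewrite [(C + C) * _]mulrDl [X in (_ <= X)%E]EFinD; apply: le_trans (leeD err gn).
rewrite -intD; last 4 first.
- exact: measurable_err_density.
- exact: measurable_gain_density.
- by move=> z; exact: err_density_ge0.
- by move=> z; exact: gain_density_ge0.
apply: le_int.
- apply: measurable_mul_fun => //; apply: measurable_mul_fun.
  + exact: (measurableT_comp (measurable_ball_if c r (measurable_inv_w t)) measurable_fst).
  + exact: (measurableT_comp (measurable_far_fun c r) measurable_snd).
- by apply: measurable_add_fun; [exact: measurable_err_density|exact: measurable_gain_density].
- move=> z; apply: mulr_ge0; first exact: ltW.
  apply: mulr_ge0; case: ifP => // _; first by rewrite invr_ge0 ltW.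
  by rewrite mulr_ge0// powR_ge0.
move=> [x y] /=.
have EG0 : 0 <= err_density s u c r 1 t (x, y) + gain_density s u c r 1 0 t (x, y).
  by rewrite addr_ge0// ?err_density_ge0// gain_density_ge0.
case: ifPn => xc; last by rewrite mul0r mulr0.
case: ifPn => yc; last by rewrite !mulr0.
rewrite /err_density /gain_density /= (cutoff_in r0 xc) (cutoff_out r0 yc) subrr !powRr0.
rewrite -mulrDl.
have xy : x != y.
  by apply/eqP => xy; move: xc yc; rewrite xy; move: r0; lra.
have kK : k * (r + `|y|) `^ (- a) <= K x y.
  rewrite /k -powRM ?mulr_ge0 ?(ltW sN)//; last by rewrite addr_ge0// ltW.
  rewrite -mulrA; apply: frac_kernel_ge => //.
  have h1 := ler_normB x y; have h2 := ler_normD (x - c) c; rewrite subrK in h2.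
  have h3 := normr_ge0 y; move: xc h1 h2; rewrite c4; lra.
have h : u y / (u x + t) <= 2 + gain 1 0 1 (u x + t) (u y + t).
  have uw : u y / (u x + t) <= (u y + t) / (u x + t).
    by rewrite ler_pM2r ?invr_gt0// lerDl ltW.
  apply: (le_trans uw); have [xw|wx] := leP (u x + t) (u y + t).
    rewrite gainE// !trunc_powN1// expr1n mul1r -subr_ge0.
    rewrite (_ : _ - _ = (u x + t) / (u y + t)); first by rewrite divr_ge0// ltW.
    by field; rewrite !lt0r_neq0.
  have : (u y + t) / (u x + t) <= 1 by rewrite ler_pdivrMr// mul1r ltW.
  by have := gain_ge0 0 1 (u y + t) ler01 (w0 x); lra.
have g2 : 0 <= gain 1 0 0 (u y + t) (u x + t) by exact: gain_ge0.
apply: (@le_trans _ _ ((u y / (u x + t)) * K x y)).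
  rewrite (_ : k * _ = (u y / (u x + t)) * (k * (r + `|y|) `^ (- a))); last by ring.
  by apply: ler_wpM2l kK; rewrite divr_ge0// ltW.
apply: ler_wpM2r; first exact: frac_kernel_ge0.
by move: h g2; rewrite !subr0 expr1n mul1r; lra.
Qed.

Lemma normr_powRB2_mul (v : R) : 0 <= v -> `|v| `^ (p - 2) * v = v `^ (p - 1).
Proof.
move=> v0; rewrite ger0_norm// mulrC.
have -> : p - 2 = (p - 1) - 1 by ring.
by rewrite mulr_powRB1// subr_gt0.
Qed.

Definition mass_p (b : RN -> bool) : \bar R :=
  (\int[mu]_x (if b x then u x `^ p else 0)%:E)%E.

(** Up to the shift [t], the integral of [u^(p - 2)] over a ball. *)
Definition mass_p2 c r t : \bar R :=
  (\int[mu]_x (if (`|x - c| <= r)%R then u x `^ (p - 1) * (u x + t)^-1 else 0)%:E)%E.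

Lemma measurable_mass_p2 (c : RN) (r t : R) : measurable_fun setT
  (fun x : RN => if (`|x - c| <= r)%R then u x `^ (p - 1) * (u x + t)^-1 else 0).
Proof. by apply: measurable_ball_if; apply: measurable_mul_fun => //; exact: measurable_powR_fun. Qed.

Lemma nonlin_ge (b : RN -> bool) c r t D : measurable_fun setT b ->
  0 < r -> 0 < t -> (forall x y, `|x - c| <= r -> b y -> `|x - y| <= D) ->
  (((Num.sqrt N%:R * D) `^ (alpha - N%:R))%:E * mass_p b * mass_p2 c r t <=
     nonlin alpha p u (test_fun u c r 1 0 t))%E.
Proof.
move=> mb r0 t0 bD.
have w0 x : 0 < u x + t by rewrite ltr_wpDl.
have mup : measurable_fun setT (fun y => `|u y| `^ p) by apply: measurable_powR_fun; exact: measurable_norm_fun.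
have m0 : (0 <= mass_p b)%E.
  by apply: int_ge0 => x; case: ifP => // _; exact: powR_ge0.
rewrite /mass_p2 /nonlin.
rewrite -ge0_integralZl//; last 3 first.
- by apply: measurable_EFin_fun; exact: measurable_mass_p2.
- by move=> x _; rewrite lee_fin; case: ifP => // _; rewrite mulr_ge0 ?powR_ge0// invr_ge0 ltW.
- by apply: mule_ge0 => //; rewrite lee_fin powR_ge0.
apply: ge0_le_integral => //.
- move=> x _; apply: mule_ge0; first by apply: mule_ge0 => //; rewrite lee_fin powR_ge0.
  by rewrite lee_fin; case: ifP => // _; rewrite mulr_ge0 ?powR_ge0// invr_ge0 ltW.
- by apply: emeasurable_funM => //; apply: measurable_EFin_fun; exact: measurable_mass_p2.
- apply: emeasurable_funM.
    by apply: measurable_riesz_potential => // y; exact: powR_ge0.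
  apply: measurable_EFin_fun; apply: measurable_mul_fun; last exact: measurable_test_fun.
  by apply: measurable_mul_fun => //; apply: measurable_powR_fun; exact: measurable_norm_fun.
move=> x _; rewrite normr_powRB2_mul//.
case: ifPn => xc; last first.
  rewrite mule0; apply: mule_ge0; first by apply: riesz_potential_ge0 => y; exact: powR_ge0.
  by rewrite lee_fin mulr_ge0 ?powR_ge0// test_fun_ge0.
rewrite /test_fun (cutoff_in r0 xc) expr1n mul1r trunc_powN1//.
apply: lee_wpmul2r; first by rewrite lee_fin mulr_ge0 ?powR_ge0// invr_ge0 ltW.
rewrite /mass_p (eq_integral (fun y => (if b y then `|u y| `^ p else 0)%:E)); last first.
  by move=> y _; rewrite ger0_norm.
apply: (@riesz_potential_ge R N alpha N0 alphaN _ b x D mup _ mb) => y.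
  exact: powR_ge0.
exact: bD.
Qed.
End annulus.


(** * Decay beyond the fundamental solution *)

Lemma powR_small (R : realType) (C d e : R) : 0 <= C -> 0 < d -> 0 < e ->
  exists2 r1 : R, 0 < r1 & forall r, r1 <= r -> C * r `^ (- d) < e.
Proof.
move=> C0 d0 e0.
have k0 : 0 < (C + 1) / e by rewrite divr_gt0// ltr_wpDl.
exists (((C + 1) / e) `^ d^-1); first by rewrite powR_gt0.
move=> r r1r.
apply: (@le_lt_trans _ _ (C * (((C + 1) / e) `^ d^-1) `^ (- d))).
  by rewrite ler_wpM2l//; apply: powRNle => //; [exact: ltW|rewrite powR_gt0].
rewrite -powRrM mulrN mulVf ?gt_eqF// powR_inv1 ?(ltW k0)// invf_div.
have C1 : 0 < C + 1 by rewrite ltr_wpDl.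
rewrite mulrA ltr_pdivrMr// mulrC ltr_pM2l//; lra.
Qed.

Lemma amgm_opt (R : realType) (A k i b0 : R) : 0 <= k -> 0 <= i -> 0 < b0 ->
  k * i <= b0 ^+ 2 -> (forall th, 0 < th -> A <= th * k + th^-1 * i) -> A <= 2 * b0.
Proof.
move=> k0 i0 b00 kib h; rewrite leNgt; apply/negP => Ab.
have A0 : 0 < A by apply: lt_trans Ab; rewrite mulr_gt0.
move: k0; rewrite le_eqVlt => /orP[/eqP k0|k0].
  have i1 : 0 < i + 1 by rewrite ltr_wpDl.
  have := h ((i + 1) / A); rewrite divr_gt0// => /(_ isT).
  rewrite -k0 mulr0 add0r invf_div mulrAC ler_pdivlMr// ler_pM2l//; lra.
have := h (b0 / k); rewrite divr_gt0// => /(_ isT).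
rewrite divfK ?gt_eqF// invf_div => {}h.
have : k / b0 * i <= b0 by rewrite mulrAC ler_pdivrMr// -expr2.
by move: h Ab; lra.
Qed.

(** The two ranges of exponents both leave room for a decay rate above the one
of the fundamental solution. *)
Lemma exists_rate (R : realType) (n s alpha p : R) : 0 < n -> 1 < p ->
  p < 1 + (s + alpha / 2) / n \/ 2 <= p < 1 + alpha / n ->
  exists2 g, n < g & g * (p - 1) < s + alpha / 2 \/ (2 <= p /\ g * (p - 2) < alpha - n).
Proof.
move=> n0 p1; have p10 : 0 < p - 1 by rewrite subr_gt0.
case=> [h|/andP[p2 h]].
  have e0 : 0 < s + alpha / 2 - n * (p - 1).
    by rewrite subr_gt0 mulrC -ltr_pdivlMr// ltrBlDl.
  set e := _ - _ in e0.
  exists (n + e / 2 / (p - 1)); first by rewrite ltrDl !divr_gt0.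
  by left; rewrite mulrDl divfK ?gt_eqF//; move: e0; rewrite /e; lra.
have e0 : 0 < alpha - n * (p - 1).
  by rewrite subr_gt0 mulrC -ltr_pdivlMr// ltrBlDl.
set e := _ - _ in e0.
exists (n + e / 2 / (p - 1)); first by rewrite ltrDl !divr_gt0.
right; split => //.
have -> : (n + e / 2 / (p - 1)) * (p - 2) = n * (p - 1) - n + e / 2 - e / 2 / (p - 1).
  by field; exact: lt0r_neq0.
have : 0 < e / 2 / (p - 1) by rewrite !divr_gt0.
by move: e0; rewrite /e; lra.
Qed.

Section decay.
Context (R : realType) (N : nat) (s alpha eps p : R) (V u : 'rV[R]_N -> R).
Local Notation RN := 'rV[R]_N.
Local Notation mu := (@lebesgue_rV R N).
Local Notation a := (N%:R + 2 * s).
Hypotheses (s0 : 0 < s) (s1 : s < 1) (hN : 2 * s < N%:R) (eps0 : 0 < eps).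
Hypotheses (alphaN : alpha < N%:R) (p1 : 1 < p).
Hypotheses (cV : continuous V) (V0 : forall x, 0 <= V x).
Hypotheses (cu : continuous u) (u0 : forall x, 0 <= u x).
Hypothesis hu : weak_solution s alpha eps p V u.
Hypothesis Vdecay : forall d, 0 < d -> exists2 rho, 0 < rho &
    forall x, rho <= `|x| -> V x <= d * `|x| `^ (- (2 * s)).
Variables (x0 : RN) (rho0 c0 : R).
Hypotheses (rho00 : 0 < rho0) (c00 : 0 < c0).
Hypothesis uc0 : forall y, `|y - x0| <= rho0 -> c0 <= u y.
Variable g : R.
Hypothesis hg : g * (p - 1) < s + alpha / 2 \/ (2 <= p /\ g * (p - 2) < alpha - (N%:R - 2 * s)).

Let mes_u : measurable_fun setT u. Proof. exact: continuous_measurable_rV. Qed.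
Let N0 : (0 < N)%N.
Proof. by rewrite -(ltr_nat R); apply: lt_trans hN; rewrite mulr_gt0. Qed.
Let sN : 0 < Num.sqrt N%:R :> R. Proof. by rewrite sqrtr_gt0 ltr0n. Qed.

Lemma ball_int_cst (c : RN) (r h : R) : 0 < r -> 0 <= h ->
  (\int[mu]_x (if (`|x - c| <= r)%R then h else 0)%:E = (h * (2 * r) ^+ N)%:E)%E.
Proof.
move=> r0 h0; rewrite int_if_cst//; last exact: measurable_ball_norm.
rewrite [X in (_ * X)%E](_ : _ = ((2 * r) ^+ N)%:E)//.
by apply: lebesgue_rV_ball; exact: ltW.
Qed.

Lemma mass_p_ge : ((c0 `^ p * (2 * rho0) ^+ N)%:E <=
  mass_p p u (fun y => `|y - x0| <= rho0)%R)%E.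
Proof.
rewrite -(@ball_int_cst x0 rho0 (c0 `^ p) rho00 (powR_ge0 _ _)); apply: le_int.
- by apply: measurable_if_fun => //; exact: measurable_ball_norm.
- by apply: measurable_if_fun => //; [exact: measurable_ball_norm|exact: measurable_powR_fun].
- by move=> x; case: ifP => // _; exact: powR_ge0.
move=> x; case: ifPn => // /uc0 ux.
by apply: ge0_ler_powR => //; rewrite ?nnegrE// ltW// (lt_trans _ p1).
Qed.

(** Where [u + lam / 2 >= lam] one has [u + lam / 2 <= 2 * u]; elsewhere the
first summand is at least one. *)
Lemma pointwise_case2 (l v : R) : 0 < l -> 0 <= v -> 2 <= p ->
  1 <= l * (v + l / 2)^-1 + 2 `^ (p - 1) * l `^ (2 - p) * (v `^ (p - 1) * (v + l / 2)^-1).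
Proof.
move=> l0 v0 p2; set w := v + l / 2.
have w0 : 0 < w by rewrite ltr_wpDl// divr_gt0.
have [wl|lw] := ltP w l.
  apply: ler_wpDr; last by rewrite ler_pdivlMr// mul1r ltW.
  by rewrite !mulr_ge0 ?powR_ge0// invr_ge0 ltW.
apply: ler_wpDl; first by rewrite mulr_ge0 ?invr_ge0// ltW.
have vw : w / 2 <= v by move: lw; rewrite /w; lra.
have h1 : (w / 2) `^ (p - 1) <= v `^ (p - 1).
  by apply: ge0_ler_powR; rewrite ?nnegrE ?divr_ge0 ?(ltW w0)// subr_ge0 ltW.
have h2 : l `^ (p - 2) <= w `^ (p - 2).
  by apply: ge0_ler_powR; rewrite ?nnegrE ?(ltW w0) ?(ltW l0)// subr_ge0.
apply: (@le_trans _ _ (2 `^ (p - 1) * l `^ (2 - p) * ((w / 2) `^ (p - 1) * w^-1))); last first.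
  rewrite ler_wpM2l ?mulr_ge0 ?powR_ge0//.
  by rewrite ler_wpM2r// invr_ge0 ltW.
have -> : 2 `^ (p - 1) * l `^ (2 - p) * ((w / 2) `^ (p - 1) * w^-1) =
   l `^ (2 - p) * w `^ (p - 2).
  have -> : (w / 2) `^ (p - 1) = w * w `^ (p - 2) * 2^-1 `^ (p - 1).
    rewrite powRM ?(ltW w0)//; congr (_ * _).
    rewrite -(@mulr_powRB1 R w (p - 1)) ?(ltW w0) ?subr_gt0//.
    by have -> : p - 2 = p - 1 - 1 by ring.
  have e : 2 `^ (p - 1) * 2^-1 `^ (p - 1) = 1 :> R.
    by rewrite -powRM ?invr_ge0// divff// powR1.
  rewrite (_ : _ * _ = (2 `^ (p - 1) * 2^-1 `^ (p - 1)) * (l `^ (2 - p) * w `^ (p - 2)) * (w / w)).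
    by rewrite e divff ?gt_eqF// mul1r mulr1.
  by ring.
apply: le_trans (ler_wpM2l (powR_ge0 _ _) h2).
rewrite -powRD ?(gt_eqF l0) ?implybT//.
have -> : 2 - p + (p - 2) = 0 by ring.
by rewrite powRr0.
Qed.

Lemma pointwise_case1 (l v th : R) : 0 < l -> 0 <= v -> 0 < th ->
  1 <= l * (v + l / 2)^-1 + 2 `^ (p - 1) * l `^ (1 - p) *
     (th * v `^ p + th^-1 * (v `^ (p - 1) * (v + l / 2)^-1)).
Proof.
move=> l0 v0 th0; set w := v + l / 2.
have w0 : 0 < w by rewrite ltr_wpDl// divr_gt0.
have [wl|lw] := ltP w l.
  apply: ler_wpDr; last by rewrite ler_pdivlMr// mul1r ltW.
  rewrite !mulr_ge0 ?powR_ge0// addr_ge0//; rewrite !mulr_ge0 ?invr_ge0 ?powR_ge0// ltW//.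
apply: ler_wpDl; first by rewrite mulr_ge0 ?invr_ge0// ltW.
have lv : l / 2 <= v by move: lw; rewrite /w; lra.
have v00 : 0 < v by apply: lt_le_trans lv; rewrite divr_gt0.
have wv : w <= 2 * v by rewrite /w; lra.
have h1 : (l / 2) `^ (p - 1) <= v `^ (p - 1).
  by apply: ge0_ler_powR; rewrite ?nnegrE ?divr_ge0 ?(ltW l0)// subr_ge0 ltW.
have h2 : 1 <= th * v + th^-1 * w^-1.
  apply: (@le_trans _ _ (th * v + th^-1 * (2 * v)^-1)).
    have z0 : 0 < th * v by rewrite mulr_gt0.
    rewrite -invfM (_ : th * (2 * v) = 2 * (th * v)); last by ring.
    set z := th * v in z0 *; rewrite -subr_ge0.
    rewrite (_ : _ - 1 = ((2 * z - 1) ^+ 2 + 1) / (4 * z)).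
      by rewrite divr_ge0 ?addr_ge0 ?sqr_ge0 ?mulr_ge0// ltW.
    by field; exact: lt0r_neq0.
  rewrite lerD2l ler_wpM2l ?invr_ge0 ?(ltW th0)// lef_pV2 ?posrE// mulr_gt0//.
have -> : th * v `^ p + th^-1 * (v `^ (p - 1) * w^-1) =
    v `^ (p - 1) * (th * v + th^-1 * w^-1).
  by rewrite -(mulr_powRB1 v0 (lt_trans ltr01 p1)); ring.
have e : 2 `^ (p - 1) * l `^ (1 - p) * (l / 2) `^ (p - 1) = 1.
  rewrite powRM ?(ltW l0)// [l `^ (p - 1) * _]mulrC mulrACA.
  rewrite -powRM ?invr_ge0// divff// powR1 mul1r.
  rewrite -powRD ?(gt_eqF l0) ?implybT//.
  have -> : 1 - p + (p - 1) = 0 by ring.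
  by rewrite powRr0.
rewrite -[leLHS]e; apply: ler_wpM2l; first by rewrite mulr_ge0 ?powR_ge0.
apply: (le_trans h1); rewrite -[leLHS]mulr1.
by apply: ler_wpM2l => //; exact: powR_ge0.
Qed.

(** The first summand accounts for at most half of the volume of the ball, so
that [G] must account for the other half. *)
Lemma ball_mass_ge (c : RN) (r l : R) (G : RN -> R) : 0 < r -> 0 < l ->
  measurable_fun setT G -> (forall x, 0 <= G x) ->
  (forall x, 1 <= l * (u x + l / 2)^-1 + G x) ->
  (l%:E * inv_mass u c r (l / 2) <= (r ^+ N)%:E)%E ->
  ((r ^+ N)%:E <= \int[mu]_x (if (`|x - c| <= r)%R then G x else 0)%:E)%E.
Proof.
move=> r0 l0 mG G0 hG hl.
have w0 x : 0 < u x + l / 2 by rewrite ltr_wpDl// divr_gt0.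
have mb := @measurable_ball_norm R N c r.
have m1 : measurable_fun setT (fun x : RN => if `|x - c| <= r then (u x + l / 2)^-1 else 0).
  by apply: measurable_if_fun => //; apply: measurable_inv_fun; apply: measurable_add_fun.
have m2 : measurable_fun setT (fun x : RN => if `|x - c| <= r then G x else 0).
  exact: measurable_if_fun.
have h : (((2 * r) ^+ N)%:E <= l%:E * inv_mass u c r (l / 2) +
    \int[mu]_x (if (`|x - c| <= r)%R then G x else 0)%:E)%E.
  rewrite -[X in X%:E]mul1r -(@ball_int_cst c r 1)// /inv_mass.
  rewrite -intZ//; last 2 first.
  - exact: ltW.
  - by move=> x; case: ifP => // _; rewrite invr_ge0 ltW.
  rewrite -intD//; last 3 first.
  - exact: measurable_mul_fun.
  - by move=> x; rewrite mulr_ge0 ?(ltW l0)//; case: ifP => // _; rewrite invr_ge0 ltW.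
  - by move=> x; case: ifP.
  apply: le_int.
  - exact: measurable_if_fun.
  - by apply: measurable_add_fun => //; exact: measurable_mul_fun.
  - by move=> x; case: ifP.
  - by move=> x; case: ifP => // _; rewrite mulr0 add0r.
rewrite -(@leeD2lE _ (r ^+ N)%:E)//.
apply: (@le_trans _ _ ((2 * r) ^+ N)%:E).
  rewrite -EFinD lee_fin exprMn.
  have N2 : 2 <= 2 ^+ N :> R.
    by rewrite -[X in X <= _]expr1; apply: ler_weXn2l; rewrite ?ler1n.
  have : 0 <= (2 ^+ N - 2) * r ^+ N.
    by rewrite mulr_ge0 ?subr_ge0// exprn_ge0// ltW.
  by rewrite mulrBl; lra.
by apply: (le_trans h); rewrite leeD2r.
Qed.

Lemma ball_int_fin (c : RN) (r : R) (f : RN -> R) (h : R) : 0 < r ->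
  measurable_fun setT f -> (forall x, 0 <= f x) -> (forall x, `|x - c| <= r -> f x <= h) ->
  (\int[mu]_x (if (`|x - c| <= r)%R then f x else 0)%:E)%E \is a fin_num.
Proof.
move=> r0 mf f0 fh; rewrite ge0_fin_numE; last by apply: int_ge0 => x; case: ifP.
have h0 : 0 <= h by apply: le_trans (f0 c) (fh c _); rewrite subrr normr0 ltW.
apply: (@le_lt_trans _ _ (h * (2 * r) ^+ N)%:E); last by rewrite ltry.
rewrite -(@ball_int_cst c)//; apply: le_int.
- by apply: measurable_if_fun => //; exact: measurable_ball_norm.
- by apply: measurable_if_fun => //; exact: measurable_ball_norm.
- by move=> x; case: ifP.
- by move=> x; case: ifPn => // /fh.
Qed.

(** If [u] had more mass than claimed, [cross_estimate] would make [u + t] at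
least of order [r^(-g)] on most of the ball, and the Riesz potential term would
exceed the bound of [annulus_test]. The Riesz potential is estimated from below
by the mass of [u^p] on the same ball in the first case of [hg], and by that on
a fixed ball in the second one. *)
Lemma far_mass_decay : exists2 r1 : R, 0 < r1 & forall c r, r1 <= r -> `|c| = 4 * r ->
  (far_mass s u c r <= (r `^ (- (2 * s) - g))%:E)%E.
Proof.
have [C1 [r1 [C10 r10 test]]] :=
  annulus_test s0 s1 hN eps0 cV V0 cu u0 hu Vdecay.
have [C2 [r2 [C20 r20 cross]]] :=
  cross_estimate s0 s1 hN eps0 cV V0 cu u0 hu Vdecay.
pose kap := C2^-1; have kap0 : 0 < kap by rewrite invr_gt0.
have inv_bound r c t : r1 <= r -> r2 <= r -> `|c| = 4 * r -> 0 < t ->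
    ((r `^ (- (2 * s) - g))%:E < far_mass s u c r)%E ->
    ((kap * r `^ (- g))%:E * inv_mass u c r t <= (r ^+ N)%:E)%E.
  move=> r1r r2r c4 t0 far.
  have r0 : 0 < r by apply: lt_le_trans r1r.
  have i0 : (0 <= inv_mass u c r t)%E.
    by apply: int_ge0 => x; case: ifP => // _; rewrite invr_ge0 addr_ge0// ltW.
  have h := cross c r t r2r c4 t0.
  have h' : ((r `^ (- (2 * s) - g))%:E * inv_mass u c r t <= (C2 * r `^ (N%:R - 2 * s))%:E)%E.
    by apply: le_trans h; rewrite muleC; apply: lee_wpmul2l => //; exact: ltW.
  have -> : kap * r `^ (- g) = (kap * r `^ (2 * s)) * r `^ (- (2 * s) - g).
    rewrite -mulrA -powRD ?(gt_eqF r0) ?implybT//; congr (_ * _ `^ _); ring.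
  rewrite EFinM -muleA.
  apply: (@le_trans _ _ ((kap * r `^ (2 * s))%:E * (C2 * r `^ (N%:R - 2 * s))%:E)%E).
    by apply: lee_wpmul2l => //; rewrite lee_fin mulr_ge0 ?powR_ge0// ltW.
  rewrite -EFinM lee_fin mulrACA /kap mulVf ?gt_eqF// mul1r.
  rewrite -powRD ?(gt_eqF r0) ?implybT// -(powR_mulrn _ (ltW r0)).
  by apply: ler_of_eq; congr (_ `^ _); ring.
pose q := (Num.sqrt N%:R * 6) `^ (alpha - N%:R).
have sN6 : 0 < Num.sqrt N%:R * 6 :> R by rewrite mulr_gt0.
have q0 : 0 < q by rewrite powR_gt0.
have qE r : 0 < r -> (Num.sqrt N%:R * (6 * r)) `^ (alpha - N%:R) = q * r `^ (alpha - N%:R).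
  by move=> r0; rewrite mulrA powRM ?(ltW r0) ?(ltW sN6).
have mi (l : R) : measurable_fun setT (fun x : RN => (u x + l / 2)^-1).
  by apply: measurable_inv_fun; apply: measurable_add_fun.
have powgN r e : 0 < r -> (kap * r `^ (- g)) `^ e = kap `^ e * r `^ (- g * e).
  by move=> r0; rewrite powRM ?(ltW kap0) ?powR_ge0// -powRrM.
case: hg => [hg1|[p2 hg2]].
- (* [annulus_test] bounds the product of the integrals of [u^p] and of
     [u^(p - 1) / (u + l / 2)]; optimizing in [th] bounds the volume of the ball
     by the square root of this product. *)
  pose C5 := Num.sqrt (C1 / q); have C50 : 0 < C5 by rewrite sqrtr_gt0 divr_gt0.
  pose C6 := 2 `^ (p - 1) * kap `^ (1 - p) * (2 * C5).
  have C60 : 0 < C6 by rewrite !mulr_gt0 ?powR_gt0.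
  have [|r3 r30 small] := @powR_small R C6 (s + alpha / 2 - g * (p - 1)) 1 (ltW C60) _ ltr01.
    by rewrite subr_gt0.
  exists (r1 + r2 + r3); first by rewrite !addr_gt0.
  move=> c r rr c4; rewrite leNgt; apply/negP => far.
  have r1r : r1 <= r by move: rr r20 r30; lra.
  have r2r : r2 <= r by move: rr r10 r30; lra.
  have r3r : r3 <= r by move: rr r10 r20; lra.
  have r0 : 0 < r by apply: lt_le_trans r1r.
  pose l := kap * r `^ (- g); have l0 : 0 < l by rewrite mulr_gt0// powR_gt0.
  have l20 : 0 < l / 2 by rewrite divr_gt0.
  have w0 x : 0 < u x + l / 2 by rewrite ltr_wpDl.
  have hinv := inv_bound r c (l / 2) r1r r2r c4 l20 far.
  have [um [um0 umP]] := continuous_bounded_rV (5 * r) cu.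
  have uum x : `|x - c| <= r -> u x <= um.
    move=> xc; apply: (le_trans (ler_norm _)); apply: umP.
    have := ler_normD (x - c) c; rewrite subrK c4; move: xc; lra.
  pose b := (fun y : RN => `|y - c| <= r)%R.
  have mb : measurable_fun setT b by exact: measurable_ball_norm.
  have Kfin : mass_p p u b \is a fin_num.
    apply: (@ball_int_fin c r _ (um `^ p)) => //.
    - exact: measurable_powR_fun.
    - by move=> x; exact: powR_ge0.
    move=> x /uum uxm; apply: ge0_ler_powR => //; rewrite ?nnegrE ?(ltW um0)//.
    exact: ltW (lt_trans ltr01 p1).
  have Ifin : mass_p2 p u c r (l / 2) \is a fin_num.
    apply: (@ball_int_fin c r _ (um `^ (p - 1) * (l / 2)^-1)) => //.
    - by apply: measurable_mul_fun => //; exact: measurable_powR_fun.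
    - by move=> x; rewrite mulr_ge0 ?powR_ge0// invr_ge0 ltW.
    - move=> x /uum uxm; apply: ler_pM; rewrite ?powR_ge0 ?invr_ge0 ?(ltW (w0 x))//.
        apply: ge0_ler_powR => //; rewrite ?nnegrE ?(ltW um0)//.
        by rewrite subr_ge0 ltW.
      by rewrite lef_pV2 ?posrE// lerDr.
  have K0 : (0 <= mass_p p u b)%E.
    by apply: int_ge0 => x; case: ifP => // _; exact: powR_ge0.
  have I0 : (0 <= mass_p2 p u c r (l / 2))%E.
    apply: int_ge0 => x; case: ifP => // _.
    by rewrite mulr_ge0 ?powR_ge0// invr_ge0 ltW.
  have [T1 _ _] := test c r (l / 2) r1r c4 l20.
  have low := @nonlin_ge R N s alpha p u s0 hN alphaN p1 cu u0 b c r (l / 2) (6 * r) mb r0 l20.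
  have {}low := le_trans (low _) T1.
  have {}low : ((q * r `^ (alpha - N%:R))%:E * mass_p p u b * mass_p2 p u c r (l / 2)
      <= (C1 * r `^ (N%:R - 2 * s))%:E)%E.
    rewrite -qE//; apply: low => x y xc yc.
    have := ler_distD c x y; rewrite [`|c - y|]distrC; move: xc yc; rewrite /b; lra.
  rewrite -(fineK Kfin) -(fineK Ifin) -!EFinM lee_fin in low.
  set k := fine _ in low; set i := fine (mass_p2 _ _ _ _ _) in low.
  have k0 : 0 <= k by exact: fine_ge0.
  have i0 : 0 <= i by exact: fine_ge0.
  pose b0 := C5 * r `^ (N%:R - s - alpha / 2).
  have b00 : 0 < b0 by rewrite mulr_gt0// powR_gt0.
  have kib : k * i <= b0 ^+ 2.
    have qr0 : 0 < q * r `^ (alpha - N%:R) by rewrite mulr_gt0// powR_gt0.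
    rewrite -(ler_pM2l qr0) mulrA (le_trans low)//.
    rewrite /b0 exprMn sqr_sqrtr ?divr_ge0 ?(ltW C10) ?(ltW q0)//.
    rewrite -powR_mulrn ?powR_ge0// -powRrM.
    have -> : r `^ ((N%:R - s - alpha / 2) * 2) = r `^ (N%:R - 2 * s) * r `^ (N%:R - alpha).
      by rewrite -powRD ?(gt_eqF r0) ?implybT//; congr (_ `^ _); field.
    have -> : r `^ (alpha - N%:R) = (r `^ (N%:R - alpha))^-1.
      by rewrite -powRN opprB.
    by apply: ler_of_eq; field; rewrite !gt_eqF ?powR_gt0.
  have A : r ^+ N / (2 `^ (p - 1) * l `^ (1 - p)) <= 2 * b0.
    apply: (amgm_opt k0 i0 b00 kib) => th th0.
    have := @ball_mass_ge c r l (fun x => 2 `^ (p - 1) * l `^ (1 - p) *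
      (th * u x `^ p + th^-1 * (u x `^ (p - 1) * (u x + l / 2)^-1))) r0 l0.
    have G0 x : 0 <= th * u x `^ p + th^-1 * (u x `^ (p - 1) * (u x + l / 2)^-1).
      by rewrite addr_ge0// mulr_ge0 ?invr_ge0 ?(ltW th0) ?powR_ge0// mulr_ge0 ?powR_ge0// invr_ge0 ltW.
    have mup : measurable_fun setT (fun x : RN => u x `^ p) by exact: measurable_powR_fun.
    have mup2 : measurable_fun setT (fun x : RN => u x `^ (p - 1) * (u x + l / 2)^-1).
      by apply: measurable_mul_fun => //; exact: measurable_powR_fun.
    have mG : measurable_fun setT (fun x : RN => 2 `^ (p - 1) * l `^ (1 - p) *
      (th * u x `^ p + th^-1 * (u x `^ (p - 1) * (u x + l / 2)^-1))).
      by apply: measurable_mul_fun => //; apply: measurable_add_fun; apply: measurable_mul_fun.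
    move=> /(_ mG (fun x => mulr_ge0 (mulr_ge0 (powR_ge0 _ _) (powR_ge0 _ _)) (G0 x))).
    move=> /(_ (fun x => pointwise_case1 l0 (u0 x) th0) hinv).
    have pl0 : 0 < 2 `^ (p - 1) * l `^ (1 - p) by rewrite mulr_gt0// powR_gt0.
    rewrite (_ : \int[mu]_x _ = (2 `^ (p - 1) * l `^ (1 - p) * (th * k + th^-1 * i))%:E)%E.
      by rewrite lee_fin ler_pdivrMr// mulrC.
    pose f1 x := if b x then u x `^ p else 0.
    pose f2 x := if `|x - c| <= r then u x `^ (p - 1) * (u x + l / 2)^-1 else 0.
    have mf1 : measurable_fun setT f1 by exact: measurable_if_fun.
    have mf2 : measurable_fun setT f2 by apply: measurable_if_fun => //; exact: measurable_ball_norm.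
    have f10 x : 0 <= f1 x by rewrite /f1; case: ifP => // _; exact: powR_ge0.
    have f20 x : 0 <= f2 x.
      by rewrite /f2; case: ifP => // _; rewrite mulr_ge0 ?powR_ge0// invr_ge0 ltW.
    have th'0 : 0 <= th^-1 by rewrite invr_ge0 ltW.
    rewrite (eq_integral (fun x => (2 `^ (p - 1) * l `^ (1 - p) *
        (th * f1 x + th^-1 * f2 x))%:E)); last first.
      by move=> x _; rewrite /f1 /f2 /b; case: ifP => // _; rewrite !mulr0 addr0 mulr0.
    rewrite intZ; last 3 first.
    - by apply: measurable_add_fun; apply: measurable_mul_fun.
    - exact: ltW.
    - by move=> x; rewrite addr_ge0// mulr_ge0// ltW.
    rewrite intD; last 4 first.
    - exact: measurable_mul_fun.
    - exact: measurable_mul_fun.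
    - by move=> x; rewrite mulr_ge0// ltW.
    - by move=> x; rewrite mulr_ge0.
    rewrite !intZ ?(ltW th0)// [RHS]EFinM; congr (_ * _)%E.
    by rewrite EFinD !EFinM /k /i !fineK.
  move: A; rewrite leNgt => /negP; apply.
  rewrite ltr_pdivlMr ?mulr_gt0 ?powR_gt0// /l powgN//.
  rewrite (_ : 2 * b0 * _ = r ^+ N * (C6 * r `^ (- (s + alpha / 2 - g * (p - 1))))).
    by rewrite gtr_pMr ?exprn_gt0// small.
  rewrite /b0 /C6 -(powR_mulrn _ (ltW r0)).
  have -> : r `^ (N%:R - s - alpha / 2) = r `^ N%:R * r `^ (- (s + alpha / 2)).
    by rewrite -powRD ?(gt_eqF r0) ?implybT//; congr (_ `^ _); ring.
  have -> : r `^ (- (s + alpha / 2 - g * (p - 1))) = r `^ (- (s + alpha / 2)) * r `^ (- g * (1 - p)).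
    by rewrite -powRD ?(gt_eqF r0) ?implybT//; congr (_ `^ _); ring.
  by ring.
- (* The mass of [u^p] near [x0] keeps the Riesz potential at least of order
     [r^(alpha - N)] on the ball. *)
  have m00 : 0 < c0 `^ p * (2 * rho0) ^+ N.
    by rewrite mulr_gt0 ?powR_gt0// exprn_gt0// mulr_gt0.
  set m0 := _ * _ in m00.
  pose C6 := 2 `^ (p - 1) * kap `^ (2 - p) * (C1 / (q * m0)).
  have C60 : 0 < C6 by rewrite !mulr_gt0 ?powR_gt0// invr_gt0 mulr_gt0.
  have [|r3 r30 small] := @powR_small R C6 (alpha - (N%:R - 2 * s) - g * (p - 2)) 1 (ltW C60) _ ltr01.
    by rewrite subr_gt0.
  exists (r1 + r2 + r3 + `|x0| + rho0); first by rewrite ltr_pwDr// ler_wpDr// !addr_ge0// ltW.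
  move=> c r rr c4; rewrite leNgt; apply/negP => far.
  have x00 := normr_ge0 x0.
  have r1r : r1 <= r by move: rr r20 r30 rho00 x00; lra.
  have r2r : r2 <= r by move: rr r10 r30 rho00 x00; lra.
  have r3r : r3 <= r by move: rr r10 r20 rho00 x00; lra.
  have rx : `|x0| + rho0 <= r by move: rr r10 r20 r30; lra.
  have r0 : 0 < r by apply: lt_le_trans r1r.
  pose l := kap * r `^ (- g); have l0 : 0 < l by rewrite mulr_gt0// powR_gt0.
  have l20 : 0 < l / 2 by rewrite divr_gt0.
  have w0 x : 0 < u x + l / 2 by rewrite ltr_wpDl.
  have hinv := inv_bound r c (l / 2) r1r r2r c4 l20 far.
  have I0 : (0 <= mass_p2 p u c r (l / 2))%E.
    apply: int_ge0 => x; case: ifP => // _.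
    by rewrite mulr_ge0 ?powR_ge0// invr_ge0 ltW.
  have [T1 _ _] := test c r (l / 2) r1r c4 l20.
  have mb := @measurable_ball_norm R N x0 rho0.
  have low := @nonlin_ge R N s alpha p u s0 hN alphaN p1 cu u0 _ c r (l / 2) (6 * r) mb r0 l20.
  have {}low := le_trans (low _) T1.
  have {}low : ((q * r `^ (alpha - N%:R))%:E * mass_p p u (fun y => `|y - x0| <= rho0)%R * mass_p2 p u c r (l / 2)
      <= (C1 * r `^ (N%:R - 2 * s))%:E)%E.
    rewrite -qE//; apply: low => x y xc yc.
    have h1 := ler_normB x y; have h2 := ler_normD (x - c) c.
    have h3 := ler_normD (y - x0) x0; rewrite !subrK in h2 h3.
    by move: xc yc rx h1 h2 h3; rewrite c4; lra.
  have qr0 : 0 < q * r `^ (alpha - N%:R) by rewrite mulr_gt0// powR_gt0.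
  have Ibound : (mass_p2 p u c r (l / 2) <=
      (C1 * r `^ (N%:R - 2 * s) / (q * r `^ (alpha - N%:R) * m0))%:E)%E.
    apply: lee_ldiv; first by rewrite mulr_gt0.
    apply: le_trans low; apply: lee_wpmul2r => //.
    by rewrite EFinM; apply: lee_wpmul2l; [rewrite lee_fin ltW|exact: mass_p_ge].
  have mup2 : measurable_fun setT (fun x : RN => u x `^ (p - 1) * (u x + l / 2)^-1).
    by apply: measurable_mul_fun => //; exact: measurable_powR_fun.
  have pl0 : 0 < 2 `^ (p - 1) * l `^ (2 - p) by rewrite mulr_gt0// powR_gt0.
  have g20 x : 0 <= u x `^ (p - 1) * (u x + l / 2)^-1.
    by rewrite mulr_ge0 ?powR_ge0// invr_ge0 ltW.
  have := @ball_mass_ge c r l (fun x => 2 `^ (p - 1) * l `^ (2 - p) *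
      (u x `^ (p - 1) * (u x + l / 2)^-1)) r0 l0.
  have mG : measurable_fun setT (fun x : RN => 2 `^ (p - 1) * l `^ (2 - p) *
      (u x `^ (p - 1) * (u x + l / 2)^-1)) by exact: measurable_mul_fun.
  move=> /(_ mG (fun x => mulr_ge0 (ltW pl0) (g20 x))).
  move=> /(_ (fun x => pointwise_case2 l0 (u0 x) p2) hinv).
  pose f2 x := if `|x - c| <= r then u x `^ (p - 1) * (u x + l / 2)^-1 else 0.
  have mf2 : measurable_fun setT f2 by apply: measurable_if_fun => //; exact: measurable_ball_norm.
  have f20 x : 0 <= f2 x by rewrite /f2; case: ifP.
  rewrite (eq_integral (fun x => (2 `^ (p - 1) * l `^ (2 - p) * f2 x)%:E)); last first.
    by move=> x _; rewrite /f2; case: ifP => // _; rewrite mulr0.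
  rewrite intZ ?(ltW pl0)// => h.
  have {h} : ((r ^+ N)%:E <= (2 `^ (p - 1) * l `^ (2 - p) *
      (C1 * r `^ (N%:R - 2 * s) / (q * r `^ (alpha - N%:R) * m0)))%:E)%E.
    by apply: (le_trans h); rewrite [X in (_ <= X)%E]EFinM; apply: lee_wpmul2l => //; rewrite lee_fin ltW.
  rewrite lee_fin leNgt => /negP; apply.
  rewrite /l powgN//.
  rewrite (_ : _ * (C1 * _ / _) = r ^+ N * (C6 * r `^ (- (alpha - (N%:R - 2 * s) - g * (p - 2))))).
    by rewrite gtr_pMr ?exprn_gt0// small.
  rewrite /C6 -(powR_mulrn _ (ltW r0)).
  have -> : r `^ (- (alpha - (N%:R - 2 * s) - g * (p - 2))) =
      r `^ (N%:R - 2 * s) * r `^ (- g * (2 - p)) * r `^ (- alpha).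
    by rewrite -!powRD ?(gt_eqF r0) ?implybT//; congr (_ `^ _); ring.
  have -> : r `^ (alpha - N%:R) = (r `^ N%:R * r `^ (- alpha))^-1.
    by rewrite -powRD ?(gt_eqF r0) ?implybT// -powRN; congr (_ `^ _); ring.
  field; rewrite !gt_eqF ?powR_gt0//.
Qed.

(** Two antipodal balls suffice to see all the mass, because no point is close
to both of them. *)
Lemma mass_decay : exists2 r1 : R, 0 < r1 & forall r, r1 <= r ->
  (\int[mu]_y (u y * (r + `|y|) `^ (- a))%:E <= (2 * r `^ (- (2 * s) - g))%:E)%E.
Proof.
have [r1 r10 far] := far_mass_decay; exists r1 => // r r1r.
have r0 : 0 < r by apply: lt_le_trans r1r.
pose c : RN := const_mx (4 * r).
have c4 : `|c| = 4 * r.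
  have r4 : 0 <= 4 * r by rewrite mulr_ge0// ltW.
  apply: le_anti; apply/andP; split.
    by apply/rV_norm_le => // i; rewrite mxE ger0_norm.
  by have := rV_coord_le c (Ordinal N0); rewrite mxE ger0_norm.
have mf (c' : RN) : measurable_fun setT (fun y : RN =>
    if 2 * r <= `|y - c'| then u y * (r + `|y|) `^ (- a) else 0).
  have mn : measurable_fun setT (fun y : RN => `|y|) by apply: measurable_norm_rV.
  have mnc : measurable_fun setT (fun y : RN => `|y - c'|).
    by apply: measurable_norm_rV; apply: measurable_subr_rV.
  by repeat (exact: mn || exact: mnc || exact: mes_u || exact: measurable_cst || measurable_step).
have f0 (c' y : RN) : 0 <= if 2 * r <= `|y - c'| then u y * (r + `|y|) `^ (- a) else 0.
  by case: ifP => // _; rewrite mulr_ge0// powR_ge0.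
have -> : 2 * r `^ (- (2 * s) - g) = r `^ (- (2 * s) - g) + r `^ (- (2 * s) - g) by ring.
rewrite EFinD.
apply: le_trans (leeD (far c r r1r c4) (far (- c) r r1r _)); last by rewrite normrN.
rewrite /far_mass -intD//; apply: le_int.
- apply: measurable_mul_fun => //; apply: measurable_powR_fun; apply: measurable_add_fun => //; exact: measurable_norm_rV.
- by apply: measurable_add_fun; exact: mf.
- by move=> y; rewrite mulr_ge0// powR_ge0.
move=> y.
(* The centers [c] and [- c] are at distance [8 r]. *)
have [yc|yc] := leP (2 * r) `|y - c|; first by rewrite lerDl f0.
rewrite add0r opprK ifT//.
have := ler_normB (y + c) (y - c).
have -> : y + c - (y - c) = c *+ 2.
  by rewrite opprB [y + c]addrC -addrA [y + _]addrC subrK mulr2n.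
rewrite normrMn c4 -mulr_natl; move: yc; lra.
Qed.
End decay.


(** * A fractional Hardy inequality *)

Section hardy.
Context (R : realType) (N : nat) (s : R) (u : 'rV[R]_N -> R).
Local Notation RN := 'rV[R]_N.
Local Notation mu := (@lebesgue_rV R N).
Local Notation a := (N%:R + 2 * s).
Hypotheses (s0 : 0 < s) (hN : 2 * s < N%:R).
Hypotheses (cu : continuous u) (u0 : forall x, 0 <= u x).

Let mes_u : measurable_fun setT u. Proof. exact: continuous_measurable_rV. Qed.

Let N0 : (0 < N)%N.
Proof. by rewrite -(ltr_nat R); apply: lt_trans hN; rewrite mulr_gt0. Qed.

Definition cube (l : R) (x y : RN) : bool :=
  [forall i, (l * `|x| <= y 0 i) && (y 0 i <= 2 * l * `|x|)].

(** The pairs [(x, y)] compared in Hardy's inequality: [y] ranges over a cube of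
side [l |x|] at distance [l |x|] from the origin. *)
Definition cube_weight (l rho : R) (x y : RN) : R :=
  if (rho <= `|x|) && cube l x y then `|x| `^ (- a) else 0.

Lemma cube_weight_ge0 l rho x y : 0 <= cube_weight l rho x y.
Proof. by rewrite /cube_weight; case: ifP => // _; exact: powR_ge0. Qed.

Lemma measurable_cube_weight l rho d (T : measurableType d) (f g : T -> RN) :
  measurable_fun setT f -> measurable_fun setT g ->
  measurable_fun setT (fun t => cube_weight l rho (f t) (g t)).
Proof.
move=> mf mg.
have mn : measurable_fun setT (fun t => `|f t|) by exact: measurable_norm_rV.
apply: measurable_if_fun => //; last exact: measurable_powR_fun.
apply: measurable_and; first exact: measurable_le_fun.
apply: measurable_forall_fun => i.
have mgi : measurable_fun setT (fun t => g t 0 i).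
  exact: (measurableT_comp (measurable_coord_rV i) mg).
by apply: measurable_and; apply: measurable_le_fun => //; exact: measurable_mul_fun.
Qed.

Lemma cube_norm l x y : 0 < l -> cube l x y -> l * `|x| <= `|y| <= 2 * l * `|x|.
Proof.
move=> l0 /forallP h; apply/andP; split.
  have /andP[h1 _] := h (Ordinal N0); apply: (le_trans h1).
  by apply: le_trans (rV_coord_le y (Ordinal N0)); exact: ler_norm.
apply/rV_norm_le; first by rewrite !mulr_ge0// ltW.
move=> i; have /andP[h1 h2] := h i; rewrite ger0_norm//.
by apply: le_trans h1; rewrite mulr_ge0// ltW.
Qed.

Lemma int_cube_weight_right l rho x : 0 < l -> 0 < rho ->
  (\int[mu]_y (cube_weight l rho x y)%:E =
    (l ^+ N * (if rho <= `|x| then `|x| `^ (- (2 * s)) else 0))%:E)%E.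
Proof.
move=> l0 rho0; rewrite /cube_weight; case: ifPn => /= xr; last first.
  by rewrite mulr0 integral0_eq.
have x0 : 0 < `|x| by apply: lt_le_trans xr.
rewrite int_if_cst ?powR_ge0//; last first.
  apply: measurable_forall_fun => i; apply: measurable_and; apply: measurable_le_fun => //.
    exact: measurable_coord_rV.
  exact: measurable_coord_rV.
rewrite [X in (_ * X)%E](_ : _ = ((l * `|x|) ^+ N)%:E); last first.
  rewrite -(@lebesgue_rV_cube R N (fun=> l * `|x|)); last by rewrite mulr_ge0// ltW.
  congr (_ _); apply/seteqP; split => y /=.
    move=> /forallP h i; have := h i; rewrite in_itv/= => /andP[-> h2] /=.
    by apply: (le_trans h2); apply: ler_of_eq; ring.
  move=> h; apply/forallP => i; have := h i; rewrite in_itv/= => /andP[-> h2] /=.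
  by apply: (le_trans h2); apply: ler_of_eq; ring.
rewrite -EFinM exprMn mulrCA; congr (_ * _)%:E.
rewrite -(powR_mulrn _ (ltW x0)) -powRD ?(gt_eqF x0) ?implybT//.
by congr (_ `^ _); ring.
Qed.

Lemma int_cube_weight_left l rho y : 1 < l -> 0 < rho ->
  (\int[mu]_x (cube_weight l rho x y)%:E <=
    (2 `^ (2 * N%:R + 2 * s) * l `^ (2 * s) *
      (if rho <= `|y| then `|y| `^ (- (2 * s)) else 0))%:E)%E.
Proof.
move=> l1 rho0; have l0 : 0 < l by apply: lt_trans l1.
have [yr|yr] := leP rho `|y|; last first.
  rewrite mulr0 integral0_eq// => x _; rewrite /cube_weight; case: ifPn => // /andP[rx xy].
  have /andP[h1 _] := cube_norm l0 xy.
  have : `|x| <= l * `|x| by rewrite ler_peMl// ltW.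
  by move=> h2; exfalso; move: h1 h2 rx yr; lra.
have y0 : 0 < `|y| by apply: lt_le_trans yr.
have y2l : 0 < `|y| / (2 * l) by rewrite divr_gt0// mulr_gt0.
have yl0 : 0 < `|y| / l by rewrite divr_gt0.
apply: (@le_trans _ _ (\int[mu]_x (if (`|x - 0| <= `|y| / l)%R
   then (`|y| / (2 * l)) `^ (- a) else 0)%:E)%E).
  apply: le_int.
  - exact: measurable_cube_weight.
  - by apply: measurable_if_fun => //; exact: measurable_ball_norm.
  - by move=> x; exact: cube_weight_ge0.
  move=> x; rewrite subr0 /cube_weight; case: ifPn => [/andP[rx xy]|_]; last first.
    by case: ifP => // _; exact: powR_ge0.
  have /andP[h1 h2] := cube_norm l0 xy.
  rewrite ifT; last by rewrite ler_pdivlMr// mulrC.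
  apply: powRNle => //; first by apply/ltW/exponent_gt0.
  by rewrite ler_pdivrMr ?mulr_gt0// mulrC.
rewrite int_if_cst ?powR_ge0//; last exact: measurable_ball_norm.
rewrite [X in (_ * X <= _)%E](_ : _ = ((2 * (`|y| / l)) ^+ N)%:E); last first.
  by apply: lebesgue_rV_ball; exact: ltW.
rewrite -EFinM lee_fin -powR_mulrn ?mulr_ge0 ?invr_ge0 ?(ltW l0)//.
have l20 : 0 < 2 * l by rewrite mulr_gt0.
rewrite !powRM ?mulr_ge0 ?invr_ge0 ?(ltW l0) ?(ltW l20)//.
have powV (z e : R) : 0 < z -> z^-1 `^ e = z `^ (- e).
  by move=> z0; rewrite -[z^-1]powR_inv1 ?(ltW z0)// -powRrM mulN1r.
rewrite !powV// opprK powRM ?(ltW l0)//.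
have -> : `|y| `^ (- (2 * s)) = `|y| `^ (- a) * `|y| `^ N%:R.
  by rewrite -powRD ?(gt_eqF y0) ?implybT//; congr (_ `^ _); ring.
have -> : l `^ (2 * s) = l `^ a * l `^ (- N%:R).
  by rewrite -powRD ?(gt_eqF l0) ?implybT//; congr (_ `^ _); ring.
have -> : 2 `^ (2 * N%:R + 2 * s) = 2 `^ a * 2 `^ N%:R :> R.
  by rewrite -powRD ?pnatr_eq0 ?implybT//; congr (_ `^ _); ring.
by apply: ler_of_eq; ring.
Qed.

Variable b : R.
Hypotheses (b0 : 0 < b) (b1 : b < 1).

Definition trunc_power (c : RN) (r t m : R) (x : RN) : R :=
  cutoff c r x ^+ 2 * Num.min (u x + t) m `^ (1 - b).

Lemma trunc_power_ge0 c r t m x : 0 <= trunc_power c r t m x.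
Proof. by rewrite mulr_ge0 ?sqr_ge0 ?powR_ge0. Qed.

Definition hardy_int rho c r t m : \bar R :=
  (\int[mu]_x ((if rho <= `|x| then `|x| `^ (- (2 * s)) else 0) *
     trunc_power c r t m x)%:E)%E.

Lemma measurable_trunc_power c r t m d (T : measurableType d) (f : T -> RN) :
  measurable_fun setT f -> measurable_fun setT (fun x => trunc_power c r t m (f x)).
Proof.
move=> mf; apply: measurable_mul_fun; first by apply: measurable_exprn_fun; exact: measurable_cutoff.
apply: measurable_powR_fun; apply: measurable_min_fun => //; apply: measurable_add_fun => //.
exact: (measurableT_comp mes_u mf).
Qed.

Lemma measurable_radial rho d (T : measurableType d) (f : T -> RN) :
  measurable_fun setT f -> measurable_fun setT
    (fun x => if rho <= `|f x| then `|f x| `^ (- (2 * s)) else 0).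
Proof.
move=> mf; have mn : measurable_fun setT (fun t => `|f t|) by exact: measurable_norm_rV.
by apply: measurable_if_fun => //; [exact: measurable_le_fun|exact: measurable_powR_fun].
Qed.

Lemma radial_ge0 rho (x : RN) : 0 <= if rho <= `|x| then `|x| `^ (- (2 * s)) else 0.
Proof. by case: ifP => // _; exact: powR_ge0. Qed.

Lemma hardy_int_fin rho c r t m : 0 < rho -> 0 < r -> 0 < t -> 0 < m ->
  hardy_int rho c r t m \is a fin_num.
Proof.
move=> rho0 r0 t0 m0; rewrite ge0_fin_numE; last first.
  by apply: int_ge0 => x; rewrite mulr_ge0 ?radial_ge0 ?trunc_power_ge0.
apply: (@le_lt_trans _ _ ((rho `^ (- (2 * s)) * m `^ (1 - b)) * (2 * (2 * r)) ^+ N)%:E);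
  last by rewrite ltry.
rewrite -(@ball_int_cst R N c (2 * r) (rho `^ (- (2 * s)) * m `^ (1 - b))); last 2 first.
- by rewrite mulr_gt0.
- by rewrite mulr_ge0 ?powR_ge0.
apply: le_int.
- by apply: measurable_mul_fun; [exact: measurable_radial|exact: measurable_trunc_power].
- by apply: measurable_if_fun => //; exact: measurable_ball_norm.
- by move=> x; rewrite mulr_ge0 ?radial_ge0 ?trunc_power_ge0.
move=> x; rewrite /trunc_power; case: (leP `|x - c|) => xc; last first.
  by rewrite (cutoff_out r0 (ltW xc)) expr0n mul0r mulr0.
apply: ler_pM; rewrite ?radial_ge0 ?trunc_power_ge0//.
  case: ifPn => rx; last exact: powR_ge0.
  by apply: powRNle => //; rewrite mulr_ge0// ltW.
rewrite -[leRHS]mul1r; apply: ler_pM; rewrite ?sqr_ge0 ?powR_ge0//.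
  by apply: exprn_ile1; [exact: cutoff_ge0|exact: cutoff_le1].
apply: ge0_ler_powR; rewrite ?nnegrE ?(ltW m0) ?subr_ge0 ?(ltW b1)//.
  by rewrite le_min (ltW m0) andbT addr_ge0// ltW.
by rewrite ge_min lexx orbT.
Qed.

(** Each [x] is compared, by [hardy_pointwise], with the points of a cube dilated
by the factor [l]. Averaging over it multiplies the integral by a constant times
[l^(2s - N)], so that it can be absorbed for [l] large, as [2s < N]. *)
Lemma hardy : exists2 C, 0 < C & forall rho m c r t,
  0 < rho -> 0 < m -> 0 < r -> 0 < t ->
  (hardy_int rho c r t m <= C%:E * \int[(mu \x mu)%E]_z
    (gain_density s u c r b (m `^ (- b)) t z + err_density s u c r b t z)%:E)%E.
Proof.
pose kap : R := 4 * 2 `^ (2 * N%:R + 2 * s).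
have kap0 : 0 < kap by rewrite mulr_gt0// powR_gt0.
have n0 : 0 < N%:R - 2 * s by rewrite subr_gt0.
(* [kap] collects the factor 4 of [hardy_pointwise] and the constant of
[int_cube_weight_left]; then [l^N = l^(2s) (kap + 1)]. *)
pose l := (kap + 1) `^ (N%:R - 2 * s)^-1.
have k1 : 1 < kap + 1 by rewrite ltrDr.
have l1 : 1 < l.
  have : 1 `^ (N%:R - 2 * s)^-1 < l.
    by apply: gt0_ltr_powR; rewrite ?nnegrE ?invr_gt0 ?ler01 ?(ltW (lt_trans ltr01 k1)).
  by rewrite powR1.
have l0 : 0 < l by apply: lt_trans l1.
have lN : l ^+ N = l `^ (2 * s) * (kap + 1).
  have -> : kap + 1 = l `^ (N%:R - 2 * s).
    by rewrite /l -powRrM mulVf ?gt_eqF// powRr1// ltW// (lt_trans ltr01).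
  rewrite -powRD ?(gt_eqF l0) ?implybT// -powR_mulrn ?(ltW l0)//.
  by congr (_ `^ _); ring.
pose C1 := 2 + 4 / (2 `^ b - 1).
have C10 : 0 < C1.
  rewrite /C1 ltr_pwDl// divr_ge0// subr_ge0 -[leLHS](powRr0 2).
  by apply: ler_powR; [rewrite ler1n|exact: ltW].
have sN : 0 < Num.sqrt N%:R :> R by rewrite sqrtr_gt0 ltr0n.
have sl0 : 0 < Num.sqrt N%:R * (1 + 2 * l) by rewrite mulr_gt0// addr_gt0// mulr_gt0.
pose C2 := (Num.sqrt N%:R * (1 + 2 * l)) `^ a; have C20 : 0 < C2 by exact: powR_gt0.
exists (C1 * C2 / l `^ (2 * s)).
  by apply: divr_gt0; [exact: mulr_gt0|exact: powR_gt0].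
move=> rho m c r t rho0 m0 r0 t0; set Z := (\int[_]_z _)%E.
pose S := trunc_power c r t m.
have S0 x : 0 <= S x by exact: trunc_power_ge0.
have w0 x : 0 < u x + t by rewrite ltr_wpDl.
pose GE z := gain_density s u c r b (m `^ (- b)) t z + err_density s u c r b t z.
have GE0 z : 0 <= GE z by rewrite addr_ge0 ?err_density_ge0 ?gain_density_ge0.
have mGE : measurable_fun setT GE.
  by apply: measurable_add_fun; [exact: measurable_gain_density|exact: measurable_err_density].
have mA : measurable_fun setT (fun z : RN * RN => cube_weight l rho z.1 z.2).
  exact: measurable_cube_weight.
have mS1 : measurable_fun setT (fun z : RN * RN => S z.1) by exact: measurable_trunc_power.
have mS2 : measurable_fun setT (fun z : RN * RN => S z.2) by exact: measurable_trunc_power.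
have mS : measurable_fun setT S by exact: measurable_trunc_power.
have pw z : cube_weight l rho z.1 z.2 * S z.1 <=
    4 * (cube_weight l rho z.1 z.2 * S z.2) + C1 * C2 * GE z.
  case: z => x y /=; have [->|] := eqVneq (cube_weight l rho x y) 0.
    by rewrite !mul0r mulr0 add0r mulr_ge0// mulr_ge0// ltW.
  rewrite /cube_weight; case: ifPn => [|_]; last by rewrite eqxx.
  move=> /andP[rx xy _]; have x0 : 0 < `|x| by apply: lt_le_trans rx.
  have /andP[h1 h2] := cube_norm l0 xy.
  have xney : x != y.
    apply/eqP => e; move: h1; rewrite -e leNgt => /negP; apply.
    by rewrite ltr_pMl.
  have Kx : `|x| `^ (- a) <= C2 * frac_kernel s x y.
    have : (Num.sqrt N%:R * ((1 + 2 * l) * `|x|)) `^ (- a) <= frac_kernel s x y.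
      apply: frac_kernel_ge => //; apply: (le_trans (ler_normB _ _)).
      by rewrite [leRHS]mulrDl mul1r lerD2l.
    rewrite mulrA powRM ?(ltW sl0)// => h.
    rewrite -[leLHS]mul1r -[X in X * _](@mulfV _ C2) ?gt_eqF// -mulrA ler_pM2l//.
    by rewrite -powRN.
  have hp : S x <= 4 * S y + C1 * (gain b (m `^ (- b)) (cutoff c r x) (u x + t) (u y + t)
     + gain b (m `^ (- b)) (cutoff c r y) (u y + t) (u x + t)
     + (cutoff c r x - cutoff c r y) ^+ 2 * ((u x + t) `^ (1 - b) + (u y + t) `^ (1 - b))).
    by apply: hardy_pointwise => //; rewrite ?b0 ?cutoff_ge0.
  set Q := _ + _ + _ in hp.
  have Q0 : 0 <= Q.
    by rewrite /Q !addr_ge0 ?gain_ge0 ?(ltW b0)// mulr_ge0 ?sqr_ge0// addr_ge0// powR_ge0.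
  have -> : GE (x, y) = Q * frac_kernel s x y by rewrite /GE /gain_density /err_density /Q /=; ring.
  apply: (@le_trans _ _ (`|x| `^ (- a) * (4 * S y + C1 * Q))).
    by rewrite ler_wpM2l ?powR_ge0.
  rewrite mulrDr mulrCA lerD2l.
  rewrite (_ : C1 * C2 * _ = C2 * frac_kernel s x y * (C1 * Q)); last by ring.
  by rewrite ler_wpM2r// mulr_ge0// ltW.
have int1 : (\int[(mu \x mu)%E]_z (cube_weight l rho z.1 z.2 * S z.1)%:E =
    (l ^+ N)%:E * hardy_int rho c r t m)%E.
  rewrite fubini_tonelli1; last 2 first.
  - by apply: measurable_EFin_fun; exact: measurable_mul_fun.
  - by move=> z; rewrite lee_fin mulr_ge0 ?cube_weight_ge0.
  rewrite /hardy_int -intZ; last 3 first.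
  - by apply: measurable_mul_fun => //; exact: measurable_radial.
  - by rewrite exprn_ge0// ltW.
  - by move=> x; rewrite mulr_ge0 ?radial_ge0.
  apply: eq_integral => x _; rewrite /fubini_F /=.
  under eq_integral do rewrite mulrC.
  rewrite intZ ?S0//; last 2 first.
  - exact: measurable_cube_weight.
  - by move=> y; exact: cube_weight_ge0.
  by rewrite int_cube_weight_right// -EFinM mulrCA [S x * _]mulrC.
have int2 : (\int[(mu \x mu)%E]_z (cube_weight l rho z.1 z.2 * S z.2)%:E <=
    (2 `^ (2 * N%:R + 2 * s) * l `^ (2 * s))%:E * hardy_int rho c r t m)%E.
  rewrite fubini_tonelli2; last 2 first.
  - by apply: measurable_EFin_fun; exact: measurable_mul_fun.
  - by move=> z; rewrite lee_fin mulr_ge0 ?cube_weight_ge0.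
  rewrite /hardy_int -intZ; last 3 first.
  - by apply: measurable_mul_fun => //; exact: measurable_radial.
  - by rewrite mulr_ge0 ?powR_ge0.
  - by move=> x; rewrite mulr_ge0 ?radial_ge0.
  have E y : (fubini_G mu (fun z : RN * RN => (cube_weight l rho z.1 z.2 * S z.2)%:E) y =
      (S y)%:E * \int[mu]_x (cube_weight l rho x y)%:E)%E.
    rewrite /fubini_G /=; under eq_integral do rewrite mulrC.
    by rewrite intZ ?S0//; [exact: measurable_cube_weight|move=> x; exact: cube_weight_ge0].
  apply: ge0_le_integral => //.
  - by move=> y _; apply: int_ge0 => x; rewrite mulr_ge0 ?cube_weight_ge0.
  - apply: measurable_fun_fubini_tonelli_G => //; first by apply: measurable_EFin_fun; exact: measurable_mul_fun.
    by move=> z; rewrite lee_fin mulr_ge0 ?cube_weight_ge0.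
  - by apply: measurable_EFin_fun; apply: measurable_mul_fun => //; apply: measurable_mul_fun => //; exact: measurable_radial.
  move=> y _; rewrite E.
  apply: le_trans (lee_wpmul2l _ (int_cube_weight_left y l1 rho0)) _.
    by rewrite lee_fin.
  by rewrite -EFinM lee_fin mulrCA [S y * _]mulrC.
have tot : ((l ^+ N)%:E * hardy_int rho c r t m <=
    (kap * l `^ (2 * s))%:E * hardy_int rho c r t m + (C1 * C2)%:E * Z)%E.
  rewrite -int1; apply: (@le_trans _ _ (\int[(mu \x mu)%E]_z
      (4 * (cube_weight l rho z.1 z.2 * S z.2) + C1 * C2 * GE z)%:E)%E).
    apply: le_int.
    - exact: measurable_mul_fun.
    - by apply: measurable_add_fun; apply: measurable_mul_fun => //; exact: measurable_mul_fun.
    - by move=> z; rewrite mulr_ge0 ?cube_weight_ge0.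
    - exact: pw.
  have CC0 : 0 <= C1 * C2 by rewrite mulr_ge0// ltW.
  rewrite intD; last 4 first.
  - by apply: measurable_mul_fun => //; exact: measurable_mul_fun.
  - exact: measurable_mul_fun.
  - by move=> z; apply: mulr_ge0 => //; apply: mulr_ge0; [exact: cube_weight_ge0|exact: S0].
  - by move=> z; rewrite mulr_ge0.
  rewrite intZ//; last 2 first.
  - exact: measurable_mul_fun.
  - by move=> z; rewrite mulr_ge0 ?cube_weight_ge0.
  rewrite intZ//; apply: leeD => //.
  rewrite /kap -mulrA EFinM -muleA; apply: lee_wpmul2l => //.
have hf := hardy_int_fin c rho0 r0 t0 m0.
rewrite -(fineK hf) in tot *; set h := fine _ in tot *.
have Zge : (0 <= Z)%E by exact: int_ge0.
case: Z Zge tot => [z z0|_ _|//]; last first.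
  rewrite gt0_muley ?leey// lte_fin.
  by apply: divr_gt0; [exact: mulr_gt0|exact: powR_gt0].
rewrite -!EFinM -EFinD !lee_fin lN => tot.
rewrite mulrAC ler_pdivlMr ?(powR_gt0 _ l0)//; move: tot.
by rewrite mulrDr mulr1; move: (l `^ _) => L; rewrite !mulrDl; lra.
Qed.
End hardy.


(** * Absorption of the potential *)

Section absorption.
Context (R : realType) (N : nat) (s alpha eps p : R) (V u : 'rV[R]_N -> R).
Local Notation RN := 'rV[R]_N.
Local Notation mu := (@lebesgue_rV R N).
Local Notation a := (N%:R + 2 * s).
Hypotheses (s0 : 0 < s) (s1 : s < 1) (hN : 2 * s < N%:R) (eps0 : 0 < eps).
Hypotheses (cV : continuous V) (V0 : forall x, 0 <= V x).
Hypotheses (cu : continuous u) (u0 : forall x, 0 <= u x).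
Hypothesis hu : weak_solution s alpha eps p V u.
Hypothesis Vdecay : forall d, 0 < d -> exists2 rho, 0 < rho &
    forall x, rho <= `|x| -> V x <= d * `|x| `^ (- (2 * s)).
Variables (x0 : RN) (rho0 c0 : R).
Hypotheses (rho00 : 0 < rho0) (c00 : 0 < c0).
Hypothesis uc0 : forall y, `|y - x0| <= rho0 -> c0 <= u y.
Variable b : R.
Hypotheses (b0 : 0 < b) (b1 : b < 1).

Let mes_u : measurable_fun setT u. Proof. exact: continuous_measurable_rV. Qed.
Let mV : measurable_fun setT V. Proof. exact: continuous_measurable_rV. Qed.
Let N0 : (0 < N)%N.
Proof. by rewrite -(ltr_nat R); apply: lt_trans hN; rewrite mulr_gt0. Qed.
Let sN : 0 < Num.sqrt N%:R :> R. Proof. by rewrite sqrtr_gt0 ltr0n. Qed.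

Lemma trunc_powN_eq0 (m v : R) : 0 < m -> m <= v -> trunc_powN b (m `^ (- b)) v = 0.
Proof.
move=> m0 mv; apply: max_l; rewrite subr_le0.
by apply: powRNle => //; exact: ltW.
Qed.

(** Jumps from the region where [u] is small to the fixed ball where it is at
least [c0] dominate the mass of the test function. *)
Lemma gain_ge_mass (c : RN) (rho D r t m : R) : 0 < r -> 0 < t -> 0 < m -> m <= c0 / 2 ->
  (forall x, `|x - c| <= rho -> `|x| <= r) ->
  (forall x y, `|x - c| <= rho -> `|y - x0| <= rho0 -> `|x - y| <= D) ->
  (((Num.sqrt N%:R * D) `^ (- a) * (c0 / 2) * (2 * rho0) ^+ N)%:E *
     \int[mu]_x (if (`|x - c| <= rho)%R then trunc_powN b (m `^ (- b)) (u x + t) else 0)%:E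
   <= \int[(mu \x mu)%E]_z (gain_density s u 0 r b (m `^ (- b)) t z)%:E)%E.
Proof.
move=> r0 t0 m0 mc0 cr xyD.
have w0 x : 0 < u x + t by rewrite ltr_wpDl.
set M := m `^ (- b); set k := (Num.sqrt N%:R * D) `^ (- a).
have k0 : 0 <= k by exact: powR_ge0.
have kc0 : 0 <= k * (c0 / 2) by rewrite mulr_ge0// divr_ge0// ltW.
have mtp : measurable_fun setT (fun x : RN => trunc_powN b M (u x + t)).
  by apply: measurable_trunc_powN; apply: measurable_add_fun.
have mf : measurable_fun setT (fun x : RN => if `|x - c| <= rho then trunc_powN b M (u x + t) else 0).
  by apply: measurable_if_fun => //; exact: measurable_ball_norm.
have mg : measurable_fun setT (fun y : RN => if `|y - x0| <= rho0 then k * (c0 / 2) else 0).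
  by apply: measurable_if_fun => //; exact: measurable_ball_norm.
have f0 x : 0 <= if `|x - c| <= rho then trunc_powN b M (u x + t) else 0.
  by case: ifP => // _; exact: trunc_powN_ge0.
have gg0 (y : RN) : 0 <= if `|y - x0| <= rho0 then k * (c0 / 2) else 0 by case: ifP.
rewrite -(@ball_int_cst R N x0)// muleC -int_prod//.
apply: le_int.
- apply: measurable_mul_fun; first exact: (measurableT_comp mf measurable_fst).
  exact: (measurableT_comp mg measurable_snd).
- exact: measurable_gain_density.
- by move=> z; rewrite mulr_ge0.
move=> [x y] /=.
have G0 := gain_density_ge0 s u0 0 r M b0 t0 (x, y).
case: ifPn => xc; last by rewrite mul0r.
case: ifPn => yx0; last by rewrite mulr0.
have [mw|wm] := leP m (u x + t); first by rewrite trunc_powN_eq0// mul0r.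
have uy := uc0 yx0.
have xy : x != y by apply/eqP => e; move: wm uy; rewrite e; lra.
have kK : k <= frac_kernel s x y by apply: frac_kernel_ge => //; exact: xyD.
have c1 : cutoff 0 r x = 1 by apply: cutoff_in => //; rewrite subr0; exact: (cr _ xc).
have wxy : u x + t <= u y + t by move: wm uy; lra.
have g2 : gain b M (cutoff 0 r y) (u y + t) (u x + t) = 0 by exact: gain_le0.
rewrite /gain_density /= g2 addr0 gainE// c1 expr1n mul1r (trunc_powN_eq0 (v := u y + t))//; last first.
  by move: uy mc0; lra.
rewrite subr0 (_ : _ * (k * _) = c0 / 2 * trunc_powN b M (u x + t) * k); last by ring.
have c20 : 0 <= c0 / 2 by rewrite divr_ge0// ltW.
apply: ler_pM => //; first exact: mulr_ge0 c20 (trunc_powN_ge0 _ _ _).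
apply: ler_wpM2r; first exact: trunc_powN_ge0.
by move: wm uy; lra.
Qed.

(** Both parts of the potential term are absorbed by the gain: the exterior
part through Hardy's inequality and the smallness of [|x|^(2s) V], the interior
part by choosing the truncation level [m] small. *)
Lemma gain_le_err : exists m C r1, [/\ 0 < m, m <= c0 / 2, 0 < C &
  forall r t, 0 < r -> r1 <= r -> 0 < t ->
  (\int[(mu \x mu)%E]_z (gain_density s u 0%R r b (m `^ (- b)) t z)%:E <=
    C%:E * \int[(mu \x mu)%E]_z (err_density s u 0%R r b t z)%:E)%E].
Proof.
have [CH CH0 hardyP] := hardy s0 hN cu u0 b0 b1.
pose e2 := eps `^ (2 * s); have e20 : 0 < e2 by exact: powR_gt0.
pose sg := e2 / 8 / CH; have sg0 : 0 < sg by rewrite !divr_gt0.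
have [rho rhop Vrho] := Vdecay sg0.
have [Vm [Vm0 VmP]] := continuous_bounded_rV rho cV.
pose D := rho + `|x0| + rho0.
have D0 : 0 < D by rewrite ltr_wpDl// addr_ge0// ltW.
pose k := (Num.sqrt N%:R * D) `^ (- a) * (c0 / 2) * (2 * rho0) ^+ N.
have k0 : 0 < k.
  apply: mulr_gt0; last by rewrite exprn_gt0// mulr_gt0.
  by apply: mulr_gt0; [apply: powR_gt0; exact: mulr_gt0|exact: divr_gt0].
pose m := Num.min (c0 / 2) (e2 / 8 * k / Vm).
have m0 : 0 < m by rewrite lt_min !divr_gt0// mulr_gt0// divr_gt0.
have mc0 : m <= c0 / 2 by rewrite ge_min lexx.
have mk : Vm * m <= e2 / 8 * k.
  by rewrite mulrC -ler_pdivlMr// ge_min lexx orbT.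
pose M := m `^ (- b); have M0 : 0 <= M by exact: powR_ge0.
have cb0 : 0 < 1 + 2 / b by rewrite addr_gt0// divr_gt0.
exists m, (4 * (1 + 2 / b + 8^-1)), rho; split => //.
  by rewrite mulr_gt0// addr_gt0.
move=> r t r0 rr t0.
have c4 : `|0 : RN| <= 4 * r by rewrite normr0 mulr_ge0// ltW.
have w0 x : 0 < u x + t by rewrite ltr_wpDl.
have := test_inequality s0 s1 hN eps0 cV V0 cu u0 hu r0 c4 b0 M0 t0.
rewrite -/e2; set T := nonlin _ _ _ _.
set G := (\int[_]_z (gain_density _ _ _ _ _ _ _ z)%:E)%E.
set E := (\int[_]_z (err_density _ _ _ _ _ _ z)%:E)%E; set W := (\int[_]_x _)%E.
move=> test.
have T0 : (0 <= T)%E.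
  apply: integral_ge0 => x _; apply: mule_ge0.
    by apply: riesz_potential_ge0 => y; exact: powR_ge0.
  by rewrite lee_fin mulr_ge0 ?test_fun_ge0// mulr_ge0// powR_ge0.
have {}test : ((e2 / 2)%:E * G <= (e2 * (1 + 2 / b))%:E * E + W)%E.
  apply: le_trans test; apply: leeDr; apply: mule_ge0 => //.
  by rewrite lee_fin powR_ge0.
have G0 : (0 <= G)%E by apply: int_ge0 => z; exact: gain_density_ge0.
have E0 : (0 <= E)%E by apply: int_ge0 => z; exact: err_density_ge0.
have mtp : measurable_fun setT (fun x : RN => trunc_powN b M (u x + t)).
  by apply: measurable_trunc_powN; apply: measurable_add_fun.
pose I := (\int[mu]_x (if (`|x - 0| <= rho)%R then trunc_powN b M (u x + t) else 0)%:E)%E.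
have mI : measurable_fun setT (fun x : RN => if `|x - 0| <= rho then trunc_powN b M (u x + t) else 0).
  by apply: measurable_if_fun => //; exact: measurable_ball_norm.
have I0 x : 0 <= if `|x - 0| <= rho then trunc_powN b M (u x + t) else 0.
  by case: ifP => // _; exact: trunc_powN_ge0.
have GI : (k%:E * I <= G)%E.
  apply: gain_ge_mass => //.
  - by move=> x; rewrite subr0 => h; exact: le_trans rr.
  - move=> x y; rewrite subr0 => xr yr; rewrite /D.
    have h1 := ler_normB x y; have h2 := ler_normD (y - x0) x0; rewrite subrK in h2.
    by move: xr yr h1 h2; lra.
have HG : (hardy_int s u b rho 0 r t m <= CH%:E * (G + E))%E.
  have := hardyP rho m 0 r t rhop m0 r0 t0; rewrite intD//.
  - exact: measurable_gain_density.
  - exact: measurable_err_density.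
  - by move=> z; exact: gain_density_ge0.
  - by move=> z; exact: err_density_ge0.
have WW : (W <= (Vm * m)%:E * I + sg%:E * hardy_int s u b rho 0 r t m)%E.
  rewrite /I -intZ//; last by rewrite mulr_ge0// ltW.
  have mH : measurable_fun setT (fun x : RN =>
     (if rho <= `|x| then `|x| `^ (- (2 * s)) else 0) * trunc_power u b 0 r t m x).
    by apply: measurable_mul_fun; [exact: measurable_radial|exact: measurable_trunc_power].
  have H0 x : 0 <= (if rho <= `|x| then `|x| `^ (- (2 * s)) else 0) * trunc_power u b 0 r t m x.
    by apply: mulr_ge0; [exact: radial_ge0|exact: trunc_power_ge0].
  rewrite /hardy_int -intZ//; last exact: ltW.
  rewrite -intD//; last 4 first.
  - exact: measurable_mul_fun.
  - exact: measurable_mul_fun.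
  - by move=> x; rewrite mulr_ge0// mulr_ge0// ltW.
  - by move=> x; rewrite mulr_ge0// ltW.
  apply: le_int.
  - apply: measurable_mul_fun; first exact: measurable_mul_fun.
    exact: measurable_test_fun.
  - by apply: measurable_add_fun; exact: measurable_mul_fun.
  - by move=> x; rewrite mulr_ge0 ?test_fun_ge0// mulr_ge0.
  move=> x; rewrite /test_fun.
  set e := cutoff 0 r x; have e1 : e ^+ 2 <= 1.
    by apply: exprn_ile1; [exact: cutoff_ge0|exact: cutoff_le1].
  have e0 : 0 <= e ^+ 2 by exact: sqr_ge0.
  have tp0 : 0 <= trunc_powN b M (u x + t) by exact: trunc_powN_ge0.
  have ut : u x <= u x + t by rewrite lerDl ltW.
  case: (leP `|x - 0| rho) => xr.
    rewrite -[leLHS]addr0; apply: lerD; last by rewrite mulr_ge0// ltW.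
    have [mw|wm] := leP m (u x + t); first by rewrite trunc_powN_eq0// !mulr0.
    rewrite subr0 in xr; have Vx := le_trans (ler_norm _) (VmP _ xr).
    apply: ler_pM (mulr_ge0 (V0 x) (u0 x)) (mulr_ge0 e0 tp0) _ _.
      by apply: ler_pM => //; apply: (le_trans ut); exact: ltW.
    by rewrite -[leRHS]mul1r; apply: ler_wpM2r.
  rewrite mulr0 add0r; rewrite subr0 in xr; rewrite (ltW xr).
  have Vx := Vrho _ (ltW xr).
  have tpw : u x * trunc_powN b M (u x + t) <= Num.min (u x + t) m `^ (1 - b).
    have [mw|wm] := leP m (u x + t); first by rewrite trunc_powN_eq0// mulr0 powR_ge0.
    rewrite powR1B//; apply: ler_pM => //; exact: trunc_powN_le.
  rewrite /trunc_power -/e.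
  have -> : V x * u x * (e ^+ 2 * trunc_powN b M (u x + t)) =
    V x * (e ^+ 2 * (u x * trunc_powN b M (u x + t))) by ring.
  rewrite [leRHS]mulrA; apply: ler_pM => //; first by rewrite mulr_ge0// mulr_ge0.
  by apply: ler_wpM2l.
have Wfin : (W < +oo)%E by exact: (int_V_test_fun_lty cV V0 cu u0 r0 c4 b0 M0 t0).
have C0 : 0 < 4 * (1 + 2 / b + 8^-1) by rewrite mulr_gt0// addr_gt0.
case: E E0 test HG => [E' E'0|_ _ _|//]; last first.
  by rewrite gt0_muley ?leey// lte_fin.
move=> test HG.
have Gfin : G \is a fin_num.
  rewrite ge0_fin_numE//.
  have : ((e2 / 2)%:E * G < +oo)%E.
    by apply: le_lt_trans test _; apply: lte_add_pinfty => //; rewrite -EFinM ltry.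
  apply: contraTT; rewrite -!leNgt !leye_eq => /eqP ->.
  by rewrite gt0_muley// lte_fin divr_gt0.
have kI : (I <= (fine G / k)%:E)%E by apply: lee_ldiv => //; rewrite fineK.
rewrite -(fineK Gfin) in test HG *; set G' := fine G in test HG kI *.
have WB : (W <= ((e2 / 8) * G' + (e2 / 8) * (G' + E'))%:E)%E.
  apply: (le_trans WW); rewrite EFinD; apply: leeD.
    apply: (@le_trans _ _ ((Vm * m)%:E * (G' / k)%:E)%E).
      by apply: lee_wpmul2l => //; rewrite lee_fin mulr_ge0// ltW.
    rewrite -EFinM lee_fin mulrA ler_pdivrMr//.
    rewrite [leRHS]mulrAC; apply: ler_wpM2r => //.
    by rewrite fine_ge0.
  apply: (@le_trans _ _ (sg%:E * (CH%:E * (G'%:E + E'%:E)))%E).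
    by apply: lee_wpmul2l => //; rewrite lee_fin ltW.
  rewrite -EFinD -!EFinM lee_fin /sg mulrA divfK ?gt_eqF//.
have : ((e2 / 2 * G')%:E <= (e2 * (1 + 2 / b) * E' + ((e2 / 8) * G' + (e2 / 8) * (G' + E')))%:E)%E.
  rewrite !EFinM; apply: (le_trans test); rewrite [leRHS]EFinD EFinM.
  exact: leeD2l.
rewrite -EFinM !lee_fin => h.
rewrite -(ler_pM2l e20); move: h; set c := 1 + 2 / b.
have -> : e2 * (4 * (c + 8^-1) * E') = 4 * (c * (e2 * E')) + 2^-1 * (e2 * E').
  by field.
have -> : e2 / 2 * G' = 2^-1 * (e2 * G') by ring.
have -> : e2 * c * E' + (e2 / 8 * G' + e2 / 8 * (G' + E')) =
  c * (e2 * E') + 4^-1 * (e2 * G') + 8^-1 * (e2 * E') by field.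
by move: (e2 * G') (e2 * E') (c * _) => x y z; lra.
Qed.
End absorption.


(** * Conclusion *)

Section cutoff_error_decay.
Context (R : realType) (N : nat) (s : R) (u : 'rV[R]_N -> R).
Local Notation RN := 'rV[R]_N.
Local Notation mu := (@lebesgue_rV R N).
Local Notation a := (N%:R + 2 * s).
Hypotheses (s0 : 0 < s) (s1 : s < 1).
Hypotheses (cu : continuous u) (u0 : forall x, 0 <= u x).
Variables (b g : R).
Hypotheses (b0 : 0 < b) (b1 : b < 1).
Hypothesis decay : exists2 r1 : R, 0 < r1 & forall r, r1 <= r ->
  (\int[mu]_y (u y * (r + `|y|) `^ (- a))%:E <= (2 * r `^ (- (2 * s) - g))%:E)%E.

Let mes_u : measurable_fun setT u. Proof. exact: continuous_measurable_rV. Qed.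

Lemma powR_le1D (z : R) : 0 <= z -> z `^ (1 - b) <= 1 + z.
Proof.
move=> z0; have [z1|/ltW z1] := leP 1 z.
  apply: le_trans (ler1_powR z1 _) _; first by rewrite gerBl ltW.
  by rewrite lerDr.
apply: (@le_trans _ _ (1 `^ (1 - b))); last by rewrite powR1 lerDl.
by apply: ge0_ler_powR; rewrite ?nnegrE ?subr_ge0 ?(ltW b1).
Qed.

(** For [t = r^(-g)], the bound [z^(1 - b) <= 1 + z] with [z = (u + t) / t] makes
the error linear in [u], and [decay] applies. *)
Lemma err_decay : exists2 C, 0 < C & exists2 r1 : R, 0 < r1 & forall r, r1 <= r ->
  (\int[(mu \x mu)%E]_z (err_density s u 0%R r b (r `^ (- g)) z)%:E <=
    (C * r `^ (N%:R - 2 * s - g * (1 - b)))%:E)%E.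
Proof.
have [Ce [Ce0 CeP]] := @cutoff_error R N s s0 s1.
have [Cw [Cw0 CwP]] := @int_weight R N s s0.
have [r1 r10 dec] := decay.
exists (Ce * (2 * Cw + 2)); first by rewrite mulr_gt0// addr_gt0// mulr_gt0.
exists r1 => // r r1r.
have r0 : 0 < r by apply: lt_le_trans r1r.
pose t := r `^ (- g); have t0 : 0 < t by exact: powR_gt0.
have w0 x : 0 < u x + t by rewrite ltr_wpDl.
have c4 : `|0 : RN| <= 4 * r by rewrite normr0 mulr_ge0// ltW.
have mw : measurable_fun setT (fun x : RN => (u x + t) `^ (1 - b)).
  by apply: measurable_powR_fun; apply: measurable_add_fun.
have mn : measurable_fun setT (fun y : RN => `|y|) by apply: measurable_norm_rV.
have mW : measurable_fun setT (fun x : RN => (r + `|x|) `^ (- a)).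
  by apply: measurable_powR_fun; apply: measurable_add_fun.
apply: le_trans (CeP 0 r _ r0 c4 mw (fun x => powR_ge0 _ _)) _.
have rg (e : R) : r `^ (- g * e) = t `^ e by rewrite /t -powRrM.
have h : (\int[mu]_x ((u x + t) `^ (1 - b) * (r + `|x|) `^ (- a))%:E <=
    (t `^ (1 - b) * ((2 * Cw + 2) * r `^ (- (2 * s))))%:E)%E.
  apply: (@le_trans _ _ (\int[mu]_x (t `^ (1 - b) * (2 * (r + `|x|) `^ (- a) +
      t^-1 * (u x * (r + `|x|) `^ (- a))))%:E)%E).
    apply: le_int.
    - exact: measurable_mul_fun.
    - by apply: measurable_mul_fun => //; apply: measurable_add_fun; apply: measurable_mul_fun => //; exact: measurable_mul_fun.
    - by move=> x; rewrite mulr_ge0 ?powR_ge0.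
    move=> x; set Wx := (r + `|x|) `^ (- a); have W0 : 0 <= Wx by exact: powR_ge0.
    have -> : u x + t = t * ((u x + t) / t) by rewrite mulrCA divff ?mulr1// gt_eqF.
    have wt0 : 0 <= (u x + t) / t by rewrite divr_ge0// ltW.
    rewrite powRM ?(ltW t0)// -mulrA; apply: ler_wpM2l; first exact: powR_ge0.
    apply: (le_trans (ler_wpM2r W0 (powR_le1D wt0))).
    by apply: ler_of_eq; field; exact: lt0r_neq0.
  rewrite intZ ?powR_ge0//; last 2 first.
  - by apply: measurable_add_fun; apply: measurable_mul_fun => //; exact: measurable_mul_fun.
  - move=> x; apply: addr_ge0; first by rewrite mulr_ge0 ?powR_ge0.
    by apply: mulr_ge0; rewrite ?invr_ge0 ?(ltW t0)// mulr_ge0 ?powR_ge0.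
  rewrite EFinM; apply: lee_wpmul2l; first by rewrite lee_fin powR_ge0.
  rewrite intD; last 4 first.
  - exact: measurable_mul_fun.
  - by apply: measurable_mul_fun => //; exact: measurable_mul_fun.
  - by move=> x; rewrite mulr_ge0 ?powR_ge0.
  - by move=> x; apply: mulr_ge0; rewrite ?invr_ge0 ?(ltW t0)// mulr_ge0 ?powR_ge0.
  rewrite intZ//; last by move=> x; exact: powR_ge0.
  rewrite intZ//; last 3 first.
  - exact: measurable_mul_fun.
  - by rewrite invr_ge0 ltW.
  - by move=> x; rewrite mulr_ge0 ?powR_ge0.
  have -> : (2 * Cw + 2) * r `^ (- (2 * s)) =
      2 * (Cw * r `^ (- (2 * s))) + t^-1 * (2 * r `^ (- (2 * s) - g)).
    have -> : r `^ (- (2 * s) - g) = r `^ (- (2 * s)) * t.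
      by rewrite /t -powRD// (gt_eqF r0) implybT.
    by field; exact: lt0r_neq0.
  rewrite [leRHS]EFinD; apply: leeD.
    by rewrite [leRHS]EFinM; apply: lee_wpmul2l; [rewrite lee_fin|exact: CwP].
  rewrite [leRHS]EFinM; apply: lee_wpmul2l; last exact: dec.
  by rewrite lee_fin invr_ge0 ltW.
apply: le_trans (lee_wpmul2l _ h) _.
  by rewrite lee_fin mulr_ge0 ?exprn_ge0 ?(ltW r0)// ltW.
rewrite -EFinM lee_fin -rg.
have -> : r `^ (N%:R - 2 * s - g * (1 - b)) =
    r ^+ N * r `^ (- (2 * s)) * r `^ (- g * (1 - b)).
  rewrite -(powR_mulrn _ (ltW r0)) -!powRD ?(gt_eqF r0) ?implybT//.
  by congr (_ `^ _); ring.
by apply: ler_of_eq; ring.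
Qed.
End cutoff_error_decay.

Section small_values.
Context (R : realType) (N : nat) (s : R) (u : 'rV[R]_N -> R).
Local Notation RN := 'rV[R]_N.
Local Notation mu := (@lebesgue_rV R N).
Local Notation a := (N%:R + 2 * s).
Hypotheses (s0 : 0 < s).
Hypotheses (cu : continuous u) (u0 : forall x, 0 <= u x).
Variable g : R.
Hypothesis g0 : 0 < g.
Hypothesis decay : exists2 r1 : R, 0 < r1 & forall r, r1 <= r ->
  (\int[mu]_y (u y * (r + `|y|) `^ (- a))%:E <= (2 * r `^ (- (2 * s) - g))%:E)%E.

Let mes_u : measurable_fun setT u. Proof. exact: continuous_measurable_rV. Qed.

(** A positive lower bound for [u] would make its weighted mass at least of order
[r^(-2s)]. *)
Lemma small_value d : 0 < d -> exists z, u z < d.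
Proof.
move=> d0; apply: contrapT => nz.
have ud x : d <= u x by rewrite leNgt; apply/negP => ux; apply: nz; exists x.
have [r1 r10 dec] := decay.
pose k := d * 2 `^ (- a) * 2 ^+ N.
have k0 : 0 < k by rewrite !mulr_gt0// ?powR_gt0// exprn_gt0.
have [|r2 r20 small] := @powR_small R 2 g k _ g0 k0; first by [].
pose r := r1 + r2.
have r0 : 0 < r by rewrite addr_gt0.
have r1r : r1 <= r by rewrite lerDl ltW.
have r2r : r2 <= r by rewrite lerDr ltW.
have mn : measurable_fun setT (fun y : RN => `|y|) by apply: measurable_norm_rV.
have : ((d * (2 * r) `^ (- a) * (2 * r) ^+ N)%:E <= (2 * r `^ (- (2 * s) - g))%:E)%E.
  apply: le_trans (dec r r1r).
  rewrite -(@ball_int_cst R N 0 r (d * (2 * r) `^ (- a)))//; last first.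
    by rewrite mulr_ge0 ?powR_ge0// ltW.
  apply: le_int.
  - by apply: measurable_if_fun => //; exact: measurable_ball_norm.
  - by apply: measurable_mul_fun => //; apply: measurable_powR_fun; exact: measurable_add_fun.
  - by move=> x; case: ifP => // _; rewrite mulr_ge0 ?powR_ge0// ltW.
  move=> x; rewrite subr0; case: ifPn => xr; last by rewrite mulr_ge0 ?powR_ge0.
  apply: ler_pM; rewrite ?powR_ge0 ?(ltW d0)//; apply: powRNle.
  - exact/ltW/exponent_gt0.
  - by rewrite ltr_pwDl.
  - by move: xr; lra.
rewrite lee_fin leNgt => /negP; apply.
have -> : r `^ (- (2 * s) - g) = r `^ (- a) * r ^+ N * r `^ (- g).
  rewrite -(powR_mulrn _ (ltW r0)) -!powRD ?(gt_eqF r0) ?implybT//.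
  by congr (_ `^ _); ring.
rewrite powRM ?(ltW r0)// exprMn.
have P0 : 0 < r `^ (- a) * r ^+ N by rewrite mulr_gt0 ?powR_gt0// exprn_gt0.
have -> : d * (2 `^ (- a) * r `^ (- a)) * (2 ^+ N * r ^+ N) =
  k * (r `^ (- a) * r ^+ N) by rewrite /k; ring.
rewrite mulrCA mulrC ltr_pM2r//; exact: small.
Qed.
End small_values.

Lemma continuous_ball (R : realType) N (u : 'rV[R]_N -> R) x (P : set R) :
  continuous u -> open P -> P (u x) ->
  exists2 rho, 0 < rho & forall y, `|y - x| <= rho -> P (u y).
Proof.
move=> cu oP Px; have /nbhs_ballP[e /= e0 xe] : nbhs x (u @^-1` P).
  by apply: (cu x); exact: open_nbhs_nbhs.
exists (e / 2); first by rewrite divr_gt0.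
move=> y yx; apply: (xe y); rewrite -ball_normE /ball_/= distrC.
by apply: (le_lt_trans yx); rewrite ltr_pdivrMr// ltr_pMr// ltr1n.
Qed.

Theorem theorem1p2 (R : realType) (N : nat) (s alpha eps p : R)
  (V : 'rV[R]_N -> R)
  (hs : 0 < s < 1) (hN : 2 * s < N%:R) (halpha : 0 < alpha < N%:R)
  (heps : 0 < eps) (hVc : continuous V) (hV0 : forall x, 0 <= V x)
  (hp : 1 < p < 1 + (s + alpha / 2) / (N%:R - 2 * s) \/
        2 <= p < 1 + alpha / (N%:R - 2 * s))
  (hV : limf_esup (fun x : 'rV[R]_N => ((1 + enorm x `^ (2 * s)) * V x)%:E)
          (@enorm_pinfty R N) = 0%E) :
  ~ exists u : 'rV[R]_N -> R,
      [/\ continuous u, (forall x, 0 <= u x), (exists x, u x != 0) &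
          weak_solution s alpha eps p V u].
Proof.
move=> [u [cu u0 [x0 ux0] hu]].
have /andP[s0 s1] := hs; have /andP[_ alphaN] := halpha.
have n0 : 0 < N%:R - 2 * s by rewrite subr_gt0.
have p1 : 1 < p.
  by case: hp => [/andP[]//|/andP[p2 _]]; apply: lt_le_trans p2; rewrite ltr1n.
have Vdecay := potential_decay s0 hV0 hV.
have ux0' : 0 < u x0 by rewrite lt_def ux0 u0.
pose c0 := u x0 / 2; have c00 : 0 < c0 by rewrite divr_gt0.
have [||rho0 rho00 uc0'] := @continuous_ball R N u x0 [set y | c0 < y] cu.
- exact: open_gt.
- by rewrite /= /c0 ltr_pdivrMr// ltr_pMr// ltr1n.
have uc0 y : `|y - x0| <= rho0 -> c0 <= u y by move=> /uc0' /ltW.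
have [g gN hg] : exists2 g, N%:R - 2 * s < g &
    g * (p - 1) < s + alpha / 2 \/ (2 <= p /\ g * (p - 2) < alpha - (N%:R - 2 * s)).
  by apply: exists_rate => //; case: hp => [/andP[_]|]; [left|right].
have g0 : 0 < g by apply: lt_trans gN.
have decay := mass_decay s0 s1 hN heps alphaN p1 hVc hV0 cu u0 hu Vdecay rho00 c00 uc0 hg.
pose n := N%:R - 2 * s.
(* With this [b], [g (1 - b)] is halfway between [n] and [g]. *)
pose b := (1 - n / g) / 2.
have ng : n / g < 1 by rewrite ltr_pdivrMr// mul1r.
have ng0 : 0 < n / g by rewrite divr_gt0.
have b0 : 0 < b by rewrite divr_gt0// subr_gt0.
have b1 : b < 1 by rewrite /b; lra.
have gb : 0 < g * (1 - b) - n.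
  have -> : g * (1 - b) - n = (g - n) / 2 by rewrite /b; field; exact: lt0r_neq0.
  by rewrite divr_gt0// subr_gt0.
have [m [C [r1 [m0 mc0 C0 gain_err]]]] :=
  gain_le_err s0 s1 hN heps hVc hV0 cu u0 hu Vdecay rho00 c00 uc0 b0 b1.
have [C' C'0 [r2 r20 err]] := err_decay s0 s1 cu u0 b0 b1 decay.
have m40 : 0 < m / 4 by rewrite divr_gt0.
have [z uz] := small_value s0 cu u0 g0 decay m40.
have [rho rhop uzb] := @continuous_ball R N u z [set y | y < m / 4] cu (@open_lt R _) uz.
pose D := rho + `|z| + `|x0| + rho0.
have sN : 0 < Num.sqrt N%:R :> R.
  by rewrite sqrtr_gt0; apply: lt_trans hN; rewrite mulr_gt0.
have D0 : 0 < D by rewrite ltr_wpDl// !addr_ge0// ltW.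
pose f0 := (3 / 4 * m) `^ (- b) - m `^ (- b).
have m34 : 0 < 3 / 4 * m by rewrite mulr_gt0.
have f00 : 0 < f0.
  rewrite subr_gt0 !powRN ltf_pV2 ?posrE ?powR_gt0//.
  by apply: gt0_ltr_powR; rewrite ?nnegrE ?(ltW m0) ?(ltW m34)//; lra.
pose k := (Num.sqrt N%:R * D) `^ (- (N%:R + 2 * s)) * (c0 / 2) * (2 * rho0) ^+ N
  * (f0 * (2 * rho) ^+ N).
have k0 : 0 < k.
  apply: mulr_gt0; last by rewrite mulr_gt0// exprn_gt0// mulr_gt0.
  apply: mulr_gt0; last by rewrite exprn_gt0// mulr_gt0.
  by apply: mulr_gt0; [apply: powR_gt0; exact: mulr_gt0|exact: divr_gt0].
have CC0 : 0 <= C * C' by rewrite mulr_ge0// ltW.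
have [r3 r30 smallC] := powR_small CC0 gb k0.
have [|r4 r40 smallt] := @powR_small R 1 g (m / 4) _ g0 m40; first by [].
pose r := (`|r1| + r2 + r3 + r4 + rho + `|z|).
have z0 := normr_ge0 z; have r10 := normr_ge0 r1; have r1n := ler_norm r1.
have [r0 r1r r2r r3r [r4r rzr]] : [/\ 0 < r, r1 <= r, r2 <= r, r3 <= r & r4 <= r /\
    rho + `|z| <= r].
  rewrite /r; clear -z0 r10 r1n r20 r30 r40 rhop; move: `|z| `|r1| z0 r10 r1n => y w.
  by do ! split; lra.
pose t := r `^ (- g); have t0 : 0 < t by exact: powR_gt0.
have tm : t < m / 4 by have := smallt r r4r; rewrite mul1r.
have up : (\int[(@lebesgue_rV R N \x @lebesgue_rV R N)%E]_w
    (gain_density s u 0%R r b (m `^ (- b)) t w)%:E < k%:E)%E.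
  apply: le_lt_trans (gain_err r t r0 r1r t0) _.
  apply: le_lt_trans (lee_wpmul2l _ (err r r2r)) _; first by rewrite lee_fin ltW.
  rewrite -EFinM lte_fin mulrA -/n.
  by have := smallC r r3r; rewrite opprB.
(* The jumps from a small ball about [z], where [u + t <= 3 m / 4], to the ball
about [x0] release a gain that does not depend on [r]. *)
move: up; apply/negP; rewrite -leNgt.
apply: le_trans (gain_ge_mass s0 cu u0 rho00 c00 uc0 b0 r0 t0 m0 mc0 (c := z) (rho := rho) (D := D) _ _).
- rewrite /k EFinM; apply: lee_wpmul2l.
    rewrite lee_fin; apply: mulr_ge0; last by rewrite exprn_ge0// mulr_ge0// ltW.
    by rewrite mulr_ge0 ?powR_ge0// divr_ge0// ltW.
  rewrite -(@ball_int_cst R N z rho f0)//; last exact: ltW.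
  apply: le_int.
  + by apply: measurable_if_fun => //; exact: measurable_ball_norm.
  + apply: measurable_if_fun => //; first exact: measurable_ball_norm.
    apply: measurable_trunc_powN; apply: measurable_add_fun => //; exact: continuous_measurable_rV.
  + by move=> x; case: ifP => // _; exact: ltW.
  move=> x; case: ifPn => // /uzb /= ux.
  apply: (@le_trans _ _ ((u x + t) `^ (- b) - m `^ (- b))); last by rewrite le_max lexx orbT.
  rewrite lerD2r; apply: powRNle; [exact: ltW|by rewrite ltr_wpDl|].
  by clear -tm ux m0; lra.
- move=> x xz; have := ler_normD (x - z) z; rewrite subrK; clear -rzr xz; lra.
- move=> x y xz yx; rewrite /D.
  have h1 := ler_normB x y; have h2 := ler_normD (x - z) z; rewrite subrK in h2.
  have h3 := ler_normD (y - x0) x0; rewrite subrK in h3.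
  by clear -xz yx h1 h2 h3; lra.
Qed.
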